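(* There exist $t\in\mathbb{C}\setminus\mathbb{Z}$ and a simple object $X$ of Deligne's abelian semisimple category $\mathrm{Rep}(S_t,\mathbb{C})$ such that $X$ is of integral type but $X\otimes X$ is not of integral type. In particular, the full subcategory of objects of integral type of a rigid abelian semisimple $\mathbb{C}$-linear $\otimes$-category is not always closed under $\otimes$.
   Context: A $\otimes$-category is an additive, pseudo-abelian (idempotent complete) symmetric monoidal category $\mathcal{A}$ with biadditive $\otimes$, unit object $\mathbf{1}$ and symmetry $\tau$. $\mathcal{A}(X,Y)$ denotes morphisms, and $\mathcal{A}(X)=\mathcal{A}(X,X)$. It is rigid if every object $X$ has a dual $X^\vee$, with evaluation $\varepsilon_X\colon X^\vee\otimes X\to\mathbf{1}$ and coevaluation $\eta_X\colon\mathbf{1}\to X\otimes X^\vee$ satisfying the triangle identities. In a rigid $\otimes$-category the trace of $f\in\mathcal{A}(X)$ is $\mathrm{Tr}(f)=\varepsilon_X\circ\tau_{X,X^\vee}\circ(f\otimes X^\vee)\circ\eta_X\in\mathcal{A}(\mathbf{1})$, and the Euler characteristic of $X$ is $\chi(X)=\mathrm{Tr}(\mathrm{id}_X)$. Integral type: let $\mathcal{A}$ be a rigid $\mathbb{C}$-linear $\otimes$-category with $\mathcal{A}(\mathbf{1})=\mathbb{C}$. An object $X$ is of integral type (equivalently here, geometrically of integral type) if (i) $\mathcal{A}(X)$ is a finite dimensional semisimple $\mathbb{C}$-algebra, and (ii) $\chi(X_i)\in\mathbb{Z}$ for each direct summand $X_i$ of $X$ such that $\mathcal{A}(X_i)$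 is a simple $\mathbb{C}$-algebra. Deligne's category $\mathrm{Rep}(S_t,\mathbb{C})$ (for $t\in\mathbb{C}$) is a rigid $\mathbb{C}$-linear $\otimes$-category which can be described as follows. First take the category with objects $[1]^{\otimes n}$, $n\in\mathbb{N}=\{0,1,2,\dots\}$, in which $\mathrm{Hom}([1]^{\otimes n},[1]^{\otimes m})$ is the $\mathbb{C}$-vector space with basis all set partitions (equivalence relations) of $\{1,\dots,n\}\sqcup\{1',\dots,m'\}$. The composite of a partition $\pi$ from $n$ to $m$ with a partition $\rho$ from $m$ to $l$ is $\rho\circ\pi=t^{k}\sigma$. Here, on the disjoint union of the three sets of sizes $n,m,l$, one takes the equivalence relation generated by $\pi$ and $\rho$; $k$ is the number of its classes contained entirely in the middle set, and $\sigma$ is its restriction to the union of the two outer sets. Composition is extended bilinearly. The tensor product is $[1]^{\otimes n}\otimes[1]^{\otimes m}=[1]^{\otimes(n+m)}$ on objects and disjoint union of partitions on morphisms; the unit is $\mathbf{1}=[1]^{\otimes 0}$; the symmetry is given by the partitions attached to the block-swap permutations. $\mathrm{Rep}(S_t,\mathbb{C})$ is the idempotent completion of the additive envelope of this category. By a theorem of Deligne it is abelian semisimple, with simple objects having endomorphism algebra $\mathbb{C}$, when $t\notin\mathbb{N}$. *)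

(* Defs.v *)
From HB Require Import structures.
From mathcomp Require Import all_boot all_order all_algebra.
From mathcomp Require Import reals.
From mathcomp Require Import complex.

Set Implicit Arguments.
Unset Strict Implicit.
Unset Printing Implicit Defensive.

Import GRing.Theory.
Local Open Scope ring_scope.

Declare Scope cat_scope.
Delimit Scope cat_scope with cat.
Reserved Notation "g ∘ f" (at level 41, right associativity).
Reserved Notation "X ⊗ Y" (at level 38, left associativity).
Reserved Notation "f ⊠ g" (at level 38, left associativity).

Record linCat (K : fieldType) := LinCat {
  obj :> Type;
  hom : obj -> obj -> lmodType K;
  idm : forall X, hom X X;
  mcomp : forall X Y Z, hom Y Z -> hom X Y -> hom X Z;
  mcompA : forall W X Y Z (h : hom Y Z) (g : hom X Y) (f : hom W X),
    mcomp h (mcomp g f) = mcomp (mcomp h g) f;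
  mcomp1l : forall X Y (f : hom X Y), mcomp (idm Y) f = f;
  mcomp1r : forall X Y (f : hom X Y), mcomp f (idm X) = f;
  mcompPl : forall X Y Z (a : K) (g g' : hom Y Z) (f : hom X Y),
    mcomp (a *: g + g') f = a *: mcomp g f + mcomp g' f;
  mcompPr : forall X Y Z (a : K) (g : hom Y Z) (f f' : hom X Y),
    mcomp g (a *: f + f') = a *: mcomp g f + mcomp g f' }.

Arguments hom {K l} X Y.
Arguments idm {K l} X.
Arguments mcomp {K l X Y Z} g f.
Notation "g ∘ f" := (mcomp g f) : cat_scope.
Local Open Scope cat_scope.

(* A symmetric monoidal category with bilinear tensor product, given with the
   inverses of its structural isomorphisms; [f ⊠ g] is the tensor product of
   morphisms, written [X ⊗ Y] on objects.  Since [sym] is involutive, one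
   hexagon is enough. *)
Record symCat (K : fieldType) := SymCat {
  sym_lin :> linCat K;
  tens : sym_lin -> sym_lin -> sym_lin;
  tensm : forall X X' Y Y' : sym_lin,
    hom X X' -> hom Y Y' -> hom (tens X Y) (tens X' Y');
  tunit : sym_lin;
  assoc : forall X Y Z : sym_lin,
    hom (tens (tens X Y) Z) (tens X (tens Y Z));
  assocV : forall X Y Z : sym_lin,
    hom (tens X (tens Y Z)) (tens (tens X Y) Z);
  lunit : forall X : sym_lin, hom (tens tunit X) X;
  lunitV : forall X : sym_lin, hom X (tens tunit X);
  runit : forall X : sym_lin, hom (tens X tunit) X;
  runitV : forall X : sym_lin, hom X (tens X tunit);
  sym : forall X Y : sym_lin, hom (tens X Y) (tens Y X);
  tensm1 : forall X Y : sym_lin, tensm (idm X) (idm Y) = idm (tens X Y);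
  tensm_comp : forall (X X' X'' Y Y' Y'' : sym_lin)
      (f' : hom X' X'') (f : hom X X') (g' : hom Y' Y'') (g : hom Y Y'),
    tensm (f' ∘ f) (g' ∘ g) = tensm f' g' ∘ tensm f g;
  tensmPl : forall (X X' Y Y' : sym_lin) (a : K) (f f' : hom X X')
      (g : hom Y Y'),
    tensm (a *: f + f') g = a *: tensm f g + tensm f' g;
  tensmPr : forall (X X' Y Y' : sym_lin) (a : K) (f : hom X X')
      (g g' : hom Y Y'),
    tensm f (a *: g + g') = a *: tensm f g + tensm f g';
  assocK : forall X Y Z : sym_lin,
    assocV X Y Z ∘ assoc X Y Z = idm (tens (tens X Y) Z);
  assocVK : forall X Y Z : sym_lin,
    assoc X Y Z ∘ assocV X Y Z = idm (tens X (tens Y Z));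
  lunitK : forall X : sym_lin, lunitV X ∘ lunit X = idm (tens tunit X);
  lunitVK : forall X : sym_lin, lunit X ∘ lunitV X = idm X;
  runitK : forall X : sym_lin, runitV X ∘ runit X = idm (tens X tunit);
  runitVK : forall X : sym_lin, runit X ∘ runitV X = idm X;
  symK : forall X Y : sym_lin, sym Y X ∘ sym X Y = idm (tens X Y);
  assoc_nat : forall (X X' Y Y' Z Z' : sym_lin)
      (f : hom X X') (g : hom Y Y') (h : hom Z Z'),
    assoc X' Y' Z' ∘ tensm (tensm f g) h =
      tensm f (tensm g h) ∘ assoc X Y Z;
  lunit_nat : forall (X X' : sym_lin) (f : hom X X'),
    lunit X' ∘ tensm (idm tunit) f = f ∘ lunit X;
  runit_nat : forall (X X' : sym_lin) (f : hom X X'),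
    runit X' ∘ tensm f (idm tunit) = f ∘ runit X;
  sym_nat : forall (X X' Y Y' : sym_lin) (f : hom X X') (g : hom Y Y'),
    sym X' Y' ∘ tensm f g = tensm g f ∘ sym X Y;
  pentagon : forall W X Y Z : sym_lin,
    assoc W X (tens Y Z) ∘ assoc (tens W X) Y Z =
      tensm (idm W) (assoc X Y Z) ∘ assoc W (tens X Y) Z
        ∘ tensm (assoc W X Y) (idm Z);
  triangle : forall X Y : sym_lin,
    tensm (idm X) (lunit Y) ∘ assoc X tunit Y = tensm (runit X) (idm Y);
  hexagon : forall X Y Z : sym_lin,
    assoc Y Z X ∘ sym X (tens Y Z) ∘ assoc X Y Z =
      tensm (idm Y) (sym X Z) ∘ assoc Y X Z ∘ tensm (sym X Y) (idm Z) }.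

Arguments tens {K s} X Y.
Arguments tensm {K s X X' Y Y'} f g.
Arguments tunit {K s}.
Arguments assoc {K s} X Y Z.
Arguments assocV {K s} X Y Z.
Arguments lunit {K s} X.
Arguments lunitV {K s} X.
Arguments runit {K s} X.
Arguments runitV {K s} X.
Arguments sym {K s} X Y.
Notation "X ⊗ Y" := (tens X Y) : cat_scope.
Notation "f ⊠ g" := (tensm f g) : cat_scope.

Record rigidCat (K : fieldType) := RigidCat {
  rigid_sym :> symCat K;
  dual : rigid_sym -> rigid_sym;
  ev : forall X : rigid_sym, hom (dual X ⊗ X) tunit;
  coev : forall X : rigid_sym, hom tunit (X ⊗ dual X);
  rigidl : forall X : rigid_sym,
    runit X ∘ (idm X ⊠ ev X) ∘ assoc X (dual X) X ∘ (coev X ⊠ idm X)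
      ∘ lunitV X = idm X;
  rigidr : forall X : rigid_sym,
    lunit (dual X) ∘ (ev X ⊠ idm (dual X)) ∘ assocV (dual X) X (dual X)
      ∘ (idm (dual X) ⊠ coev X) ∘ runitV (dual X) = idm (dual X) }.

Arguments dual {K r} X.
Arguments ev {K r} X.
Arguments coev {K r} X.

Section CategoryNotions.
Variables (K : fieldType) (A : linCat K).
Implicit Types X Y Z : A.

Definition is_zero_obj X : Prop := idm X = 0.

Definition is_biprod X Y Z (i : hom X Z) (j : hom Y Z)
    (p : hom Z X) (q : hom Z Y) : Prop :=
  [/\ p ∘ i = idm X, q ∘ j = idm Y, p ∘ j = 0, q ∘ i = 0
    & i ∘ p + j ∘ q = idm Z].

Definition is_additive : Prop :=
  (exists Z : A, is_zero_obj Z) /\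
  (forall X Y, exists Z (i : hom X Z) (j : hom Y Z) (p : hom Z X) (q : hom Z Y),
     is_biprod i j p q).

Definition is_pseudo_abelian : Prop :=
  forall X (e : hom X X), e ∘ e = e ->
  exists Y (i : hom Y X) (p : hom X Y), p ∘ i = idm Y /\ i ∘ p = e.

Definition is_mono X Y (f : hom X Y) : Prop :=
  forall W (u v : hom W X), f ∘ u = f ∘ v -> u = v.

Definition is_epi X Y (f : hom X Y) : Prop :=
  forall W (u v : hom Y W), u ∘ f = v ∘ f -> u = v.

Definition is_iso X Y (f : hom X Y) : Prop :=
  exists g : hom Y X, g ∘ f = idm X /\ f ∘ g = idm Y.

Definition is_kernel X Y N (f : hom X Y) (k : hom N X) : Prop :=
  f ∘ k = 0 /\
  forall W (u : hom W X), f ∘ u = 0 -> exists! v : hom W N, k ∘ v = u.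

Definition is_cokernel X Y Q (f : hom X Y) (c : hom Y Q) : Prop :=
  c ∘ f = 0 /\
  forall W (u : hom Y W), u ∘ f = 0 -> exists! v : hom Q W, v ∘ c = u.

Definition is_abelian : Prop :=
  [/\ is_additive,
      forall X Y (f : hom X Y), exists N (k : hom N X), is_kernel f k,
      forall X Y (f : hom X Y), exists Q (c : hom Y Q), is_cokernel f c,
      forall X Y (f : hom X Y), is_mono f ->
        exists Z (g : hom Y Z), is_kernel g f
    & forall X Y (f : hom X Y), is_epi f ->
        exists Z (g : hom Z X), is_cokernel g f].

Definition is_simple X : Prop :=
  ~ is_zero_obj X /\
  forall Y (i : hom Y X), is_mono i -> is_zero_obj Y \/ is_iso i.

Definition is_direct_sum (n : nat) (S : 'I_n -> A) X : Prop :=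
  exists (i : forall k, hom (S k) X) (p : forall k, hom X (S k)),
    [/\ forall k, p k ∘ i k = idm (S k),
        forall k l, k != l -> p k ∘ i l = 0
      & \sum_k i k ∘ p k = idm X].

Definition is_semisimple : Prop :=
  forall X, exists (n : nat) (S : 'I_n -> A),
    (forall k, is_simple (S k)) /\ is_direct_sum S X.

Definition is_direct_summand Y X : Prop :=
  exists Z (i : hom Y X) (j : hom Z X) (p : hom X Y) (q : hom X Z),
    is_biprod i j p q.

Definition fin_dim_hom X Y : Prop :=
  exists (n : nat) (b : 'I_n -> hom X Y),
    forall f, exists c : 'I_n -> K, f = \sum_k c k *: b k.

Definition is_subspace X Y (L : hom X Y -> Prop) : Prop :=
  L 0 /\ forall (a : K) f g, L f -> L g -> L (a *: f + g).

Definition is_left_ideal X (L : hom X X -> Prop) : Prop :=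
  is_subspace L /\ forall g f, L f -> L (g ∘ f).

Definition is_ideal X (L : hom X X -> Prop) : Prop :=
  is_left_ideal L /\ forall g f, L f -> L (f ∘ g).

(* Semisimplicity of the ring [hom X X], as a left module over itself.  It is
   phrased on the endomorphisms directly because [hom X X] is the zero ring
   when [X] is a zero object, which [algType] excludes. *)
Definition semisimple_End X : Prop :=
  forall L : hom X X -> Prop, is_left_ideal L ->
  exists M : hom X X -> Prop,
    [/\ is_left_ideal M,
        forall f, L f -> M f -> f = 0
      & forall f, exists g h, [/\ L g, M h & f = g + h]].

Definition simple_End X : Prop :=
  idm X <> 0 /\
  forall L : hom X X -> Prop, is_ideal L ->
    (forall f, L f -> f = 0) \/ (forall f, L f).

End CategoryNotions.

Section Integral.
Variables (K : fieldType) (A : rigidCat K).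
Implicit Types X Y : A.

Definition trace X (f : hom X X) : hom (tunit : A) tunit :=
  ev X ∘ sym X (dual X) ∘ (f ⊠ idm (dual X)) ∘ coev X.

Definition euler_char X : hom (tunit : A) tunit := trace (idm X).

(* Bijectivity of [a |-> a *: idm tunit] from [K] to [hom tunit tunit]. *)
Definition scalar_unit : Prop :=
  idm (tunit : A) <> 0 /\
  forall f : hom (tunit : A) tunit, exists a : K, f = a *: idm tunit.

Definition is_integral_scalar (f : hom (tunit : A) tunit) : Prop :=
  exists z : int, f = z%:~R *: idm tunit.

Definition is_integral_type X : Prop :=
  [/\ fin_dim_hom X X, semisimple_End X
    & forall Y, is_direct_summand Y X -> simple_End Y ->
        is_integral_scalar (euler_char Y)].

End Integral.

Record rigidTensorCat (K : fieldType) := RigidTensorCat {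
  rtc_rigid :> rigidCat K;
  rtc_additive : is_additive rtc_rigid;
  rtc_pseudo_abelian : is_pseudo_abelian rtc_rigid }.

Lemma linZ (K : fieldType) (U V : lmodType K) (L : U -> V) : 
  linear L -> forall a u, L (a *: u) = a *: L u.
Proof.
move=> lL a u; have L0 : L 0 = 0.
  by have := lL (-1) 0 0; rewrite scaler0 addr0 scaleN1r addNr.
by have := lL a u 0; rewrite L0 !addr0.
Qed.
Section LinCatTheory.
Variables (K : fieldType) (A : linCat K).
Implicit Types X Y Z : A.

Lemma mcompZl X Y Z a (g : hom Y Z) (f : hom X Y) : (a *: g) ∘ f = a *: (g ∘ f).
Proof. exact: (linZ (fun b u v => mcompPl b u v f)). Qed.
Lemma mcompZr X Y Z a (g : hom Y Z) (f : hom X Y) : g ∘ (a *: f) = a *: (g ∘ f).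
Proof. exact: (linZ (fun b u v => mcompPr b g u v)). Qed.
Lemma mcomp0l X Y Z (f : hom X Y) : (0 : hom Y Z) ∘ f = 0.
Proof. by rewrite -[0](scale0r 0) mcompZl !scale0r. Qed.
Lemma mcomp0r X Y Z (g : hom Y Z) : g ∘ (0 : hom X Y) = 0.
Proof. by rewrite -[0](scale0r 0) mcompZr !scale0r. Qed.
Lemma mcompDl X Y Z (g g' : hom Y Z) (f : hom X Y) :
  (g + g') ∘ f = g ∘ f + g' ∘ f.
Proof. by have := mcompPl 1 g g' f; rewrite !scale1r. Qed.
Lemma mcompDr X Y Z (g : hom Y Z) (f f' : hom X Y) :
  g ∘ (f + f') = g ∘ f + g ∘ f'.
Proof. by have := mcompPr 1 g f f'; rewrite !scale1r. Qed.
Lemma mcomp_suml (I : Type) (r : seq I) X Y Z (g : I -> hom Y Z) (f : hom X Y) :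
  (\sum_(i <- r) g i) ∘ f = \sum_(i <- r) g i ∘ f.
Proof. by apply: (big_morph (fun g => g ∘ f)) => [u v|]; rewrite ?mcompDl ?mcomp0l. Qed.
Lemma mcomp_sumr (I : Type) (r : seq I) X Y Z (g : hom Y Z) (f : I -> hom X Y) :
  g ∘ (\sum_(i <- r) f i) = \sum_(i <- r) g ∘ f i.
Proof. by apply: (big_morph (fun f => g ∘ f)) => [u v|]; rewrite ?mcompDr ?mcomp0r. Qed.

Lemma mcompK_r X Y Z (u : hom X Y) (v : hom Y X) (f g : hom Y Z) :
  u ∘ v = idm Y -> f ∘ u = g ∘ u -> f = g.
Proof.
by move=> uv e; rewrite -[f]mcomp1r -[g]mcomp1r -uv !mcompA e.
Qed.
Lemma mcompK_l X Y Z (u : hom Y Z) (v : hom Z Y) (f g : hom X Y) :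
  v ∘ u = idm Y -> u ∘ f = u ∘ g -> f = g.
Proof.
by move=> vu e; rewrite -[f]mcomp1l -[g]mcomp1l -vu -!mcompA e.
Qed.
End LinCatTheory.

Section SymCatTheory.
Variables (K : fieldType) (A : symCat K).
Implicit Types W X Y Z : A.

Lemma tensmZl X X' Y Y' a (f : hom X X') (g : hom Y Y') :
  (a *: f) ⊠ g = a *: (f ⊠ g).
Proof. exact: (linZ (fun b u v => tensmPl b u v g)). Qed.
Lemma tensmZr X X' Y Y' a (f : hom X X') (g : hom Y Y') :
  f ⊠ (a *: g) = a *: (f ⊠ g).
Proof. exact: (linZ (fun b u v => tensmPr b f u v)). Qed.
Lemma tensm0l X X' Y Y' (g : hom Y Y') : (0 : hom X X') ⊠ g = 0.
Proof. by rewrite -[0](scale0r 0) tensmZl !scale0r. Qed.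
Lemma tensm0r X X' Y Y' (f : hom X X') : f ⊠ (0 : hom Y Y') = 0.
Proof. by rewrite -[0](scale0r 0) tensmZr !scale0r. Qed.
Lemma tensmDl X X' Y Y' (f f' : hom X X') (g : hom Y Y') :
  (f + f') ⊠ g = f ⊠ g + f' ⊠ g.
Proof. by have := tensmPl 1 f f' g; rewrite !scale1r. Qed.
Lemma tensmDr X X' Y Y' (f : hom X X') (g g' : hom Y Y') :
  f ⊠ (g + g') = f ⊠ g + f ⊠ g'.
Proof. by have := tensmPr 1 f g g'; rewrite !scale1r. Qed.
Lemma tensm_suml (I : Type) (r : seq I) X X' Y Y' (f : I -> hom X X') (g : hom Y Y') :
  (\sum_(i <- r) f i) ⊠ g = \sum_(i <- r) f i ⊠ g.
Proof. by apply: (big_morph (fun f => f ⊠ g)) => [u v|]; rewrite ?tensmDl ?tensm0l. Qed.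
Lemma tensm_sumr (I : Type) (r : seq I) X X' Y Y' (f : hom X X') (g : I -> hom Y Y') :
  f ⊠ (\sum_(i <- r) g i) = \sum_(i <- r) f ⊠ g i.
Proof. by apply: (big_morph (fun g => f ⊠ g)) => [u v|]; rewrite ?tensmDr ?tensm0r. Qed.

Lemma tensm_sum2 (I J : Type) (r : seq I) (s : seq J) X X' Y Y'
    (f : I -> hom X X') (g : J -> hom Y Y') :
  (\sum_(i <- r) f i) ⊠ (\sum_(j <- s) g j) =
  \sum_(i <- r) \sum_(j <- s) f i ⊠ g j.
Proof. by rewrite tensm_suml; apply: eq_bigr => i _; rewrite tensm_sumr. Qed.

Lemma tensm_compl X X' X'' Y (f' : hom X' X'') (f : hom X X') :
  (f' ∘ f) ⊠ idm Y = (f' ⊠ idm Y) ∘ (f ⊠ idm Y).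
Proof. by rewrite -tensm_comp mcomp1l. Qed.
Lemma tensm_compr X X' X'' Y (f' : hom X' X'') (f : hom X X') :
  idm Y ⊠ (f' ∘ f) = (idm Y ⊠ f') ∘ (idm Y ⊠ f).
Proof. by rewrite -tensm_comp mcomp1l. Qed.
Lemma tensm_lr X X' Y Y' (f : hom X X') (g : hom Y Y') :
  f ⊠ g = (f ⊠ idm Y') ∘ (idm X ⊠ g).
Proof. by rewrite -tensm_comp mcomp1l mcomp1r. Qed.
Lemma tensm_rl X X' Y Y' (f : hom X X') (g : hom Y Y') :
  f ⊠ g = (idm X' ⊠ g) ∘ (f ⊠ idm Y).
Proof. by rewrite -tensm_comp mcomp1l mcomp1r. Qed.

Lemma assocV_nat X X' Y Y' Z Z' (f : hom X X') (g : hom Y Y') (h : hom Z Z') :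
  assocV X' Y' Z' ∘ (f ⊠ (g ⊠ h)) = ((f ⊠ g) ⊠ h) ∘ assocV X Y Z.
Proof.
apply: (mcompK_l (assocK _ _ _)); rewrite !mcompA assocVK mcomp1l assoc_nat.
by rewrite -mcompA assocVK mcomp1r.
Qed.
Lemma lunitV_nat X X' (f : hom X X') :
  lunitV X' ∘ f = (idm tunit ⊠ f) ∘ lunitV X.
Proof.
apply: (mcompK_l (lunitK _)).
by rewrite !mcompA lunitVK mcomp1l lunit_nat -mcompA lunitVK mcomp1r.
Qed.
Lemma runitV_nat X X' (f : hom X X') :
  runitV X' ∘ f = (f ⊠ idm tunit) ∘ runitV X.
Proof.
apply: (mcompK_l (runitK _)).
by rewrite !mcompA runitVK mcomp1l runit_nat -mcompA runitVK mcomp1r.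
Qed.

Lemma tens1_inj X Y (f g : hom X Y) : idm tunit ⊠ f = idm tunit ⊠ g -> f = g.
Proof.
move=> e; apply: (mcompK_r (lunitVK X)).
by rewrite -!lunit_nat e.
Qed.
Lemma tensr1_inj X Y (f g : hom X Y) : f ⊠ idm tunit = g ⊠ idm tunit -> f = g.
Proof.
move=> e; apply: (mcompK_r (runitVK X)).
by rewrite -!runit_nat e.
Qed.

Lemma lunit_tens X Y : lunit (X ⊗ Y) ∘ assoc tunit X Y = lunit X ⊠ idm Y.
Proof.
apply: tens1_inj.
have k1 := assocVK tunit (tunit ⊗ X) Y.
have k2 : (assoc tunit tunit X ⊠ idm Y) ∘ (assocV tunit tunit X ⊠ idm Y) = idm _.
  by rewrite -tensm_compl assocVK tensm1.
apply: (mcompK_r k1); apply: (mcompK_r k2).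
rewrite tensm_compr -!mcompA -pentagon mcompA triangle.
rewrite -[in LHS](tensm1 X Y) -assoc_nat.
by rewrite [RHS]mcompA -assoc_nat -mcompA -tensm_compl triangle.
Qed.

Lemma runit_tens X Y : (idm X ⊠ runit Y) ∘ assoc X Y tunit = runit (X ⊗ Y).
Proof.
apply/esym/tensr1_inj.
apply: (mcompK_l (assocK X Y tunit)).
rewrite -triangle mcompA -{1}tensm1 assoc_nat -mcompA pentagon.
rewrite mcompA -tensm_compr triangle.
by rewrite mcompA -assoc_nat -mcompA -tensm_compl.
Qed.

Lemma lunit_runit_one : lunit tunit = runit tunit :> hom (tunit ⊗ (tunit : A)) tunit.
Proof.
apply: tensr1_inj; rewrite -lunit_tens -triangle; congr (_ ∘ _).
by apply: (mcompK_l (lunitK tunit)); rewrite lunit_nat.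
Qed.

End SymCatTheory.

Section RigidTheory.
Variables (K : fieldType) (A : rigidCat K).
Implicit Types D X Y Z : A.

(* [adjm u] corresponds to [u] under Hom(D ⊗ X, 1) = Hom(D, X^dual). *)
Definition adjm D X (u : hom (D ⊗ X) tunit) : hom D (dual X) :=
  lunit (dual X) ∘ (u ⊠ idm (dual X)) ∘ assocV D X (dual X)
    ∘ (idm D ⊠ coev X) ∘ runitV D.

Lemma adjmK D X (u : hom (D ⊗ X) tunit) : ev X ∘ (adjm u ⊠ idm X) = u.
Proof.
rewrite /adjm !tensm_compl mcompA -lunit_tens.
rewrite !mcompA -lunit_nat -!mcompA.
rewrite [assoc _ _ _ ∘ _]mcompA assoc_nat -!mcompA [(_ ⊠ _) ∘ (_ ⊠ _ ∘ _)]mcompA.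
rewrite tensm1 -tensm_rl tensm_lr lunit_runit_one !mcompA runit_nat -!mcompA.
have e1 : assoc (D ⊗ X) (dual X) X ∘ (assocV D X (dual X) ⊠ idm X) =
   assocV D X (dual X ⊗ X) ∘ (idm D ⊠ assoc X (dual X) X)
     ∘ assoc D (X ⊗ dual X) X.
  apply: (mcompK_l (assocK _ _ _)); rewrite !mcompA assocVK mcomp1l pentagon.
  by rewrite -!mcompA -tensm_compl assocVK tensm1 mcomp1r.
rewrite [assoc (D ⊗ X) _ _ ∘ _]mcompA e1 -!mcompA.
rewrite [assoc D _ X ∘ _]mcompA assoc_nat.
have e2 : assoc D tunit X ∘ (runitV D ⊠ idm X) = idm D ⊠ lunitV X.
  have k : (idm D ⊠ lunitV X) ∘ (idm D ⊠ lunit X) = idm _.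
    by rewrite -tensm_compr lunitK tensm1.
  apply: (mcompK_l k).
  by rewrite mcompA triangle -tensm_compl runitVK -tensm_compr lunitVK !tensm1.
rewrite -!mcompA e2.
have e3 : (idm (D ⊗ X) ⊠ ev X) ∘ assocV D X (dual X ⊗ X) =
    assocV D X tunit ∘ (idm D ⊠ (idm X ⊠ ev X)).
  by rewrite assocV_nat tensm1.
rewrite [(idm (D ⊗ X) ⊠ _) ∘ _]mcompA e3 -!mcompA -!tensm_compr.
have e4 : runit (D ⊗ X) ∘ assocV D X tunit = idm D ⊠ runit X.
  by rewrite -runit_tens -mcompA assocVK mcomp1r.
rewrite [runit _ ∘ _]mcompA e4 -tensm_compr rigidl tensm1 mcomp1r //.
Qed.

Lemma adjm_unique D X (g : hom D (dual X)) : adjm (ev X ∘ (g ⊠ idm X)) = g.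
Proof.
rewrite /adjm tensm_compl -!mcompA [((_ ⊠ _) ⊠ _) ∘ _]mcompA -assocV_nat.
rewrite -!mcompA [(_ ⊠ _) ∘ (_ ⊠ _) ∘ _]mcompA tensm1 -tensm_lr [g ⊠ _]tensm_rl -!mcompA.
by rewrite -runitV_nat -[RHS]mcomp1l -[in RHS]rigidr -!mcompA.
Qed.

Lemma dual_ext D X (g g' : hom D (dual X)) :
  ev X ∘ (g ⊠ idm X) = ev X ∘ (g' ⊠ idm X) -> g = g'.
Proof. by move=> e; rewrite -[g]adjm_unique -[g']adjm_unique e. Qed.

Definition transp X Y (f : hom X Y) : hom (dual Y) (dual X) :=
  adjm (ev Y ∘ (idm (dual Y) ⊠ f)).

Lemma transpE X Y (f : hom X Y) :
  ev X ∘ (transp f ⊠ idm X) = ev Y ∘ (idm (dual Y) ⊠ f).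
Proof. exact: adjmK. Qed.

Lemma transp_comp X Y Z (g : hom Y Z) (f : hom X Y) :
  transp (g ∘ f) = transp f ∘ transp g.
Proof.
apply: dual_ext; rewrite transpE tensm_compl mcompA transpE -mcompA.
by rewrite -tensm_rl [transp g ⊠ _]tensm_lr mcompA transpE -mcompA -tensm_compr.
Qed.

End RigidTheory.

Definition spart (T : finType) := {P : {set {set T}} | partition P [set: T]}.

Definition prel (T : finType) (P : spart T) : rel T :=
  fun x y => y \in pblock (val P) x.

Lemma equivalence_partition_setT (T : finType) (e : rel T) :
  equivalence_rel e -> partition (equivalence_partition e [set: T]) [set: T].
Proof. by move=> ee; apply/equivalence_partitionP => x y z _ _ _; apply: ee. Qed.

Definition spart_of (T : finType) (e : rel T) (ee : equivalence_rel e) :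
    spart T :=
  exist _ (equivalence_partition e [set: T]) (equivalence_partition_setT ee).

Definition kerpart (T : finType) (U : eqType) (f : T -> U) : spart T :=
  exist _ (preim_partition f [set: T]) (preim_partitionP f [set: T]).

Section Glue.
Variables (A B C : finType) (P : spart (A + B)%type) (Q : spart (B + C)%type).

Definition low_in (x : A + B) : A + B + C := inl x.
Definition up_in (x : B + C) : A + B + C :=
  match x with inl b => inl (inr b) | inr c => inr c end.
Definition out_in (x : A + C) : A + B + C :=
  match x with inl a => inl (inl a) | inr c => inr c end.

Definition glink : rel (A + B + C)%type := fun u v =>
  [exists x, exists y, [&& low_in x == u, low_in y == v & prel P x y]] ||
  [exists x, exists y, [&& up_in x == u, up_in y == v & prel Q x y]].

(* The equivalence relation generated by [P] and [Q] on the disjoint union of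
   the three sets.  [ploop] counts its classes contained in the middle set [B],
   and [pcomp] is its restriction to the two outer sets. *)
Definition glue : rel (A + B + C)%type := connect glink.

Definition ploop : nat :=
  #|[set D in equivalence_partition glue [set: A + B + C] |
      [forall x, out_in x \notin D]]|.

Lemma prel_equiv (T : finType) (R : spart T) : equivalence_rel (prel R).
Proof.
case: R => R pR x y z.
by apply: (pblock_equivalence pR); rewrite inE.
Qed.

Lemma prel_refl (T : finType) (R : spart T) x : prel R x x.
Proof. by have [] := prel_equiv R x x x. Qed.

Lemma prel_sym (T : finType) (R : spart T) : symmetric (prel R).
Proof. by have /equivalence_relP[_ r] := @prel_equiv _ R; apply/symmetric_from_pre => x y h; rewrite -(r _ _ h) prel_refl. Qed.

Lemma glink_sym : symmetric glink.
Proof.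
apply/symmetric_from_pre => u v /orP[] /existsP[x /existsP[y /and3P[xu yv r]]];
  apply/orP; [left|right]; apply/existsP; exists y; apply/existsP; exists x;
  by rewrite xu yv prel_sym.
Qed.

Lemma glue_equiv : equivalence_rel glue.
Proof.
apply/equivalence_relP; split; first exact: connect0.
by move=> x y /(same_connect (sym_connect_sym glink_sym)).
Qed.

Lemma pcomp_equiv : equivalence_rel (fun x y : A + C => glue (out_in x) (out_in y)).
Proof. by move=> x y z; apply: glue_equiv. Qed.

Definition pcomp : spart (A + C)%type := spart_of pcomp_equiv.

End Glue.

Lemma prel_spart_of (T : finType) (e : rel T) (ee : equivalence_rel e) x y :
  prel (spart_of ee) x y = e x y.
Proof.
by rewrite /prel /= pblock_equivalence_partition ?inE // => u v w _ _ _; apply: ee.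
Qed.

Lemma prel_kerpart (T : finType) (U : eqType) (f : T -> U) x y :
  prel (kerpart f) x y = (f x == f y).
Proof.
rewrite /prel /= pblock_equivalence_partition ?inE // => u v w _ _ _.
by split=> // /eqP->.
Qed.

Lemma prel_inj (T : finType) (P Q : spart T) : prel P =2 prel Q -> P = Q.
Proof.
case: P Q => P pP [Q pQ] h; apply/val_inj => /=.
rewrite -(equivalence_partition_pblock pP) -(equivalence_partition_pblock pQ).
apply: eq_imset => x; apply/setP => y; rewrite !inE /=; exact: h.
Qed.

(* Two-colourings.  A partition [P] of [A + B] acts as the 0/1-matrix [pmx P]
   indexed by colourings of [A] and of [B]; this representation is faithful
   (also on the number of closed components), and is used below only to check
   the category axioms. *)
Definition pcol (T : finType) (P : spart T) (c : T -> bool) : bool :=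
  [forall x, forall y, prel P x y ==> (c x == c y)].

Definition scol (A B : Type) (a : A -> bool) (b : B -> bool) (x : A + B) : bool :=
  match x with inl i => a i | inr j => b j end.

Definition pmx (A B : finType) (P : spart (A + B)%type)
  (a : A -> bool) (b : B -> bool) : bool := pcol P (scol a b).

Lemma pcolP (T : finType) (P : spart T) (c : T -> bool) :
  reflect (forall x y, prel P x y -> c x = c y) (pcol P c).
Proof.
apply: (iffP forallP) => [h x y r|h x].
  by have /forallP/(_ y)/implyP/(_ r)/eqP := h x.
by apply/forallP => y; apply/implyP => /h ->.
Qed.

Lemma eq_pcol (T : finType) (P : spart T) (c d : T -> bool) :
  c =1 d -> pcol P c = pcol P d.
Proof.
by move=> cd; apply/pcolP/pcolP => h x y /h; rewrite !cd.
Qed.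

Lemma eq_pmx (A B : finType) (P : spart (A + B)%type) a a' b b' :
  a =1 a' -> b =1 b' -> pmx P a b = pmx P a' b'.
Proof. by move=> aa bb; apply: eq_pcol => -[i|j] /=. Qed.

Lemma pmx_inj (A B : finType) (P P' : spart (A + B)%type) k k' :
  (forall (a : {ffun A -> bool}) (b : {ffun B -> bool}),
     2 ^ k * pmx P a b = 2 ^ k' * pmx P' a b)%N -> k = k' /\ P = P'.
Proof.
move=> h.
have hk : k = k'.
  have := h [ffun=> true] [ffun=> true].
  have t R : pmx R ([ffun=> true] : {ffun A -> bool}) ([ffun=> true] : {ffun B -> bool}).
    by apply/pcolP => -[x|x] [y|y] _ /=; rewrite !ffunE.
  by rewrite !t !muln1 => /eqP; rewrite eqn_exp2l // => /eqP.
split=> //; subst k'.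
have {}h c : pcol P c = pcol P' c.
  have := h [ffun i => c (inl i)] [ffun i => c (inr i)].
  move/eqP; rewrite eqn_pmul2l ?expn_gt0 // => /eqP.
  have e R : pmx R ([ffun i => c (inl i)] : {ffun A -> bool})
                   ([ffun i => c (inr i)] : {ffun B -> bool}) = pcol R c.
    by apply: eq_pcol => -[i|i] /=; rewrite ffunE.
  by rewrite !e; case: pcol; case: pcol.
have H (R R' : spart (A + B)%type) :
    (forall c, pcol R c -> pcol R' c) -> forall x y, prel R' x y -> prel R x y.
  move=> hc x y r'.
  have /hc/pcolP/(_ x y r') : pcol R (prel R x).
    apply/pcolP => u v r; rewrite ![prel R x _]prel_sym.
    by have [_ ->] := prel_equiv R u v x.
  by rewrite prel_refl.
apply: prel_inj => x y; apply/idP/idP; apply: H => c; by rewrite h.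
Qed.

Section GlueColour.
Variables (A B C : finType) (P : spart (A + B)%type) (Q : spart (B + C)%type).
Variables (a : A -> bool) (c : C -> bool).
Notation G := (glue P Q).
Notation T := (A + B + C)%type.
Let G_sym : symmetric G := sym_connect_sym (@glink_sym _ _ _ P Q).
Let G_refl x : G x x := connect0 _ x.
Let QP := equivalence_partition G [set: T].
Let partQP : partition QP [set: T] := equivalence_partition_setT (@glue_equiv _ _ _ P Q).
Let Mid := [set D in QP | [forall x, out_in B x \notin D]].
Let mid (y : B) : T := inl (inr y).

Definition tricol (b : B -> bool) : T -> bool := scol (scol a b) c.

Lemma tricolP b :
  reflect (forall u v, G u v -> tricol b u = tricol b v) (pmx P a b && pmx Q b c).
Proof.
apply: (iffP andP) => [[/pcolP hP /pcolP hQ] u v|h].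
  case/connectP => p; elim: p u => [|w p IH] u /=; first by move=> _ ->.
  case/andP => l pw e; rewrite -(IH _ pw e) {pw e IH}.
  case/orP: l => /existsP[x /existsP[y /and3P[/eqP <- /eqP <- r]]].
    exact: hP r.
  move/hQ: r; by case: x y => [x|x] [y|y].
split; apply/pcolP => x y r.
  apply: (h (low_in C x) (low_in C y)); apply: connect1; apply/orP; left.
  by apply/existsP; exists x; apply/existsP; exists y; rewrite !eqxx.
have /h : G (up_in A x) (up_in A y).
  apply: connect1; apply/orP; right.
  by apply/existsP; exists x; apply/existsP; exists y; rewrite !eqxx.
by case: x y {r} => [x|x] [y|y].
Qed.

Lemma pblock_glue u v : (v \in pblock QP u) = G u v.
Proof.
rewrite pblock_equivalence_partition ?inE // => x y z _ _ _.
exact: glue_equiv.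
Qed.

Let mem_pb u : pblock QP u \in QP.
Proof. by apply: pblock_mem; rewrite (cover_partition partQP) inE. Qed.

Let eq_pb u v : G u v -> pblock QP u = pblock QP v.
Proof.
move=> g; apply/setP => w; rewrite !pblock_glue.
exact: (same_connect (sym_connect_sym (@glink_sym _ _ _ P Q)) g).
Qed.

Let colf (S : {set {set T}}) (u : T) : bool :=
  if [pick x | G u (out_in B x)] is Some x then scol a c x
  else pblock QP u \in S.

Let colb S : {ffun B -> bool} := [ffun y => colf S (mid y)].

Lemma glue_count :
  (\sum_(b : {ffun B -> bool}) pmx P a b * pmx Q b c
   = 2 ^ ploop P Q * pmx (pcomp P Q) a c)%N.
Proof.
have -> : (\sum_(b : {ffun B -> bool}) pmx P a b * pmx Q b c)%N =
          #|[set b : {ffun B -> bool} | pmx P a b && pmx Q b c]|.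
  rewrite -sum1_card [RHS]big_mkcond /=; apply: eq_bigr => b _.
  by rewrite inE mulnb; case: (_ && _).
case: (boolP (pmx (pcomp P Q) a c)) => [/pcolP hout|hout]; last first.
  rewrite muln0; apply/eqP; rewrite cards_eq0; apply/eqP/setP => b; rewrite !inE.
  apply/negP => /tricolP h; case/negP: hout; apply/pcolP => x y.
  rewrite prel_spart_of => /h.
  by case: x y => [x|x] [y|y].
have hout' x y : G (out_in B x) (out_in B y) -> scol a c x = scol a c y.
  by move=> g; apply: hout; rewrite prel_spart_of.
rewrite muln1 -card_powerset -(card_in_imset (f := colb)); last first.
  move=> S S'; rewrite !powersetE => /subsetP SM /subsetP SM' /ffunP e.
  have H (R R' : {set {set T}}) : {subset R <= Mid} -> colb R =1 colb R' -> {subset R <= R'}.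
    move=> RM ee D DR; have := RM _ DR; rewrite inE => /andP[DQ /forallP Do].
    have /set0Pn[u uD] := partition_neq0 partQP DQ.
    have Du : D = pblock QP u.
      by rewrite (def_pblock (partition_trivIset partQP) DQ uD).
    case: u uD Du => [[u|u]|u] uD Du.
    - by have := Do (inl u); rewrite uD.
    - have := ee u; rewrite !ffunE /colf; case: pickP => [x|_].
        by rewrite -pblock_glue -Du (negbTE (Do x)).
      by rewrite -Du DR => <-.
    - by have := Do (inr u); rewrite uD.
  by apply/setP => D; apply/idP/idP; apply: H.
congr #|pred_of_set _|; apply/setP => b; rewrite inE; apply/tricolP/imsetP => [h|].
  pose S := [set D in Mid | [exists y, (mid y \in D) && b y]].
  exists S; first by rewrite powersetE; apply/subsetP => D; rewrite inE => /andP[].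
  apply/ffunP => y; rewrite ffunE /colf; case: pickP => [x g|no].
    have := h _ _ g; rewrite /mid /=; by case: x g.
  have -> : pblock QP (mid y) \in Mid = true -> (pblock QP (mid y) \in S) = b y.
    move=> e; rewrite inE e /=; apply/existsP/idP => [[z]|by_].
      by rewrite pblock_glue => /andP[/h]; rewrite /mid /= => ->.
    by exists y; rewrite pblock_glue G_refl.
    by [].
  by rewrite inE mem_pb; apply/forallP => x; rewrite pblock_glue no.
case=> S _ ->.
have colfE u : tricol (colb S) u = colf S u.
  have O x : colf S (out_in B x) = scol a c x.
    rewrite /colf; case: pickP => [x' /hout' //|/(_ x)]; by rewrite G_refl.
  case: u => [[u|u]|u] /=; first exact: esym (O (inl u)).
    by rewrite ffunE.
  exact: esym (O (inr u)).
move=> u v g; rewrite !colfE /colf (eq_pb g).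
rewrite (eq_pick (Q := fun x => G v (out_in B x))) // => x.
exact: (same_connect (sym_connect_sym (@glink_sym _ _ _ P Q)) g).
Qed.

End GlueColour.

(* The disjoint union of a partition from [n1] to [m1] and one from [n2] to
   [m2] lives on ['I_(n1 + n2) + 'I_(m1 + m2)]; [sort_sum] separates the two
   parts. *)
Definition sort_sum (n1 n2 m1 m2 : nat) (x : 'I_(n1 + n2) + 'I_(m1 + m2)) :
    ('I_n1 + 'I_m1) + ('I_n2 + 'I_m2) :=
  match x with
  | inl i => match split i with inl j => inl (inl j) | inr j => inr (inl j) end
  | inr i => match split i with inl j => inl (inr j) | inr j => inr (inr j) end
  end.

Section Ptens.
Variables (n1 n2 m1 m2 : nat).
Variables (P : spart ('I_n1 + 'I_m1)%type) (Q : spart ('I_n2 + 'I_m2)%type).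

Definition ptens_rel : rel ('I_(n1 + n2) + 'I_(m1 + m2))%type := fun x y =>
  match sort_sum x, sort_sum y with
  | inl u, inl v => prel P u v
  | inr u, inr v => prel Q u v
  | _, _ => false
  end.

Lemma ptens_equiv : equivalence_rel ptens_rel.
Proof.
move=> x y z; rewrite /ptens_rel.
case: (sort_sum x) (sort_sum y) (sort_sum z) => [u|u] [v|v] [w|w] //;
  rewrite ?prel_refl; split=> // h.
  by have [_ ->] := prel_equiv P u v w.
by have [_ ->] := prel_equiv Q u v w.
Qed.

Definition ptens : spart ('I_(n1 + n2) + 'I_(m1 + m2))%type :=
  spart_of ptens_equiv.

Lemma pmx_ptens (a : 'I_(n1 + n2) -> bool) (b : 'I_(m1 + m2) -> bool) :
  pmx ptens a b =
    pmx P (a \o lshift n2) (b \o lshift m2) &&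
    pmx Q (a \o rshift n1 (n:=n2)) (b \o rshift m1 (n:=m2)).
Proof.
pose unsort (x : ('I_n1 + 'I_m1) + ('I_n2 + 'I_m2)) : 'I_(n1 + n2) + 'I_(m1 + m2) :=
  match x with
  | inl (inl i) => inl (lshift _ i) | inl (inr i) => inr (lshift _ i)
  | inr (inl i) => inl (rshift _ i) | inr (inr i) => inr (rshift _ i)
  end.
have sortK x : sort_sum (unsort x) = x.
  by case: x => -[i|i] /=; rewrite ?(unsplitK (inl i)) ?(unsplitK (inr i)).
have unsortK x : unsort (sort_sum x) = x.
  by case: x => i /=; case: split_ordP => j -> /=.
apply/pcolP/andP => [h|[/pcolP hP /pcolP hQ] x y].
  split; apply/pcolP => x y r.
    have := h (unsort (inl x)) (unsort (inl y)).
    rewrite prel_spart_of /ptens_rel !sortK => /(_ r).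
    by case: x y {r} => [x|x] [y|y].
  have := h (unsort (inr x)) (unsort (inr y)).
  rewrite prel_spart_of /ptens_rel !sortK => /(_ r).
  by case: x y {r} => [x|x] [y|y].
rewrite prel_spart_of /ptens_rel -[in scol a b x](unsortK x) -[in scol a b y](unsortK y).
case: (sort_sum x) (sort_sum y) => [u|u] [v|v] //.
  by move/hP; case: u v => [u|u] [v|v].
by move/hQ; case: u v => [u|u] [v|v].
Qed.

End Ptens.

Lemma sum_ffun_split (n m : nat) (F : ('I_n -> bool) -> nat) (G : ('I_m -> bool) -> nat) :
  (forall f f', f =1 f' -> F f = F f') -> (forall f f', f =1 f' -> G f = G f') ->
  (\sum_(b : {ffun 'I_(n + m) -> bool}) F (b \o lshift m) * G (b \o rshift n (n:=m))
   = (\sum_(b : {ffun 'I_n -> bool}) F b) * (\sum_(b : {ffun 'I_m -> bool}) G b))%N.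
Proof.
move=> eF eG; rewrite big_distrlr pair_bigA /=.
pose h (p : {ffun 'I_n -> bool} * {ffun 'I_m -> bool}) : {ffun 'I_(n + m) -> bool} :=
  [ffun i => match split i with inl j => p.1 j | inr j => p.2 j end].
pose h' (b : {ffun 'I_(n + m) -> bool}) : {ffun 'I_n -> bool} * {ffun 'I_m -> bool} :=
  ([ffun i => b (lshift m i)], [ffun i => b (rshift n i)]).
rewrite (reindex h); last first.
  exists h' => [[p q]|b] _ /=.
    by congr pair; apply/ffunP => i; rewrite !ffunE ?(unsplitK (inl i)) ?(unsplitK (inr i)).
  by apply/ffunP => i; rewrite !ffunE; case: split_ordP => j ->; rewrite ffunE.
apply: eq_bigr => -[p q] _; congr (_ * _)%N; [apply: eF|apply: eG] => i /=;
  by rewrite ffunE ?(unsplitK (inl i)) ?(unsplitK (inr i)).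
Qed.

Section BilinearExtension.
Variables (K : fieldType).

Definition pbas (T : finType) (x : T) : {ffun T -> K^o} :=
  [ffun y => (y == x)%:R].

Definition bilext (T U : finType) (V : lmodType K) (F : T -> U -> V)
    (f : {ffun T -> K^o}) (g : {ffun U -> K^o}) : V :=
  \sum_x \sum_y ((f x : K) * g y) *: F x y.

Lemma bilextPl (T U : finType) (V : lmodType K) (F : T -> U -> V) g : linear (bilext F ^~ g).
Proof.
move=> a f f'; rewrite /bilext scaler_sumr -big_split /=; apply: eq_bigr => x _.
rewrite scaler_sumr -big_split /=; apply: eq_bigr => y _.
by rewrite !ffunE scalerA -scalerDl mulrDl mulrA.
Qed.

Lemma bilextPr (T U : finType) (V : lmodType K) (F : T -> U -> V) f : linear (bilext F f).
Proof.
move=> a g g'; rewrite /bilext scaler_sumr -big_split /=; apply: eq_bigr => x _.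
rewrite scaler_sumr -big_split /=; apply: eq_bigr => y _.
by rewrite !ffunE scalerA -scalerDl mulrDr mulrCA.
Qed.

Lemma bilext_bas (T U : finType) (V : lmodType K) (F : T -> U -> V) x y :
  bilext F (pbas x) (pbas y) = F x y.
Proof.
rewrite /bilext (bigD1 x) //= (bigD1 y) //= !ffunE !eqxx mulr1 scale1r.
rewrite !big1 ?addr0 // => [x' /negbTE n|y' /negbTE n].
  by rewrite big1 // => y' _; rewrite !ffunE n mul0r scale0r.
by rewrite !ffunE n mulr0 scale0r.
Qed.

Lemma pbas_dec (T : finType) (f : {ffun T -> K^o}) : f = \sum_x f x *: pbas x.
Proof.
apply/ffunP => y; rewrite sum_ffunE (bigD1 y) //= big1 ?addr0 => [|x n].
  by rewrite !ffunE eqxx [_ *: _]mulr1.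
by rewrite !ffunE eq_sym (negbTE n) scaler0.
Qed.

Lemma lin_ext (T : finType) (V : lmodType K) (L R : {ffun T -> K^o} -> V) :
  linear L -> linear R -> (forall x, L (pbas x) = R (pbas x)) -> L =1 R.
Proof.
move=> lL lR h f.
have H (M : {ffun T -> K^o} -> V) : linear M -> M f = \sum_x f x *: M (pbas x).
  move=> lM.
  have M0 : M 0 = 0 by have := lM (-1) 0 0; rewrite scaler0 addr0 scaleN1r addNr.
  have MD u v : M (u + v) = M u + M v by have := lM 1 u v; rewrite !scale1r.
  have MZ a u : M (a *: u) = a *: M u by have := lM a u 0; rewrite M0 !addr0.
  rewrite {1}(pbas_dec f) (big_morph M MD M0); apply: eq_bigr => x _; exact: MZ.
by rewrite (H L) // (H R) //; apply: eq_bigr => x _; rewrite h.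
Qed.

End BilinearExtension.
Arguments pbas {K T} x.

Section PartitionCategory.
Variables (K : fieldType) (t : K).

Definition phom (n m : nat) : lmodType K := {ffun spart ('I_n + 'I_m)%type -> K^o}.

(* The blocks are the sets formed by [j] in the target and its preimage under
   [phi]; for a bijection this is the usual permutation diagram. *)
Definition pgraph (n m : nat) (phi : 'I_n -> 'I_m) : spart ('I_n + 'I_m)%type :=
  kerpart (fun x : 'I_n + 'I_m => match x with inl i => phi i | inr j => j end).

Definition pmap (n m : nat) (phi : 'I_n -> 'I_m) : phom n m := pbas (pgraph phi).

Definition pidm (n : nat) : phom n n := pmap id.

Definition pmcomp (n m l : nat) (g : phom m l) (f : phom n m) : phom n l :=
  bilext (fun P Q => t ^+ ploop P Q *: pbas (pcomp P Q) : phom n l) f g.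

Definition ptensm (n n' m m' : nat) (f : phom n n') (g : phom m m') :
    phom (n + m) (n' + m') :=
  bilext (fun P Q => pbas (ptens P Q) : phom (n + m) (n' + m')) f g.

Definition swap_ord (n m : nat) (i : 'I_(n + m)) : 'I_(m + n) :=
  match split i with inl j => rshift m j | inr j => lshift n j end.

Definition fold_ord (n : nat) (i : 'I_(n + n)) : 'I_n :=
  match split i with inl j => j | inr j => j end.

(* Every object is its own dual; the evaluation and the coevaluation pair the
   i-th elements of the two copies. *)
Definition pev (n : nat) : phom (n + n) 0 :=
  pbas (kerpart (fun x : 'I_(n + n) + 'I_0 =>
    match x with inl i => fold_ord i : nat | inr _ => 0%N end)).

Definition pcoev (n : nat) : phom 0 (n + n) :=
  pbas (kerpart (fun x : 'I_0 + 'I_(n + n) =>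
    match x with inl _ => 0%N | inr i => fold_ord i : nat end)).

(* [mrep f M]: [f] is a multiple of a partition, represented by the matrix [M]. *)
Notation colour n := {ffun 'I_n -> bool}.
Definition mrep n m (f : phom n m) (M : colour n -> colour m -> nat) : Prop :=
  exists k P, f = t ^+ k *: pbas P /\ forall a b, M a b = (2 ^ k * pmx P a b)%N.

Lemma mrep_inj n m (f g : phom n m) M N :
  mrep f M -> mrep g N -> (forall a b, M a b = N a b) -> f = g.
Proof.
move=> [k [P [-> hM]]] [l [Q [-> hN]]] MN.
have [|-> ->//] := @pmx_inj _ _ P Q k l.
by move=> a b; rewrite -hM -hN.
Qed.

Lemma pmcomp_bas n m l (P : spart ('I_n + 'I_m)%type) (Q : spart ('I_m + 'I_l)%type) :
  pmcomp (pbas Q) (pbas P) = t ^+ ploop P Q *: pbas (pcomp P Q).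
Proof. exact: bilext_bas. Qed.

Lemma ptensm_bas n n' m m' (P : spart ('I_n + 'I_n')%type)
   (Q : spart ('I_m + 'I_m')%type) :
  ptensm (pbas P) (pbas Q) = pbas (ptens P Q).
Proof. exact: bilext_bas. Qed.

Lemma pmcompPl n m l a (g g' : phom m l) (f : phom n m) :
  pmcomp (a *: g + g') f = a *: pmcomp g f + pmcomp g' f.
Proof. exact: bilextPr. Qed.
Lemma pmcompPr n m l a (g : phom m l) (f f' : phom n m) :
  pmcomp g (a *: f + f') = a *: pmcomp g f + pmcomp g f'.
Proof. exact: bilextPl. Qed.
Lemma ptensmPl n n' m m' a (f f' : phom n n') (g : phom m m') :
  ptensm (a *: f + f') g = a *: ptensm f g + ptensm f' g.
Proof. exact: bilextPl. Qed.
Lemma ptensmPr n n' m m' a (f : phom n n') (g g' : phom m m') :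
  ptensm f (a *: g + g') = a *: ptensm f g + ptensm f g'.
Proof. exact: bilextPr. Qed.

Lemma pmcompZl n m l a (g : phom m l) (f : phom n m) :
  pmcomp (a *: g) f = a *: pmcomp g f.
Proof. exact: (linZ (fun b u v => pmcompPl b u v f)). Qed.
Lemma pmcompZr n m l a (g : phom m l) (f : phom n m) :
  pmcomp g (a *: f) = a *: pmcomp g f.
Proof. exact: (linZ (fun b u v => pmcompPr b g u v)). Qed.
Lemma ptensmZl n n' m m' a (f : phom n n') (g : phom m m') :
  ptensm (a *: f) g = a *: ptensm f g.
Proof. exact: (linZ (fun b u v => ptensmPl b u v g)). Qed.
Lemma ptensmZr n n' m m' a (f : phom n n') (g : phom m m') :
  ptensm f (a *: g) = a *: ptensm f g.
Proof. exact: (linZ (fun b u v => ptensmPr b f u v)). Qed.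

Lemma mrep_bas n m (P : spart ('I_n + 'I_m)%type) :
  mrep (pbas P) (fun a b => pmx P a b).
Proof. by exists 0%N, P; split=> [|a b]; rewrite ?expr0 ?scale1r ?mul1n. Qed.

Lemma mrep_comp n m l (g : phom m l) (f : phom n m) M N :
  mrep f M -> mrep g N ->
  mrep (pmcomp g f) (fun a c => \sum_b M a b * N b c)%N.
Proof.
move=> [k [P [-> hM]]] [k' [Q [-> hN]]].
exists (k + k' + ploop P Q)%N, (pcomp P Q); split=> [|a c].
  by rewrite pmcompZr pmcompZl pmcomp_bas !scalerA !exprD.
rewrite expnD -mulnA -glue_count big_distrr /=; apply: eq_bigr => b _.
by rewrite hM hN expnD mulnACA.
Qed.

Definition resl n m (a : colour (n + m)) : colour n := [ffun i => a (lshift m i)].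
Definition resr n m (a : colour (n + m)) : colour m := [ffun i => a (rshift n i)].

Lemma mrep_tens n n' m m' (f : phom n n') (g : phom m m') M N :
  mrep f M -> mrep g N ->
  mrep (ptensm f g) (fun a b => M (resl a) (resl b) * N (resr a) (resr b))%N.
Proof.
move=> [k [P [-> hM]]] [k' [Q [-> hN]]].
exists (k + k')%N, (ptens P Q); split=> [|a c].
  by rewrite ptensmZr ptensmZl ptensm_bas scalerA exprD [t ^+ k * _]mulrC.
rewrite hM hN expnD mulnACA; congr (_ * _)%N; rewrite pmx_ptens -mulnb.
by congr ((nat_of_bool _) * nat_of_bool _)%N; apply: eq_pmx => i; rewrite ffunE.
Qed.

Definition pullc n m (phi : 'I_n -> 'I_m) (b : colour m) : colour n :=
  [ffun i => b (phi i)].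

Lemma mrep_map n m (phi : 'I_n -> 'I_m) :
  mrep (pmap phi) (fun a b => a == pullc phi b).
Proof.
have [k [P [e h]]] := mrep_bas (pgraph phi).
exists k, P; split=> // a b; rewrite -h; congr nat_of_bool.
apply/eqP/pcolP => [-> x y|h'].
  by rewrite prel_kerpart => /eqP; case: x y => x [] y /=; rewrite ?ffunE => ->.
apply/ffunP => i; rewrite ffunE; apply: (h' (inl i) (inr (phi i))).
by rewrite prel_kerpart.
Qed.

Lemma mrep_ev n : mrep (pev n) (fun a _ => resl a == resr a).
Proof.
have [k [P [e h]]] := mrep_bas (kerpart (fun x : 'I_(n + n) + 'I_0 =>
    match x with inl i => fold_ord i : nat | inr _ => 0%N end)).
exists k, P; split=> // a b; rewrite -h; congr nat_of_bool.
apply/eqP/pcolP => [e' x y|h'].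
  have {}e' i : a (lshift _ i) = a (rshift _ i).
    by have /ffunP/(_ i) := e'; rewrite !ffunE.
  rewrite prel_kerpart /fold_ord; case: x y => [x|[]//] [y|[]//] /=.
  by case: split_ordP => i ->; case: split_ordP => j -> /eqP/val_inj ->.
apply/ffunP => i; rewrite !ffunE.
apply: (h' (inl (lshift n i)) (inl (rshift n i))).
by rewrite prel_kerpart /fold_ord (unsplitK (inl i)) (unsplitK (inr i)).
Qed.

Lemma mrep_coev n : mrep (pcoev n) (fun _ a => resl a == resr a).
Proof.
have [k [P [e h]]] := mrep_bas (kerpart (fun x : 'I_0 + 'I_(n + n) =>
    match x with inl _ => 0%N | inr i => fold_ord i : nat end)).
exists k, P; split=> // b a; rewrite -h; congr nat_of_bool.
apply/eqP/pcolP => [e' x y|h'].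
  have {}e' i : a (lshift _ i) = a (rshift _ i).
    by have /ffunP/(_ i) := e'; rewrite !ffunE.
  rewrite prel_kerpart /fold_ord; case: x y => [[]//|x] [[]//|y] /=.
  by case: split_ordP => i ->; case: split_ordP => j -> /eqP/val_inj ->.
apply/ffunP => i; rewrite !ffunE.
apply: (h' (inr (lshift n i)) (inr (rshift n i))).
by rewrite prel_kerpart /fold_ord (unsplitK (inl i)) (unsplitK (inr i)).
Qed.

Lemma sum_mapr m l (phi : 'I_m -> 'I_l) (F : colour m -> nat) c :
  (\sum_b F b * (b == pullc phi c))%N = F (pullc phi c).
Proof.
rewrite (bigD1 (pullc phi c)) //= eqxx muln1 big1 ?addn0 // => b /negbTE ->.
by rewrite muln0.
Qed.

Lemma sum_mapl n m (phi : 'I_n -> 'I_m) (psi : 'I_m -> 'I_n)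
    (F : colour m -> nat) a :
  cancel phi psi -> cancel psi phi ->
  (\sum_b (a == pullc phi b) * F b)%N = F (pullc psi a).
Proof.
move=> k1 k2; rewrite (bigD1 (pullc psi a)) //= big1 ?addn0 => [|b n0].
  rewrite (_ : pullc _ _ = a) ?eqxx ?mul1n //.
  by apply/ffunP => i; rewrite !ffunE k1.
case: eqP => // e; case/eqP: n0; rewrite e.
by apply/ffunP => i; rewrite !ffunE k2.
Qed.

Lemma pmap_comp n m l (psi : 'I_m -> 'I_l) (phi : 'I_n -> 'I_m) :
  pmcomp (pmap psi) (pmap phi) = pmap (psi \o phi).
Proof.
apply: (mrep_inj (mrep_comp (mrep_map _) (mrep_map _)) (mrep_map _)) => a c /=.
rewrite (sum_mapr psi (fun b => nat_of_bool (a == pullc phi b))).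
by congr (nat_of_bool (_ == _)); apply/ffunP => i; rewrite !ffunE.
Qed.

Lemma eq_pmap n m (phi psi : 'I_n -> 'I_m) : phi =1 psi -> pmap phi = pmap psi.
Proof.
move=> e; apply: (mrep_inj (mrep_map _) (mrep_map _)) => a c /=.
by congr (nat_of_bool (_ == _)); apply/ffunP => i; rewrite !ffunE e.
Qed.

Definition sum_ord n n' m m' (phi : 'I_n -> 'I_n') (psi : 'I_m -> 'I_m')
    (i : 'I_(n + m)) : 'I_(n' + m') :=
  match split i with inl j => lshift m' (phi j) | inr j => rshift n' (psi j) end.

Lemma sum_ordl n n' m m' (phi : 'I_n -> 'I_n') (psi : 'I_m -> 'I_m') j :
  sum_ord phi psi (lshift m j) = lshift m' (phi j).
Proof. by rewrite /sum_ord (unsplitK (inl j)). Qed.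
Lemma sum_ordr n n' m m' (phi : 'I_n -> 'I_n') (psi : 'I_m -> 'I_m') j :
  sum_ord phi psi (rshift n j) = rshift n' (psi j).
Proof. by rewrite /sum_ord (unsplitK (inr j)). Qed.
Lemma swap_ordl n m j : swap_ord (lshift m j) = rshift m j :> 'I_(m + n).
Proof. by rewrite /swap_ord (unsplitK (inl j)). Qed.
Lemma swap_ordr n m j : swap_ord (rshift n j) = lshift n j :> 'I_(m + n).
Proof. by rewrite /swap_ord (unsplitK (inr j)). Qed.

Lemma pmap_tens n n' m m' (phi : 'I_n -> 'I_n') (psi : 'I_m -> 'I_m') :
  ptensm (pmap phi) (pmap psi) = pmap (sum_ord phi psi).
Proof.
apply: (mrep_inj (mrep_tens (mrep_map _) (mrep_map _)) (mrep_map _)) => a c /=.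
rewrite mulnb; congr nat_of_bool; apply/andP/eqP => [[/eqP e1 /eqP e2]|->].
  apply/ffunP => i; rewrite ffunE; case: (split_ordP i) => j ->.
    by have /ffunP/(_ j) := e1; rewrite sum_ordl !ffunE.
  by have /ffunP/(_ j) := e2; rewrite sum_ordr !ffunE.
by split; apply/eqP/ffunP => i; rewrite !ffunE ?sum_ordl ?sum_ordr.
Qed.

Lemma pmcompA w x y z (h : phom y z) (g : phom x y) (f : phom w x) :
  pmcomp h (pmcomp g f) = pmcomp (pmcomp h g) f.
Proof.
move: f; apply: lin_ext => [a u v|a u v|P]; rewrite ?pmcompPr //.
move: g; apply: lin_ext => [a u v|a u v|Q]; rewrite ?(pmcompPr, pmcompPl) //.
move: h; apply: lin_ext => [a u v|a u v|R]; rewrite ?(pmcompPr, pmcompPl) //.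
pose B := mrep_bas.
apply: (mrep_inj (mrep_comp (mrep_comp (B _ _ _) (B _ _ _)) (B _ _ _))
                 (mrep_comp (B _ _ _) (mrep_comp (B _ _ _) (B _ _ _)))) => a d.
under eq_bigr do rewrite big_distrl /=.
rewrite exchange_big; apply: eq_bigr => b _; rewrite big_distrr /=.
by apply: eq_bigr => c _; rewrite mulnA.
Qed.

Lemma pmcomp1l n m (f : phom n m) : pmcomp (pidm m) f = f.
Proof.
move: f; apply: lin_ext => [a u v|a u v|P]; rewrite ?pmcompPr //.
apply: (mrep_inj (mrep_comp (mrep_bas _) (mrep_map _)) (mrep_bas _)) => a c.
rewrite (sum_mapr id (fun b => nat_of_bool (pmx P a b))).
by congr nat_of_bool; apply: eq_pmx => i; rewrite ?ffunE.
Qed.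

Lemma pmcomp1r n m (f : phom n m) : pmcomp f (pidm n) = f.
Proof.
move: f; apply: lin_ext => [a u v|a u v|P]; rewrite ?pmcompPl //.
apply: (mrep_inj (mrep_comp (mrep_map _) (mrep_bas _)) (mrep_bas _)) => a c.
rewrite (@sum_mapl _ _ id id (fun b => nat_of_bool (pmx P b c))) //.
by congr nat_of_bool; apply: eq_pmx => i; rewrite ?ffunE.
Qed.

Definition partLin : linCat K :=
  LinCat pmcompA pmcomp1l pmcomp1r pmcompPl pmcompPr.

Definition passoc n m l : phom (n + m + l) (n + (m + l)) :=
  pmap (cast_ord (esym (addnA n m l))).
Definition passocV n m l : phom (n + (m + l)) (n + m + l) :=
  pmap (cast_ord (addnA n m l)).
Definition plunit n : phom (0 + n) n := pmap (cast_ord (add0n n)).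
Definition plunitV n : phom n (0 + n) := pmap (cast_ord (esym (add0n n))).
Definition prunit n : phom (n + 0) n := pmap (cast_ord (addn0 n)).
Definition prunitV n : phom n (n + 0) := pmap (cast_ord (esym (addn0 n))).
Definition psym n m : phom (n + m) (m + n) := pmap (@swap_ord n m).

Lemma pmap_id n (phi : 'I_n -> 'I_n) : phi =1 id -> pmap phi = pidm n.
Proof. exact: eq_pmap. Qed.

Lemma ptensm1 n m : ptensm (pidm n) (pidm m) = pidm (n + m).
Proof.
rewrite pmap_tens; apply: pmap_id => i.
by case: (split_ordP i) => j ->; rewrite (sum_ordl, sum_ordr).
Qed.

Lemma ptensm_comp x x' x'' y y' y'' (f' : phom x' x'') (f : phom x x')
    (g' : phom y' y'') (g : phom y y') :
  ptensm (pmcomp f' f) (pmcomp g' g) = pmcomp (ptensm f' g') (ptensm f g).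
Proof.
pose E := (pmcompPr, pmcompPl, ptensmPl, ptensmPr).
move: f; apply: lin_ext => [a u v|a u v|P]; rewrite ?E //.
move: g; apply: lin_ext => [a u v|a u v|Q]; rewrite ?E //.
move: f'; apply: lin_ext => [a u v|a u v|P']; rewrite ?E //.
move: g'; apply: lin_ext => [a u v|a u v|Q']; rewrite ?E //.
pose B := mrep_bas.
apply: (mrep_inj
  (mrep_tens (mrep_comp (B _ _ _) (B _ _ _)) (mrep_comp (B _ _ _) (B _ _ _)))
  (mrep_comp (mrep_tens (B _ _ _) (B _ _ _)) (mrep_tens (B _ _ _) (B _ _ _)))) => a c.
rewrite /= -(@sum_ffun_split x' y'
  (fun b => pmx P (resl a) b * pmx P' b (resl c))%N
  (fun b => pmx Q (resr a) b * pmx Q' b (resr c))%N).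
- apply: eq_bigr => b _; rewrite [RHS]mulnACA; congr (_ * _ * (_ * _))%N;
  by congr nat_of_bool; apply: eq_pmx => i //=; rewrite ffunE.
- by move=> b b' e; congr (_ * _)%N; congr nat_of_bool; apply: eq_pmx.
- by move=> b b' e; congr (_ * _)%N; congr nat_of_bool; apply: eq_pmx.
Qed.

Lemma passoc_nat x x' y y' z z' (f : phom x x') (g : phom y y') (h : phom z z') :
  pmcomp (passoc x' y' z') (ptensm (ptensm f g) h) =
  pmcomp (ptensm f (ptensm g h)) (passoc x y z).
Proof.
pose E := (pmcompPr, pmcompPl, ptensmPl, ptensmPr).
move: f; apply: lin_ext => [a u v|a u v|P]; rewrite ?E //.
move: g; apply: lin_ext => [a u v|a u v|Q]; rewrite ?E //.
move: h; apply: lin_ext => [a u v|a u v|R]; rewrite ?E //.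
pose B := mrep_bas.
apply: (mrep_inj
  (mrep_comp (mrep_tens (mrep_tens (B _ _ _) (B _ _ _)) (B _ _ _)) (mrep_map _))
  (mrep_comp (mrep_map _) (mrep_tens (B _ _ _) (mrep_tens (B _ _ _) (B _ _ _))))) => a c.
rewrite sum_mapr (sum_mapl _ _ (cast_ordKV _) (cast_ordK _)) /= -mulnA.
congr (_ * (_ * _))%N; congr nat_of_bool; apply: eq_pmx => i; rewrite !ffunE;
  congr (_ _); apply: val_inj; rewrite //= addnA //.
Qed.

Lemma plunit_nat x x' (f : phom x x') :
  pmcomp (plunit x') (ptensm (pidm 0) f) = pmcomp f (plunit x).
Proof.
pose E := (pmcompPr, pmcompPl, ptensmPl, ptensmPr).
move: f; apply: lin_ext => [a u v|a u v|P]; rewrite ?E //.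
pose B := mrep_bas.
apply: (mrep_inj
  (mrep_comp (mrep_tens (mrep_map _) (B _ _ _)) (mrep_map _))
  (mrep_comp (mrep_map _) (B _ _ _))) => a c.
rewrite sum_mapr (sum_mapl _ _ (cast_ordK _) (cast_ordKV _)) /=.
rewrite (_ : (_ == _) = true) ?mul1n; last by apply/eqP/ffunP => -[].
by congr nat_of_bool; apply: eq_pmx => i; rewrite !ffunE;
  congr (_ _); apply: val_inj.
Qed.

Lemma prunit_nat x x' (f : phom x x') :
  pmcomp (prunit x') (ptensm f (pidm 0)) = pmcomp f (prunit x).
Proof.
pose E := (pmcompPr, pmcompPl, ptensmPl, ptensmPr).
move: f; apply: lin_ext => [a u v|a u v|P]; rewrite ?E //.
pose B := mrep_bas.
apply: (mrep_inj
  (mrep_comp (mrep_tens (B _ _ _) (mrep_map _)) (mrep_map _))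
  (mrep_comp (mrep_map _) (B _ _ _))) => a c.
rewrite sum_mapr (sum_mapl _ _ (cast_ordK _) (cast_ordKV _)) /=.
rewrite (_ : (_ == _) = true) ?muln1; last by apply/eqP/ffunP => -[].
by congr nat_of_bool; apply: eq_pmx => i; rewrite !ffunE;
  congr (_ _); apply: val_inj.
Qed.

Lemma swap_ordK n m : cancel (@swap_ord n m) (@swap_ord m n).
Proof.
by move=> i; case: (split_ordP i) => j ->;
  rewrite (swap_ordl, swap_ordr) (swap_ordl, swap_ordr).
Qed.

Lemma psym_nat x x' y y' (f : phom x x') (g : phom y y') :
  pmcomp (psym x' y') (ptensm f g) = pmcomp (ptensm g f) (psym x y).
Proof.
pose E := (pmcompPr, pmcompPl, ptensmPl, ptensmPr).
move: f; apply: lin_ext => [a u v|a u v|P]; rewrite ?E //.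
move: g; apply: lin_ext => [a u v|a u v|Q]; rewrite ?E //.
pose B := mrep_bas.
apply: (mrep_inj
  (mrep_comp (mrep_tens (B _ _ _) (B _ _ _)) (mrep_map _))
  (mrep_comp (mrep_map _) (mrep_tens (B _ _ _) (B _ _ _)))) => a c.
rewrite sum_mapr (sum_mapl _ _ (@swap_ordK _ _) (@swap_ordK _ _)) /= mulnC.
by congr (_ * _)%N; congr nat_of_bool; apply: eq_pmx => i;
   rewrite !ffunE ?(swap_ordl, swap_ordr).
Qed.

Lemma cast_assocl n m l e (i : 'I_n) :
  cast_ord e (lshift l (lshift m i)) = lshift (m + l) i.
Proof. exact: val_inj. Qed.
Lemma cast_assocm n m l e (i : 'I_m) :
  cast_ord e (lshift l (rshift n i)) = rshift n (lshift l i).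
Proof. exact: val_inj. Qed.
Lemma cast_assocr n m l e (i : 'I_l) :
  cast_ord e (rshift (n + m) i) = rshift n (rshift m i).
Proof. by apply: val_inj; rewrite /= addnA. Qed.
Let castE := (cast_assocl, cast_assocm, cast_assocr).
Let sumE := (sum_ordl, sum_ordr, swap_ordl, swap_ordr).

Lemma cast_lunit n e (i : 'I_n) : cast_ord e (rshift 0 i) = i.
Proof. exact: val_inj. Qed.
Lemma cast_runit n e (i : 'I_n) : cast_ord e (lshift 0 i) = i.
Proof. exact: val_inj. Qed.

Lemma passocK x y z : pmcomp (passocV x y z) (passoc x y z) = pidm _.
Proof. by rewrite pmap_comp; apply: pmap_id => i; apply: val_inj. Qed.
Lemma passocVK x y z : pmcomp (passoc x y z) (passocV x y z) = pidm _.
Proof. by rewrite pmap_comp; apply: pmap_id => i; apply: val_inj. Qed.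
Lemma plunitK x : pmcomp (plunitV x) (plunit x) = pidm _.
Proof. by rewrite pmap_comp; apply: pmap_id => i; apply: val_inj. Qed.
Lemma plunitVK x : pmcomp (plunit x) (plunitV x) = pidm _.
Proof. by rewrite pmap_comp; apply: pmap_id => i; apply: val_inj. Qed.
Lemma prunitK x : pmcomp (prunitV x) (prunit x) = pidm _.
Proof. by rewrite pmap_comp; apply: pmap_id => i; apply: val_inj. Qed.
Lemma prunitVK x : pmcomp (prunit x) (prunitV x) = pidm _.
Proof. by rewrite pmap_comp; apply: pmap_id => i; apply: val_inj. Qed.
Lemma psymK x y : pmcomp (psym y x) (psym x y) = pidm _.
Proof. by rewrite pmap_comp; apply: pmap_id => i; apply: swap_ordK. Qed.

Lemma ppentagon w x y z :
  pmcomp (passoc w x (y + z)) (passoc (w + x) y z) =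
  pmcomp (ptensm (pidm w) (passoc x y z)) (pmcomp (passoc w (x + y) z)
    (ptensm (passoc w x y) (pidm z))).
Proof.
rewrite !(pmap_tens, pmap_comp); apply: eq_pmap => i /=.
case: (split_ordP i) => {}i ->; first case: (split_ordP i) => {}i ->;
  first case: (split_ordP i) => {}i ->; by rewrite ?(castE, sumE).
Qed.

Lemma ptriangle x y :
  pmcomp (ptensm (pidm x) (plunit y)) (passoc x 0 y) = ptensm (prunit x) (pidm y).
Proof.
rewrite !(pmap_tens, pmap_comp); apply: eq_pmap => i /=.
case: (split_ordP i) => {}i ->; first case: (split_ordP i) => {}i ->;
  by [case: i | rewrite ?(castE, sumE) ?(cast_lunit, cast_runit)].
Qed.

Lemma phexagon x y z :
  pmcomp (passoc y z x) (pmcomp (psym x (y + z)) (passoc x y z)) =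
  pmcomp (ptensm (pidm y) (psym x z)) (pmcomp (passoc y x z)
    (ptensm (psym x y) (pidm z))).
Proof.
rewrite !(pmap_tens, pmap_comp); apply: eq_pmap => i /=.
case: (split_ordP i) => {}i ->; first case: (split_ordP i) => {}i ->;
  by rewrite ?(castE, sumE).
Qed.

Definition partSym : symCat K :=
  @SymCat K partLin addn ptensm 0%N passoc passocV plunit plunitV
    prunit prunitV psym ptensm1 ptensm_comp ptensmPl ptensmPr
    passocK passocVK plunitK plunitVK prunitK prunitVK psymK
    passoc_nat plunit_nat prunit_nat psym_nat ppentagon ptriangle phexagon.

Lemma colour3 n m l (z : colour (n + (m + l))) a b c :
  [&& resl z == a, resl (resr z) == b & resr (resr z) == c] =
  (z == [ffun i => match split i with
     | inl j => a j
     | inr j => match split j with inl k => b k | inr k => c k end end]).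
Proof.
apply/and3P/eqP => [[/eqP <- /eqP <- /eqP <-]|->].
  apply/ffunP => i; rewrite ffunE; case: split_ordP => j ->; rewrite ?ffunE //.
  by case: split_ordP => k -> ; rewrite !ffunE.
by split; apply/eqP/ffunP => i; rewrite !ffunE
  ?(unsplitK (inl _)) ?(unsplitK (inr _)) ?(unsplitK (inl _)) ?(unsplitK (inr _)).
Qed.

Lemma pullc_id n (a : colour n) : pullc id a = a.
Proof. by apply/ffunP => i; rewrite ffunE. Qed.
Lemma resr_add0 n e (a : colour n) : resr (pullc (cast_ord (e : (0 + n = n)%N)) a) = a.
Proof. by apply/ffunP => i; rewrite !ffunE cast_lunit. Qed.
Lemma resl_addn0 n e (a : colour n) : resl (pullc (cast_ord (e : (n + 0 = n)%N)) a) = a.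
Proof. by apply/ffunP => i; rewrite !ffunE cast_runit. Qed.
Section Pull3.
Variables (n m l : nat) (e : (n + m + l = n + (m + l))%N).
Variable (b : colour (n + (m + l))).
Lemma pull3l : resl (resl (pullc (cast_ord e) b)) = resl b.
Proof. by apply/ffunP => i; rewrite !ffunE cast_assocl. Qed.
Lemma pull3m : resr (resl (pullc (cast_ord e) b)) = resl (resr b).
Proof. by apply/ffunP => i; rewrite !ffunE cast_assocm. Qed.
Lemma pull3r : resr (pullc (cast_ord e) b) = resr (resr b).
Proof. by apply/ffunP => i; rewrite !ffunE cast_assocr. Qed.
End Pull3.
Let pullE := (pullc_id, resr_add0, resl_addn0, pull3l, pull3m, pull3r).

Lemma colour3_sum n (a c : colour n) :
  (\sum_(b : colour (n + (n + n)))
    [&& resl b == resl (resr b), a == resr (resr b), resl b == c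
      & resl (resr b) == resr (resr b)])%N = (a == c).
Proof.
pose z : colour (n + (n + n)) := [ffun i => match split i with
     | inl j => a j
     | inr j => match split j with inl k => a k | inr k => a k end end].
have /and3P[/eqP z1 /eqP z2 /eqP z3] :
  [&& resl z == a, resl (resr z) == a & resr (resr z) == a] by rewrite colour3.
rewrite (bigD1 z) //= big1 ?addn0 => [|b nb]; last first.
  apply/eqP; rewrite eqb0; apply: contra nb.
  rewrite /z -colour3 => /and4P[/eqP -> /eqP -> _ /eqP ->].
  by rewrite !eqxx.
by rewrite z1 z2 z3 !eqxx andbT.
Qed.

Lemma prigidl n :
  pmcomp (prunit n) (pmcomp (ptensm (pidm n) (pev n)) (pmcomp (passoc n n n)
    (pmcomp (ptensm (pcoev n) (pidm n)) (plunitV n)))) = pidm n.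
Proof.
apply: (mrep_inj (mrep_comp (mrep_comp (mrep_comp (mrep_comp (mrep_map _)
  (mrep_tens (mrep_coev _) (mrep_map _))) (mrep_map _))
  (mrep_tens (mrep_map _) (mrep_ev _))) (mrep_map _)) (mrep_map _)) => a c.
rewrite sum_mapr.
under eq_bigr => b _ do
  rewrite sum_mapr (sum_mapl _ _ (cast_ordKV _) (cast_ordK _)) !pullE !mulnb -andbA.
by rewrite pullE colour3_sum.
Qed.

Lemma prigidr n :
  pmcomp (plunit n) (pmcomp (ptensm (pev n) (pidm n)) (pmcomp (passocV n n n)
    (pmcomp (ptensm (pidm n) (pcoev n)) (prunitV n)))) = pidm n.
Proof.
apply: (mrep_inj (mrep_comp (mrep_comp (mrep_comp (mrep_comp (mrep_map _)
  (mrep_tens (mrep_map _) (mrep_coev _))) (mrep_map _))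
  (mrep_tens (mrep_ev _) (mrep_map _))) (mrep_map _)) (mrep_map _)) => a c.
rewrite sum_mapr pullE eq_sym -colour3_sum.
rewrite (reindex (pullc (cast_ord (esym (addnA n n n))))) /=; last first.
  exists (pullc (cast_ord (addnA n n n))) => b _;
  by apply/ffunP => i; rewrite !ffunE (cast_ordK, cast_ordKV).
apply: eq_bigr => b _.
rewrite sum_mapr (sum_mapl _ _ (cast_ordKV _) (cast_ordK _)).
have -> : pullc (cast_ord (addnA n n n)) (pullc (cast_ord (esym (addnA n n n))) b) = b.
  by apply/ffunP => i; rewrite !ffunE cast_ordK.
rewrite !pullE !mulnb; congr nat_of_bool.
rewrite [_ == resl b]eq_sym [_ == c]eq_sym.
apply/idP/idP => [/andP[/andP[/eqP -> /eqP ->] /andP[/eqP <- /eqP ->]]|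
  /and4P[/eqP -> /eqP -> /eqP -> /eqP ->]]; by rewrite !eqxx.
Qed.

Definition partRigid : rigidCat K :=
  @RigidCat K partSym (fun n => n) pev pcoev prigidl prigidr.

End PartitionCategory.

Section DependentProduct.
Variables (K : fieldType) (I : finType) (V : I -> lmodType K).

Definition dprod := {dffun forall i : I, V i}.
HB.instance Definition _ := Choice.on dprod.

Definition dprod0 : dprod := [ffun i => 0].
Definition dprodN (f : dprod) : dprod := [ffun i => - f i].
Definition dprodD (f g : dprod) : dprod := [ffun i => f i + g i].
Definition dprodZ (a : K) (f : dprod) : dprod := [ffun i => a *: f i].

Fact dprodA : associative dprodD.
Proof. by move=> f g h; apply/ffunP => i; rewrite !ffunE addrA. Qed.
Fact dprodC : commutative dprodD.
Proof. by move=> f g; apply/ffunP => i; rewrite !ffunE addrC. Qed.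
Fact dprod0D : left_id dprod0 dprodD.
Proof. by move=> f; apply/ffunP => i; rewrite !ffunE add0r. Qed.
Fact dprodND : left_inverse dprod0 dprodN dprodD.
Proof. by move=> f; apply/ffunP => i; rewrite !ffunE addNr. Qed.
HB.instance Definition _ := GRing.isZmodule.Build dprod dprodA dprodC dprod0D dprodND.

Fact dprodZA a b f : dprodZ a (dprodZ b f) = dprodZ (a * b) f.
Proof. by apply/ffunP => i; rewrite !ffunE scalerA. Qed.
Fact dprod1Z : left_id 1 dprodZ.
Proof. by move=> f; apply/ffunP => i; rewrite !ffunE scale1r. Qed.
Fact dprodZDr : right_distributive dprodZ +%R.
Proof. by move=> a f g; apply/ffunP => i; rewrite !ffunE scalerDr. Qed.
Fact dprodZDl f : {morph dprodZ^~ f : a b / a + b}.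
Proof. by move=> a b; apply/ffunP => i; rewrite !ffunE scalerDl. Qed.
HB.instance Definition _ := GRing.Zmodule_isLmodule.Build K dprod
  dprodZA dprod1Z dprodZDr dprodZDl.

End DependentProduct.

Section AddLin.
Variables (K : fieldType) (A : linCat K).

(* The formal direct sum of the family [afam] of objects of [A]. *)
Record addObj := AddObj { aidx : finType; afam :> aidx -> A }.
Implicit Types X Y Z W : addObj.

Definition ahom X Y : lmodType K :=
  dprod (fun p : aidx X * aidx Y => hom (X p.1) (Y p.2)).

Definition entry X Y (M : ahom X Y) (i : aidx X) (j : aidx Y) : hom (X i) (Y j) :=
  (M : dprod _) (i, j).

Definition amat X Y (F : forall i j, hom (X i) (Y j)) : ahom X Y :=
  ([ffun p => F p.1 p.2] : dprod (fun p : aidx X * aidx Y => hom (X p.1) (Y p.2))).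

Lemma entryE X Y (F : forall i j, hom (X i) (Y j)) i j : entry (amat F) i j = F i j.
Proof. by rewrite /entry ffunE. Qed.

Lemma entryP X Y (M N : ahom X Y) : (forall i j, entry M i j = entry N i j) -> M = N.
Proof. by move=> h; apply/ffunP => -[i j]; apply: h. Qed.

Lemma entry_lin X Y a (M N : ahom X Y) i j :
  entry (a *: M + N) i j = a *: entry M i j + entry N i j.
Proof. by rewrite /entry !ffunE. Qed.

Lemma entryD X Y (M N : ahom X Y) i j : entry (M + N) i j = entry M i j + entry N i j.
Proof. by rewrite /entry !ffunE. Qed.

Lemma entry0 X Y i j : entry (0 : ahom X Y) i j = 0.
Proof. by rewrite /entry !ffunE. Qed.

(* The matrix with, in row [i], the only nonzero entry [F i] in column [phi i]. *)
Definition amono X Y (phi : aidx X -> aidx Y) (F : forall i, hom (X i) (Y (phi i))) :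
    ahom X Y :=
  amat (fun i j => if phi i =P j is ReflectT e
                   then ecast k (hom (X i) (Y k)) e (F i) else 0).

Definition aidm X : ahom X X := @amono X X (fun i => i) (fun i => idm (X i)).

Definition amcomp X Y Z (N : ahom Y Z) (M : ahom X Y) : ahom X Z :=
  amat (fun i k => \sum_j entry N j k ∘ entry M i j).

Lemma amono_diag X Y phi (F : forall i, hom (X i) (Y (phi i))) i :
  entry (@amono X Y phi F) i (phi i) = F i.
Proof. by rewrite entryE; case: eqP => // e; rewrite (eq_axiomK e). Qed.

Lemma amono_off X Y phi (F : forall i, hom (X i) (Y (phi i))) i j :
  phi i != j -> entry (@amono X Y phi F) i j = 0.
Proof. by rewrite entryE; case: eqP. Qed.

Lemma amono_cast X Y phi (F : forall i, hom (X i) (Y (phi i))) i j (e : phi i = j) :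
  entry (@amono X Y phi F) i j = ecast k (hom (X i) (Y k)) e (F i).
Proof. by case: j / e; rewrite amono_diag. Qed.

Lemma amono_ext X Y phi psi F G i :
  phi i = psi i ->
  (forall e : phi i = psi i, ecast k (hom (X i) (Y k)) e (F i) = G i) ->
  forall j, entry (@amono X Y phi F) i j = entry (@amono X Y psi G) i j.
Proof.
move=> e /(_ e) eFG j; have [<-|n] := eqVneq (psi i) j.
  by rewrite amono_diag (amono_cast _ e).
by rewrite !amono_off // e.
Qed.

Lemma entry_comp X Y Z (N : ahom Y Z) (M : ahom X Y) i k :
  entry (amcomp N M) i k = \sum_j entry N j k ∘ entry M i j.
Proof. exact: entryE. Qed.

Lemma entry_compr X Y Z (N : ahom Y Z) phi F i k :
  entry (amcomp N (@amono X Y phi F)) i k = entry N (phi i) k ∘ F i.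
Proof.
rewrite entry_comp (bigD1 (phi i)) //= amono_diag big1 ?addr0 // => j n.
by rewrite amono_off ?mcomp0r // eq_sym.
Qed.

Lemma entry_compl X Y Z phi F (M : ahom X Y) i k :
  injective phi ->
  entry (amcomp (@amono Y Z phi F) M) i (phi k) = F k ∘ entry M i k.
Proof.
move=> inj; rewrite entry_comp (bigD1 k) //= amono_diag big1 ?addr0 // => j n.
by rewrite amono_off ?mcomp0l //; apply: contra n => /eqP/inj ->.
Qed.

Lemma amono_comp X Y Z psi G phi F :
  amcomp (@amono Y Z psi G) (@amono X Y phi F) =
  @amono X Z (fun i => psi (phi i)) (fun i => G (phi i) ∘ F i).
Proof.
apply: entryP => i k; rewrite entry_compr.
have [<-|n] := eqVneq (psi (phi i)) k; first by rewrite !amono_diag.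
by rewrite !amono_off // mcomp0l.
Qed.

Lemma amcompA W X Y Z (h : ahom Y Z) (g : ahom X Y) (f : ahom W X) :
  amcomp h (amcomp g f) = amcomp (amcomp h g) f.
Proof.
apply: entryP => i l; rewrite !entry_comp.
under eq_bigr => k _ do rewrite entry_comp mcomp_sumr.
rewrite exchange_big; apply: eq_bigr => j _.
by rewrite entry_comp mcomp_suml; apply: eq_bigr => k _; rewrite mcompA.
Qed.

Lemma amcomp1l X Y (f : ahom X Y) : amcomp (aidm Y) f = f.
Proof.
by apply: entryP => i k; rewrite (@entry_compl _ _ _ (fun i => i)) ?mcomp1l.
Qed.

Lemma amcomp1r X Y (f : ahom X Y) : amcomp f (aidm X) = f.
Proof. by apply: entryP => i k; rewrite entry_compr mcomp1r. Qed.

Lemma amcompPl X Y Z a (g g' : ahom Y Z) (f : ahom X Y) :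
  amcomp (a *: g + g') f = a *: amcomp g f + amcomp g' f.
Proof.
apply: entryP => i k; rewrite entry_lin !entry_comp scaler_sumr -big_split /=.
by apply: eq_bigr => j _; rewrite entry_lin mcompPl.
Qed.

Lemma amcompPr X Y Z a (g : ahom Y Z) (f f' : ahom X Y) :
  amcomp g (a *: f + f') = a *: amcomp g f + amcomp g f'.
Proof.
apply: entryP => i k; rewrite entry_lin !entry_comp scaler_sumr -big_split /=.
by apply: eq_bigr => j _; rewrite entry_lin mcompPr.
Qed.

Definition addLin : linCat K :=
  LinCat amcompA amcomp1l amcomp1r amcompPl amcompPr.

Definition asum X Y : addObj :=
  AddObj (fun z : aidx X + aidx Y => match z with inl i => X i | inr j => Y j end).

Definition ainl X Y : ahom X (asum X Y) :=
  @amono X (asum X Y) inl (fun i => idm (X i)).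
Definition ainr X Y : ahom Y (asum X Y) :=
  @amono Y (asum X Y) inr (fun i => idm (Y i)).
Definition aprl X Y : ahom (asum X Y) X :=
  @amat (asum X Y) X (fun z => match z with
    | inl i => fun k => entry (aidm X) i k | inr j => fun k => 0 end).
Definition aprr X Y : ahom (asum X Y) Y :=
  @amat (asum X Y) Y (fun z => match z with
    | inl i => fun k => 0 | inr j => fun k => entry (aidm Y) j k end).

Lemma addLin_additive : is_additive addLin.
Proof.
split.
  by exists (AddObj (fun i : 'I_0 => False_rect A (ltac:(by case: i)))); apply: entryP => -[].
move=> X Y; exists (asum X Y), (ainl X Y), (ainr X Y), (aprl X Y), (aprr X Y).
split; apply: entryP => i k.
- by rewrite entry_compr entryE mcomp1r.
- by rewrite entry_compr entryE mcomp1r.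
- by rewrite entry_compr entryE mcomp0l entry0.
- by rewrite entry_compr entryE mcomp0l entry0.
rewrite entryD; case: k => k.
  have -> : entry (amcomp (ainl X Y) (aprl X Y)) i (inl k) = entry (aprl X Y) i k.
    by rewrite (@entry_compl _ _ _ (inl : _ -> aidx (asum X Y))) ?mcomp1l //; move=> ? ? [].
  rewrite [X in _ + X](_ : _ = 0) ?addr0; last first.
    by rewrite entry_comp big1 // => j _; rewrite amono_off ?mcomp0l.
  rewrite entryE; case: i => i.
    have [<-|n] := eqVneq i k; first by rewrite !(amono_diag (fun _ => idm _)).
    by rewrite !amono_off.
  by rewrite amono_off.
have -> : entry (amcomp (ainr X Y) (aprr X Y)) i (inr k) = entry (aprr X Y) i k.
  by rewrite (@entry_compl _ _ _ (inr : _ -> aidx (asum X Y))) ?mcomp1l //; move=> ? ? [].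
rewrite [X in X + _](_ : _ = 0) ?add0r; last first.
  by rewrite entry_comp big1 // => j _; rewrite amono_off ?mcomp0l.
rewrite entryE; case: i => i.
  by rewrite amono_off.
have [<-|n] := eqVneq i k; first by rewrite !(amono_diag (fun _ => idm _)).
by rewrite !amono_off.
Qed.

End AddLin.

Section AddSym.
Variables (K : fieldType) (A : symCat K).
Notation addObj := (addObj A).
Implicit Types X Y Z W : addObj.

Definition atens X Y : addObj :=
  AddObj (fun p : aidx X * aidx Y => X p.1 ⊗ Y p.2).

Definition atensm X X' Y Y' (f : ahom X X') (g : ahom Y Y') :
    ahom (atens X Y) (atens X' Y') :=
  @amat _ _ (atens X Y) (atens X' Y')
    (fun p q => entry f p.1 q.1 ⊠ entry g p.2 q.2).

Definition aone : addObj := AddObj (fun _ : unit => tunit : A).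

Definition aassoc X Y Z : ahom (atens (atens X Y) Z) (atens X (atens Y Z)) :=
  @amono _ _ (atens (atens X Y) Z) (atens X (atens Y Z))
    (fun p => (p.1.1, (p.1.2, p.2))) (fun p => assoc _ _ _).
Definition aassocV X Y Z : ahom (atens X (atens Y Z)) (atens (atens X Y) Z) :=
  @amono _ _ (atens X (atens Y Z)) (atens (atens X Y) Z)
    (fun p => ((p.1, p.2.1), p.2.2)) (fun p => assocV _ _ _).
Definition alunit X : ahom (atens aone X) X :=
  @amono _ _ (atens aone X) X (fun p => p.2) (fun p => lunit _).
Definition alunitV X : ahom X (atens aone X) :=
  @amono _ _ X (atens aone X) (fun i => (tt, i)) (fun i => lunitV _).
Definition arunit X : ahom (atens X aone) X :=
  @amono _ _ (atens X aone) X (fun p => p.1) (fun p => runit _).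
Definition arunitV X : ahom X (atens X aone) :=
  @amono _ _ X (atens X aone) (fun i => (i, tt)) (fun i => runitV _).
Definition asym X Y : ahom (atens X Y) (atens Y X) :=
  @amono _ _ (atens X Y) (atens Y X) (fun p => (p.2, p.1)) (fun p => sym _ _).

Lemma entry_tens X X' Y Y' (f : ahom X X') (g : ahom Y Y') p q :
  entry (atensm f g) p q = entry f p.1 q.1 ⊠ entry g p.2 q.2.
Proof. exact: entryE. Qed.

Lemma amono_tens X X' Y Y' phi F psi G :
  atensm (@amono _ A X X' phi F) (@amono _ A Y Y' psi G) =
  @amono _ _ (atens X Y) (atens X' Y')
    (fun p => (phi p.1, psi p.2)) (fun p => F p.1 ⊠ G p.2).
Proof.
apply: entryP => -[i j] [i' j']; rewrite entry_tens /=.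
have [<-|n] := eqVneq (phi i) i'; last first.
  rewrite amono_off // tensm0l amono_off //=.
  by apply: contra n => /eqP[-> _].
have [<-|n] := eqVneq (psi j) j'; last first.
  rewrite [X in _ ⊠ X]amono_off // tensm0r amono_off //=.
  by apply: contra n => /eqP[->].
by rewrite !amono_diag.
Qed.

Lemma atensm1 X Y : atensm (aidm X) (aidm Y) = aidm (atens X Y).
Proof.
rewrite amono_tens; apply: entryP => -[i j].
by apply: amono_ext => //= e; rewrite (eq_axiomK e) /= tensm1.
Qed.

Lemma atensm_comp X X' X'' Y Y' Y''
    (f' : ahom X' X'') (f : ahom X X') (g' : ahom Y' Y'') (g : ahom Y Y') :
  atensm (amcomp f' f) (amcomp g' g) = amcomp (atensm f' g') (atensm f g).
Proof.
apply: entryP => -[i j] [i'' j'']; rewrite entry_tens !entry_comp /=.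
rewrite tensm_sum2 pair_bigA /=; apply: eq_bigr => -[k l] _.
by rewrite !entry_tens tensm_comp.
Qed.

Lemma atensmPl X X' Y Y' a (f f' : ahom X X') (g : ahom Y Y') :
  atensm (a *: f + f') g = a *: atensm f g + atensm f' g.
Proof. by apply: entryP => p q; rewrite entry_lin !entry_tens entry_lin tensmPl. Qed.

Lemma atensmPr X X' Y Y' a (f : ahom X X') (g g' : ahom Y Y') :
  atensm f (a *: g + g') = a *: atensm f g + atensm f g'.
Proof. by apply: entryP => p q; rewrite entry_lin !entry_tens entry_lin tensmPr. Qed.

Lemma aassocK X Y Z : amcomp (aassocV X Y Z) (aassoc X Y Z) = aidm _.
Proof.
rewrite amono_comp; apply: entryP => -[[i j] k].
by apply: amono_ext => //= e; rewrite (eq_axiomK e) /= assocK.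
Qed.
Lemma aassocVK X Y Z : amcomp (aassoc X Y Z) (aassocV X Y Z) = aidm _.
Proof.
rewrite amono_comp; apply: entryP => -[i [j k]].
by apply: amono_ext => //= e; rewrite (eq_axiomK e) /= assocVK.
Qed.
Lemma alunitK X : amcomp (alunitV X) (alunit X) = aidm _.
Proof.
rewrite amono_comp; apply: entryP => -[[] i].
by apply: amono_ext => //= e; rewrite (eq_axiomK e) /= lunitK.
Qed.
Lemma alunitVK X : amcomp (alunit X) (alunitV X) = aidm _.
Proof.
rewrite amono_comp; apply: entryP => i.
by apply: amono_ext => //= e; rewrite (eq_axiomK e) /= lunitVK.
Qed.
Lemma arunitK X : amcomp (arunitV X) (arunit X) = aidm _.
Proof.
rewrite amono_comp; apply: entryP => -[i []].
by apply: amono_ext => //= e; rewrite (eq_axiomK e) /= runitK.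
Qed.
Lemma arunitVK X : amcomp (arunit X) (arunitV X) = aidm _.
Proof.
rewrite amono_comp; apply: entryP => i.
by apply: amono_ext => //= e; rewrite (eq_axiomK e) /= runitVK.
Qed.
Lemma asymK X Y : amcomp (asym Y X) (asym X Y) = aidm _.
Proof.
rewrite amono_comp; apply: entryP => -[i j].
by apply: amono_ext => //= e; rewrite (eq_axiomK e) /= symK.
Qed.

Lemma aassoc_nat X X' Y Y' Z Z' (f : ahom X X') (g : ahom Y Y') (h : ahom Z Z') :
  amcomp (aassoc X' Y' Z') (atensm (atensm f g) h) =
  amcomp (atensm f (atensm g h)) (aassoc X Y Z).
Proof.
apply: entryP => -[[i j] k] [i' [j' k']]; rewrite entry_compr.
have := @entry_compl _ _ _ (atens (atens X' Y') Z') (atens X' (atens Y' Z'))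
  (fun p => (p.1.1, (p.1.2, p.2))) (fun p => assoc _ _ _)
  (atensm (atensm f g) h) (i, j, k) (i', j', k').
move=> /= ->; last by move=> [[? ?] ?] [[? ?] ?] /= [-> -> ->].
by rewrite !entry_tens /= assoc_nat.
Qed.

Lemma alunit_nat X X' (f : ahom X X') :
  amcomp (alunit X') (atensm (aidm aone) f) = amcomp f (alunit X).
Proof.
apply: entryP => -[[] i] i'; rewrite entry_compr.
have := @entry_compl _ _ _ (atens aone X') X'
  (fun p => p.2) (fun p => lunit _) (atensm (aidm aone) f) (tt, i) (tt, i').
move=> /= ->; last by move=> [[] ?] [[] ?] /= ->.
by rewrite entry_tens /= (@amono_diag _ _ aone aone id (fun=> idm _) tt) lunit_nat.
Qed.

Lemma arunit_nat X X' (f : ahom X X') :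
  amcomp (arunit X') (atensm f (aidm aone)) = amcomp f (arunit X).
Proof.
apply: entryP => -[i []] i'; rewrite entry_compr.
have := @entry_compl _ _ _ (atens X' aone) X'
  (fun p => p.1) (fun p => runit _) (atensm f (aidm aone)) (i, tt) (i', tt).
move=> /= ->; last by move=> [? []] [? []] /= ->.
by rewrite entry_tens /= (@amono_diag _ _ aone aone id (fun=> idm _) tt) runit_nat.
Qed.

Lemma asym_nat X X' Y Y' (f : ahom X X') (g : ahom Y Y') :
  amcomp (asym X' Y') (atensm f g) = amcomp (atensm g f) (asym X Y).
Proof.
apply: entryP => -[i j] [j' i']; rewrite entry_compr.
have := @entry_compl _ _ _ (atens X' Y') (atens Y' X')
  (fun p => (p.2, p.1)) (fun p => sym _ _) (atensm f g) (i, j) (i', j').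
move=> /= ->; last by move=> [? ?] [? ?] /= [-> ->].
by rewrite !entry_tens /= sym_nat.
Qed.

Lemma apentagon W X Y Z :
  amcomp (aassoc W X (atens Y Z)) (aassoc (atens W X) Y Z) =
  amcomp (atensm (aidm W) (aassoc X Y Z)) (amcomp (aassoc W (atens X Y) Z)
    (atensm (aassoc W X Y) (aidm Z))).
Proof.
rewrite !(amono_tens, amono_comp); apply: entryP => -[[[i j] k] l].
by apply: amono_ext => //= e; rewrite (eq_axiomK e) /= pentagon.
Qed.

Lemma atriangle X Y :
  amcomp (atensm (aidm X) (alunit Y)) (aassoc X aone Y) =
  atensm (arunit X) (aidm Y).
Proof.
rewrite !(amono_tens, amono_comp); apply: entryP => -[[i []] k].
by apply: amono_ext => //= e; rewrite (eq_axiomK e) /= triangle.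
Qed.

Lemma ahexagon X Y Z :
  amcomp (aassoc Y Z X) (amcomp (asym X (atens Y Z)) (aassoc X Y Z)) =
  amcomp (atensm (aidm Y) (asym X Z)) (amcomp (aassoc Y X Z)
    (atensm (asym X Y) (aidm Z))).
Proof.
rewrite !(amono_tens, amono_comp); apply: entryP => -[[i j] k].
by apply: amono_ext => //= e; rewrite (eq_axiomK e) /= hexagon.
Qed.

Definition addSym : symCat K :=
  @SymCat K (addLin A) atens atensm aone aassoc aassocV alunit alunitV
    arunit arunitV asym atensm1 atensm_comp atensmPl atensmPr
    aassocK aassocVK alunitK alunitVK arunitK arunitVK asymK
    aassoc_nat alunit_nat arunit_nat asym_nat apentagon atriangle ahexagon.

End AddSym.

Section AddRigid.
Variables (K : fieldType) (A : rigidCat K).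
Notation addObj := (addObj A).
Implicit Types X Y Z W : addObj.

Definition adual X : addObj := AddObj (fun i : aidx X => dual (X i)).

Definition aev X : ahom (atens (adual X) X) (aone A) :=
  @amat _ _ (atens (adual X) X) (aone A) (fun p _ =>
    if p.1 =P p.2 is ReflectT e
    then ecast k (hom (dual (X p.1) ⊗ X k) tunit) e (ev (X p.1)) else 0).

Definition acoev X : ahom (aone A) (atens X (adual X)) :=
  @amat _ _ (aone A) (atens X (adual X)) (fun _ p =>
    if p.1 =P p.2 is ReflectT e
    then ecast k (hom tunit (X p.1 ⊗ dual (X k))) e (coev (X p.1)) else 0).

Lemma aev_diag X i u : entry (aev X) (i, i) u = ev (X i).
Proof. by rewrite entryE /=; case: eqP => // e; rewrite (eq_axiomK e). Qed.
Lemma aev_off X i j u : i != j -> entry (aev X) (i, j) u = 0.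
Proof. by rewrite entryE /=; case: eqP. Qed.
Lemma acoev_diag X i u : entry (acoev X) u (i, i) = coev (X i).
Proof. by rewrite entryE /=; case: eqP => // e; rewrite (eq_axiomK e). Qed.
Lemma acoev_off X i j u : i != j -> entry (acoev X) u (i, j) = 0.
Proof. by rewrite entryE /=; case: eqP. Qed.

Lemma aidm_diag X i : entry (aidm X) i i = idm (X i).
Proof. exact: (@amono_diag _ _ X X (fun i => i) (fun i => idm (X i))). Qed.
Lemma aidm_off X i j : i != j -> entry (aidm X) i j = 0.
Proof. by move=> n; rewrite amono_off. Qed.

Lemma arigidl X :
  amcomp (arunit X) (amcomp (atensm (aidm X) (aev X))
    (amcomp (aassoc X (adual X) X)
      (amcomp (atensm (acoev X) (aidm X)) (alunitV X)))) = aidm X.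
Proof.
apply: entryP => i k.
have := @entry_compl _ _ _ (atens X (aone A)) X
  (fun p => p.1) (fun p => runit _) (amcomp (atensm (aidm X) (aev X))
    (amcomp (aassoc X (adual X) X)
      (amcomp (atensm (acoev X) (aidm X)) (alunitV X)))) i (k, tt).
move=> /= ->; last by move=> [? []] [? []] /= ->.
rewrite [amcomp (atensm (aidm X) (aev X)) _]amcompA amcompA entry_compr entry_comp.
have [<-{k}|n] := eqVneq i k; last first.
  rewrite aidm_off // big1 ?mcomp0l ?mcomp0r // => -[[a b] c] _.
  rewrite entry_compr !entry_tens /=.
  have [?|n1] := eqVneq a k; last by rewrite aidm_off // tensm0l !mcomp0l.
  have [?|n2] := eqVneq b c; last by rewrite aev_off // tensm0r !mcomp0l.
  have [?|n3] := eqVneq a b; last by rewrite acoev_off // tensm0l !mcomp0r.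
  have [?|n4] := eqVneq i c; last by rewrite (aidm_off n4) tensm0r !mcomp0r.
  by case/eqP: n; congruence.
rewrite (bigD1 (i, i, i)) //= big1 ?addr0 => [|[[a b] c] n].
  rewrite entry_compr !entry_tens /= aev_diag acoev_diag !aidm_diag -[RHS]rigidl.
  by rewrite !mcompA.
rewrite entry_compr !entry_tens /=.
have [?|n1] := eqVneq a i; last by rewrite aidm_off // tensm0l !mcomp0l.
have [?|n2] := eqVneq b c; last by rewrite aev_off // tensm0r !mcomp0l.
have [?|n3] := eqVneq a b; last by rewrite acoev_off // tensm0l !mcomp0r.
by case/eqP: n; congr (_, _, _); congruence.
Qed.

Lemma arigidr X :
  amcomp (alunit (adual X)) (amcomp (atensm (aev X) (aidm (adual X)))
    (amcomp (aassocV (adual X) X (adual X))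
      (amcomp (atensm (aidm (adual X)) (acoev X)) (arunitV (adual X))))) =
  aidm (adual X).
Proof.
apply: entryP => i k.
have := @entry_compl _ _ _ (atens (aone A) (adual X)) (adual X)
  (fun p => p.2) (fun p => lunit _) (amcomp (atensm (aev X) (aidm (adual X)))
    (amcomp (aassocV (adual X) X (adual X))
      (amcomp (atensm (aidm (adual X)) (acoev X)) (arunitV (adual X))))) i (tt, k).
move=> /= ->; last by move=> [[] ?] [[] ?] /= ->.
rewrite [amcomp (atensm (aev X) _) _]amcompA amcompA entry_compr entry_comp.
have [<-{k}|n] := eqVneq i k; last first.
  rewrite [RHS]aidm_off // big1 ?mcomp0l ?mcomp0r // => -[a [b c]] _.
  rewrite entry_compr !entry_tens /=.
  have [?|n1] := eqVneq c k; last by rewrite (@aidm_off (adual X)) // tensm0r !mcomp0l.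
  have [?|n2] := eqVneq a b; last by rewrite aev_off // tensm0l !mcomp0l.
  have [?|n3] := eqVneq b c; last by rewrite acoev_off // tensm0r !mcomp0r.
  have [?|n4] := eqVneq i a; last by rewrite (@aidm_off (adual X) _ _ n4) tensm0l !mcomp0r.
  by case/eqP: n; congruence.
rewrite (bigD1 (i, (i, i))) //= big1 ?addr0 => [|[a [b c]] n].
  rewrite entry_compr !entry_tens /= aev_diag acoev_diag !(@aidm_diag (adual X)).
  by rewrite -[RHS]rigidr !mcompA.
rewrite entry_compr !entry_tens /=.
have [?|n1] := eqVneq c i; last by rewrite (@aidm_off (adual X)) // tensm0r !mcomp0l.
have [?|n2] := eqVneq a b; last by rewrite aev_off // tensm0l !mcomp0l.
have [?|n3] := eqVneq b c; last by rewrite acoev_off // tensm0r !mcomp0r.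
by case/eqP: n; congr (_, (_, _)); congruence.
Qed.

Definition addRigid : rigidCat K :=
  @RigidCat K (addSym A) adual aev acoev arigidl arigidr.

End AddRigid.

Section KarLin.
Variables (K : fieldType) (A : linCat K).

Record karObj := KarObj {
  kbase : A;
  kproj : hom kbase kbase;
  kproj_idem : kproj ∘ kproj = kproj }.

Section Hom.
Variables X Y : karObj.

Definition kar_pred : {pred hom (kbase X) (kbase Y)} :=
  fun f => kproj Y ∘ f ∘ kproj X == f.

Fact kar_pred_submod : submod_closed kar_pred.
Proof.
split=> [|a f g]; rewrite !unfold_in; first by rewrite mcomp0l mcomp0r.
by move=> /eqP ef /eqP eg; rewrite mcompPl mcompPr ef eg.
Qed.
HB.instance Definition _ :=
  GRing.isSubmodClosed.Build K (hom (kbase X) (kbase Y)) kar_pred kar_pred_submod.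

Record khom := KHom { kval : hom (kbase X) (kbase Y); _ : kval \in kar_pred }.
HB.instance Definition _ := [isSub for kval].
HB.instance Definition _ := [Choice of khom by <:].
HB.instance Definition _ := [SubChoice_isSubLmodule of khom by <:].
End Hom.

Implicit Types X Y Z W : karObj.

Lemma khomP X Y (f : khom X Y) : kproj Y ∘ kval f ∘ kproj X = kval f.
Proof. by apply/eqP; case: f. Qed.

Lemma khomPl X Y (f : khom X Y) : kproj Y ∘ kval f = kval f.
Proof. by rewrite -[in LHS]khomP mcompA kproj_idem khomP. Qed.

Lemma khomPr X Y (f : khom X Y) : kval f ∘ kproj X = kval f.
Proof. by rewrite -[in LHS]khomP -!mcompA kproj_idem khomP. Qed.

Lemma kval_lin X Y a (f g : khom X Y) : kval (a *: f + g) = a *: kval f + kval g.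
Proof. exact: (linearP (\val : khom X Y -> _)). Qed.
Lemma kval0 X Y : kval (0 : khom X Y) = 0.
Proof. exact: (linear0 (\val : khom X Y -> _)). Qed.
Lemma kvalD X Y (f g : khom X Y) : kval (f + g) = kval f + kval g.
Proof. exact: (linearD (\val : khom X Y -> _)). Qed.

Fact kmk_proof X Y (f : hom (kbase X) (kbase Y)) :
  kproj Y ∘ f ∘ kproj X \in @kar_pred X Y.
Proof.
by rewrite unfold_in -!mcompA kproj_idem ![kproj Y ∘ _]mcompA kproj_idem.
Qed.

Definition kmk X Y (f : hom (kbase X) (kbase Y)) : khom X Y := KHom (kmk_proof f).

Lemma kvalK X Y (f : khom X Y) : kmk (kval f) = f.
Proof. by apply: val_inj; rewrite /= khomP. Qed.

Fact kidm_proof X : kproj X \in @kar_pred X X.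
Proof. by rewrite unfold_in !kproj_idem. Qed.
Definition kidm X : khom X X := KHom (kidm_proof X).

Fact kmcomp_proof X Y Z (g : khom Y Z) (f : khom X Y) :
  kval g ∘ kval f \in @kar_pred X Z.
Proof. by rewrite unfold_in -mcompA khomPr mcompA khomPl. Qed.
Definition kmcomp X Y Z (g : khom Y Z) (f : khom X Y) : khom X Z :=
  KHom (kmcomp_proof g f).

Lemma kmcompA W X Y Z (h : khom Y Z) (g : khom X Y) (f : khom W X) :
  kmcomp h (kmcomp g f) = kmcomp (kmcomp h g) f.
Proof. by apply: val_inj; rewrite /= mcompA. Qed.
Lemma kmcomp1l X Y (f : khom X Y) : kmcomp (kidm Y) f = f.
Proof. by apply: val_inj; rewrite /= khomPl. Qed.
Lemma kmcomp1r X Y (f : khom X Y) : kmcomp f (kidm X) = f.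
Proof. by apply: val_inj; rewrite /= khomPr. Qed.
Lemma kmcompPl X Y Z a (g g' : khom Y Z) (f : khom X Y) :
  kmcomp (a *: g + g') f = a *: kmcomp g f + kmcomp g' f.
Proof. by apply: val_inj; rewrite /= !(kval_lin, mcompPl). Qed.
Lemma kmcompPr X Y Z a (g : khom Y Z) (f f' : khom X Y) :
  kmcomp g (a *: f + f') = a *: kmcomp g f + kmcomp g f'.
Proof. by apply: val_inj; rewrite /= !(kval_lin, mcompPr). Qed.

Definition karLin : linCat K :=
  @LinCat K karObj khom kidm kmcomp kmcompA kmcomp1l kmcomp1r kmcompPl kmcompPr.

Lemma karval0 X Y : kval (0 : @hom K karLin X Y) = 0.
Proof. exact: kval0. Qed.
Lemma karvalD X Y (f g : @hom K karLin X Y) : kval (f + g) = kval f + kval g.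
Proof. exact: kvalD. Qed.

Definition kequiv X Y (f : hom (kbase X) (kbase Y)) :=
  kproj Y ∘ f = f ∘ kproj X.

Lemma kval_equiv X Y (f : khom X Y) : kequiv (kval f).
Proof. by rewrite /kequiv khomPl khomPr. Qed.

Lemma kval_mkl X Y (f : hom (kbase X) (kbase Y)) :
  kequiv f -> kval (kmk f : khom X Y) = kproj Y ∘ f.
Proof. by rewrite /= => <-; rewrite mcompA kproj_idem. Qed.

Lemma kval_mkr X Y (f : hom (kbase X) (kbase Y)) :
  kequiv f -> kval (kmk f : khom X Y) = f ∘ kproj X.
Proof. by rewrite /= mcompA => ->; rewrite -mcompA kproj_idem. Qed.

Lemma kequiv_comp X Y Z (g : hom (kbase Y) (kbase Z)) (f : hom (kbase X) (kbase Y)) :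
  kequiv g -> kequiv f -> @kequiv X Z (g ∘ f).
Proof. by rewrite /kequiv => eg ef; rewrite mcompA eg -mcompA ef mcompA. Qed.

Lemma kmk_comp X Y Z (g : hom (kbase Y) (kbase Z)) (f : hom (kbase X) (kbase Y)) :
  kequiv f -> kmcomp (kmk g) (kmk f) = kmk (g ∘ f) :> khom X Z.
Proof.
move=> ef; apply: val_inj => /=; rewrite -!mcompA.
by rewrite [kproj Y ∘ kproj Y ∘ _]mcompA kproj_idem [kproj Y ∘ _]mcompA ef -!mcompA kproj_idem.
Qed.

Lemma kmk1 X : kmk (idm (kbase X)) = kidm X.
Proof. by apply: val_inj; rewrite /= mcomp1l kproj_idem. Qed.

Lemma karLin_pseudo_abelian : is_pseudo_abelian karLin.
Proof.
move=> X e ee; have ee' : kval e ∘ kval e = kval e.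
  exact: (congr1 (@kval _ _) ee).
pose Y := KarObj ee'.
have iP : kval e \in @kar_pred Y X.
  by rewrite unfold_in /= mcompA khomPl ee'.
have pP : kval e \in @kar_pred X Y.
  by rewrite unfold_in /= khomPr ee'.
exists Y, (KHom iP), (KHom pP).
by split; apply: val_inj; rewrite /= ee'.
Qed.

Lemma karLin_additive : is_additive A -> is_additive karLin.
Proof.
move=> [[Z Z0] bp]; split.
  have zz : (0 : hom Z Z) ∘ (0 : hom Z Z) = 0 by exact: mcomp0r.
  by exists (KarObj zz); apply: val_inj; rewrite [RHS]karval0.
move=> X Y; have [B [i [j [p [q [pi qj pj qi ipjq]]]]]] := bp (kbase X) (kbase Y).
pose eX := kproj X; pose eY := kproj Y.
have eXX : eX ∘ eX = eX := kproj_idem X.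
have eYY : eY ∘ eY = eY := kproj_idem Y.
pose u := i ∘ eX ∘ p; pose v := j ∘ eY ∘ q.
have pu : p ∘ u = eX ∘ p by rewrite /u mcompA pi mcomp1l.
have pv : p ∘ v = 0 by rewrite /v mcompA pj mcomp0l.
have qu : q ∘ u = 0 by rewrite /u mcompA qi mcomp0l.
have qv : q ∘ v = eY ∘ q by rewrite /v mcompA qj mcomp1l.
have ui : u ∘ i = i ∘ eX by rewrite /u -!mcompA pi mcomp1r.
have uj : u ∘ j = 0 by rewrite /u -!mcompA pj !mcomp0r.
have vi : v ∘ i = 0 by rewrite /v -!mcompA qi !mcomp0r.
have vj : v ∘ j = j ∘ eY by rewrite /v -!mcompA qj mcomp1r.
have ee : (u + v) ∘ (u + v) = u + v.
  have uu : u ∘ u = u by rewrite {1}/u -!mcompA pu [eX ∘ eX ∘ p]mcompA eXX.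
  have vv : v ∘ v = v by rewrite {1}/v -!mcompA qv [eY ∘ eY ∘ q]mcompA eYY.
  have uv : u ∘ v = 0 by rewrite {1}/u -!mcompA pv !mcomp0r.
  have vu : v ∘ u = 0 by rewrite {1}/v -!mcompA qu !mcomp0r.
  by rewrite mcompDl !mcompDr uu uv vu vv addr0 add0r.
pose Z' := KarObj ee.
have iP : i ∘ eX \in @kar_pred X Z'.
  by rewrite unfold_in /= -!mcompA eXX mcompDl !mcompA ui vi mcomp0l addr0 -mcompA eXX.
have jP : j ∘ eY \in @kar_pred Y Z'.
  by rewrite unfold_in /= -!mcompA eYY mcompDl !mcompA uj vj mcomp0l add0r -mcompA eYY.
have pP : eX ∘ p \in @kar_pred Z' X.
  by rewrite unfold_in /= -!mcompA mcompDr pu pv addr0 !mcompA !eXX.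
have qP : eY ∘ q \in @kar_pred Z' Y.
  by rewrite unfold_in /= -!mcompA mcompDr qu qv add0r !mcompA !eYY.
exists Z', (KHom iP), (KHom jP), (KHom pP), (KHom qP).
split; apply: val_inj; rewrite ?[RHS]karval0 ?[LHS]karvalD /=.
- by rewrite -!mcompA [p ∘ _]mcompA pi mcomp1l eXX.
- by rewrite -!mcompA [q ∘ _]mcompA qj mcomp1l eYY.
- by rewrite -!mcompA [p ∘ _]mcompA pj mcomp0l mcomp0r.
- by rewrite -!mcompA [q ∘ _]mcompA qi mcomp0l mcomp0r.
by rewrite -!mcompA [eX ∘ eX ∘ p]mcompA [eY ∘ eY ∘ q]mcompA eXX eYY.
Qed.

End KarLin.

Section KarSym.
Variables (K : fieldType) (A : symCat K).
Notation karObj := (karObj A).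
Implicit Types X Y Z W : karObj.

Fact ktens_proof X Y :
  (kproj X ⊠ kproj Y) ∘ (kproj X ⊠ kproj Y) = kproj X ⊠ kproj Y.
Proof. by rewrite -tensm_comp !kproj_idem. Qed.
Definition ktens X Y : karObj := KarObj (ktens_proof X Y).

Fact ktensm_proof X X' Y Y' (f : khom X X') (g : khom Y Y') :
  kval f ⊠ kval g \in @kar_pred _ _ (ktens X Y) (ktens X' Y').
Proof. by rewrite unfold_in /= -!tensm_comp !khomP. Qed.
Definition ktensm X X' Y Y' (f : khom X X') (g : khom Y Y') :
  khom (ktens X Y) (ktens X' Y') := KHom (ktensm_proof f g).

Definition kone : karObj := KarObj (mcomp1l (idm (tunit : A))).

Definition kassoc X Y Z : khom (ktens (ktens X Y) Z) (ktens X (ktens Y Z)) :=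
  @kmk _ _ (ktens (ktens X Y) Z) (ktens X (ktens Y Z)) (assoc _ _ _).
Definition kassocV X Y Z : khom (ktens X (ktens Y Z)) (ktens (ktens X Y) Z) :=
  @kmk _ _ (ktens X (ktens Y Z)) (ktens (ktens X Y) Z) (assocV _ _ _).
Definition klunit X : khom (ktens kone X) X := @kmk _ _ (ktens kone X) X (lunit _).
Definition klunitV X : khom X (ktens kone X) := @kmk _ _ X (ktens kone X) (lunitV _).
Definition krunit X : khom (ktens X kone) X := @kmk _ _ (ktens X kone) X (runit _).
Definition krunitV X : khom X (ktens X kone) := @kmk _ _ X (ktens X kone) (runitV _).
Definition ksym X Y : khom (ktens X Y) (ktens Y X) :=
  @kmk _ _ (ktens X Y) (ktens Y X) (sym _ _).

Lemma kassoc_equiv X Y Z :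
  @kequiv _ _ (ktens (ktens X Y) Z) (ktens X (ktens Y Z)) (assoc _ _ _).
Proof. by rewrite /kequiv /= assoc_nat. Qed.
Lemma kassocV_equiv X Y Z :
  @kequiv _ _ (ktens X (ktens Y Z)) (ktens (ktens X Y) Z) (assocV _ _ _).
Proof. by rewrite /kequiv /= assocV_nat. Qed.
Lemma klunit_equiv X : @kequiv _ _ (ktens kone X) X (lunit _).
Proof. by rewrite /kequiv /= lunit_nat. Qed.
Lemma klunitV_equiv X : @kequiv _ _ X (ktens kone X) (lunitV _).
Proof. by rewrite /kequiv /= lunitV_nat. Qed.
Lemma krunit_equiv X : @kequiv _ _ (ktens X kone) X (runit _).
Proof. by rewrite /kequiv /= runit_nat. Qed.
Lemma krunitV_equiv X : @kequiv _ _ X (ktens X kone) (runitV _).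
Proof. by rewrite /kequiv /= runitV_nat. Qed.
Lemma ksym_equiv X Y : @kequiv _ _ (ktens X Y) (ktens Y X) (sym _ _).
Proof. by rewrite /kequiv /= sym_nat. Qed.
Lemma kidm_equiv X : @kequiv _ _ X X (idm _).
Proof. by rewrite /kequiv mcomp1l mcomp1r. Qed.
Lemma ktens_equiv X X' Y Y' (f : hom (kbase X) (kbase X')) (g : hom (kbase Y) (kbase Y')) :
  kequiv f -> kequiv g -> @kequiv _ _ (ktens X Y) (ktens X' Y') (f ⊠ g).
Proof. by rewrite /kequiv /= -!tensm_comp => -> ->. Qed.

Lemma kmk_tens X X' Y Y' (f : hom (kbase X) (kbase X')) (g : hom (kbase Y) (kbase Y')) :
  ktensm (kmk f) (kmk g) = @kmk _ _ (ktens X Y) (ktens X' Y') (f ⊠ g).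
Proof. by apply: val_inj; rewrite /= !tensm_comp. Qed.

Local Hint Resolve kassoc_equiv kassocV_equiv klunit_equiv klunitV_equiv
  krunit_equiv krunitV_equiv ksym_equiv kidm_equiv ktens_equiv kval_equiv
  kequiv_comp : core.

Lemma ktensm1 X Y : ktensm (kidm X) (kidm Y) = kidm (ktens X Y).
Proof. exact: val_inj. Qed.
Lemma ktensm_comp X X' X'' Y Y' Y''
    (f' : khom X' X'') (f : khom X X') (g' : khom Y' Y'') (g : khom Y Y') :
  ktensm (kmcomp f' f) (kmcomp g' g) = kmcomp (ktensm f' g') (ktensm f g).
Proof. by apply: val_inj; rewrite /= tensm_comp. Qed.
Lemma ktensmPl X X' Y Y' a (f f' : khom X X') (g : khom Y Y') :
  ktensm (a *: f + f') g = a *: ktensm f g + ktensm f' g.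
Proof. by apply: val_inj; rewrite /= !(kval_lin, tensmPl). Qed.
Lemma ktensmPr X X' Y Y' a (f : khom X X') (g g' : khom Y Y') :
  ktensm f (a *: g + g') = a *: ktensm f g + ktensm f g'.
Proof. by apply: val_inj; rewrite /= !(kval_lin, tensmPr). Qed.

Lemma kassocK X Y Z : kmcomp (kassocV X Y Z) (kassoc X Y Z) = kidm _.
Proof. by rewrite kmk_comp // assocK kmk1. Qed.
Lemma kassocVK X Y Z : kmcomp (kassoc X Y Z) (kassocV X Y Z) = kidm _.
Proof. by rewrite kmk_comp // assocVK kmk1. Qed.
Lemma klunitK X : kmcomp (klunitV X) (klunit X) = kidm _.
Proof. by rewrite kmk_comp // lunitK kmk1. Qed.
Lemma klunitVK X : kmcomp (klunit X) (klunitV X) = kidm _.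
Proof. by rewrite kmk_comp // lunitVK kmk1. Qed.
Lemma krunitK X : kmcomp (krunitV X) (krunit X) = kidm _.
Proof. by rewrite kmk_comp // runitK kmk1. Qed.
Lemma krunitVK X : kmcomp (krunit X) (krunitV X) = kidm _.
Proof. by rewrite kmk_comp // runitVK kmk1. Qed.
Lemma ksymK X Y : kmcomp (ksym Y X) (ksym X Y) = kidm _.
Proof. by rewrite kmk_comp // symK kmk1. Qed.

Lemma kassoc_nat X X' Y Y' Z Z' (f : khom X X') (g : khom Y Y') (h : khom Z Z') :
  kmcomp (kassoc X' Y' Z') (ktensm (ktensm f g) h) =
  kmcomp (ktensm f (ktensm g h)) (kassoc X Y Z).
Proof.
rewrite -[f]kvalK -[g]kvalK -[h]kvalK !kmk_tens.
by rewrite !kmk_comp ?assoc_nat; auto.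
Qed.
Lemma klunit_nat X X' (f : khom X X') :
  kmcomp (klunit X') (ktensm (kidm kone) f) = kmcomp f (klunit X).
Proof.
rewrite -[f]kvalK -kmk1 !kmk_tens.
by rewrite !kmk_comp ?lunit_nat; auto.
Qed.
Lemma krunit_nat X X' (f : khom X X') :
  kmcomp (krunit X') (ktensm f (kidm kone)) = kmcomp f (krunit X).
Proof.
rewrite -[f]kvalK -kmk1 !kmk_tens.
by rewrite !kmk_comp ?runit_nat; auto.
Qed.
Lemma ksym_nat X X' Y Y' (f : khom X X') (g : khom Y Y') :
  kmcomp (ksym X' Y') (ktensm f g) = kmcomp (ktensm g f) (ksym X Y).
Proof.
rewrite -[f]kvalK -[g]kvalK !kmk_tens.
by rewrite !kmk_comp ?sym_nat; auto.
Qed.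

Lemma kpentagon W X Y Z :
  kmcomp (kassoc W X (ktens Y Z)) (kassoc (ktens W X) Y Z) =
  kmcomp (ktensm (kidm W) (kassoc X Y Z)) (kmcomp (kassoc W (ktens X Y) Z)
    (ktensm (kassoc W X Y) (kidm Z))).
Proof. by rewrite -!kmk1 !kmk_tens !kmk_comp ?pentagon; auto 10. Qed.

Lemma ktriangle X Y :
  kmcomp (ktensm (kidm X) (klunit Y)) (kassoc X kone Y) =
  ktensm (krunit X) (kidm Y).
Proof. by rewrite -!kmk1 !kmk_tens !kmk_comp ?triangle; auto 10. Qed.

Lemma khexagon X Y Z :
  kmcomp (kassoc Y Z X) (kmcomp (ksym X (ktens Y Z)) (kassoc X Y Z)) =
  kmcomp (ktensm (kidm Y) (ksym X Z)) (kmcomp (kassoc Y X Z)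
    (ktensm (ksym X Y) (kidm Z))).
Proof. by rewrite -!kmk1 !kmk_tens !kmk_comp ?hexagon; auto 10. Qed.

Definition karSym : symCat K :=
  @SymCat K (karLin A) ktens ktensm kone kassoc kassocV klunit klunitV
    krunit krunitV ksym ktensm1 ktensm_comp ktensmPl ktensmPr
    kassocK kassocVK klunitK klunitVK krunitK krunitVK ksymK
    kassoc_nat klunit_nat krunit_nat ksym_nat kpentagon ktriangle khexagon.

End KarSym.

Section KarRigid.
Variables (K : fieldType) (A : rigidCat K).
Notation karObj := (karObj A).
Implicit Types X : karObj.

Fact kdual_proof X :
  transp (kproj X) ∘ transp (kproj X) = transp (kproj X).
Proof. by rewrite -transp_comp kproj_idem. Qed.
Definition kdual X : karObj := KarObj (kdual_proof X).

Definition kev X : khom (ktens (kdual X) X) (kone A) :=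
  @kmk _ _ (ktens (kdual X) X) (kone A) (ev (kbase X)).
Definition kcoev X : khom (kone A) (ktens X (kdual X)) :=
  @kmk _ _ (kone A) (ktens X (kdual X)) (coev (kbase X)).

Lemma kval_kev X :
  kval (kev X) = ev (kbase X) ∘ (idm _ ⊠ kproj X).
Proof.
rewrite /= mcomp1l tensm_lr mcompA transpE -mcompA -tensm_compr.
by rewrite kproj_idem.
Qed.

Lemma kval_kev' X :
  kval (kev X) = ev (kbase X) ∘ (transp (kproj X) ⊠ idm _).
Proof. by rewrite kval_kev transpE. Qed.

Lemma kval_kcoev X : kval (kcoev X) = (kproj X ⊠ transp (kproj X)) ∘ coev (kbase X).
Proof. by rewrite /= mcomp1r. Qed.

Lemma krigidl X :
  kmcomp (krunit X) (kmcomp (ktensm (kidm X) (kev X))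
    (kmcomp (kassoc X (kdual X) X)
      (kmcomp (ktensm (kcoev X) (kidm X)) (klunitV X)))) = kidm X.
Proof.
apply: val_inj.
change (kval (krunit X) ∘ (kproj X ⊠ kval (kev X)) ∘ kval (kassoc X (kdual X) X)
  ∘ (kval (kcoev X) ⊠ kproj X) ∘ kval (klunitV X) = kproj X).
rewrite (kval_mkl (krunit_equiv X)) (kval_mkr (klunitV_equiv X)).
rewrite (kval_mkr (kassoc_equiv X (kdual X) X)) kval_kcoev kval_kev /=.
set e := kproj X; set t := transp e.
have ee : e ∘ e = e := kproj_idem X.
have tt : t ∘ t = t := kdual_proof X.
have tE : ev _ ∘ (t ⊠ idm _) = ev _ ∘ (idm _ ⊠ e) := transpE e.
clearbody t e.
have s1 : ((e ⊠ t) ⊠ e) ∘ (((e ⊠ t) ∘ coev (kbase X)) ⊠ e) =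
          ((e ⊠ t) ⊠ e) ∘ (coev (kbase X) ⊠ idm _).
  by rewrite -!tensm_comp mcompA -tensm_comp ee tt mcomp1r.
have s3 : (e ⊠ (ev (kbase X) ∘ (idm _ ⊠ e))) ∘ (e ⊠ (t ⊠ e)) =
    (e ⊠ idm tunit) ∘ (idm _ ⊠ ev (kbase X)) ∘ (idm _ ⊠ (idm _ ⊠ e)).
  rewrite -!tensm_comp ee !mcomp1l !mcomp1r -mcompA -tensm_comp mcomp1l ee.
  by rewrite [t ⊠ e]tensm_lr mcompA tE -mcompA -tensm_comp ee mcomp1l.
rewrite -!mcompA [((e ⊠ t) ⊠ e) ∘ _]mcompA s1 -!mcompA.
rewrite [assoc _ _ _ ∘ _]mcompA assoc_nat -!mcompA.
rewrite [(e ⊠ (_ ∘ _)) ∘ _]mcompA s3 -!mcompA.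
rewrite [(idm _ ⊠ (idm _ ⊠ e)) ∘ _]mcompA -assoc_nat -!mcompA.
rewrite [((idm _ ⊠ idm _) ⊠ e) ∘ _]mcompA tensm1 -tensm_rl.
rewrite [coev _ ⊠ e]tensm_lr -!mcompA.
rewrite [(idm tunit ⊠ e) ∘ _]mcompA -lunitV_nat -!mcompA ee.
rewrite [runit _ ∘ _]mcompA runit_nat -!mcompA.
have z := rigidl (kbase X).
have -> : runit (kbase X) ∘ (idm _ ⊠ ev _) ∘ assoc _ _ _ ∘ (coev _ ⊠ idm _)
   ∘ lunitV (kbase X) ∘ e = e by rewrite -[RHS]mcomp1l -[in RHS]z -!mcompA.
by rewrite !ee.
Qed.

Lemma krigidr X :
  kmcomp (klunit (kdual X)) (kmcomp (ktensm (kev X) (kidm (kdual X)))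
    (kmcomp (kassocV (kdual X) X (kdual X))
      (kmcomp (ktensm (kidm (kdual X)) (kcoev X)) (krunitV (kdual X))))) =
  kidm (kdual X).
Proof.
apply: val_inj.
change (kval (klunit (kdual X)) ∘ (kval (kev X) ⊠ kproj (kdual X))
  ∘ kval (kassocV (kdual X) X (kdual X))
  ∘ (kproj (kdual X) ⊠ kval (kcoev X)) ∘ kval (krunitV (kdual X)) = kproj (kdual X)).
rewrite (kval_mkl (klunit_equiv (kdual X))) (kval_mkr (krunitV_equiv (kdual X))).
rewrite (kval_mkr (kassocV_equiv (kdual X) X (kdual X))) kval_kcoev kval_kev' /=.
set e := kproj X; set t := transp e.
have ee : e ∘ e = e := kproj_idem X.
have tt : t ∘ t = t := kdual_proof X.
have tE : ev _ ∘ (t ⊠ idm _) = ev _ ∘ (idm _ ⊠ e) := transpE e.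
clearbody t e.
have s1 : (t ⊠ (e ⊠ t)) ∘ (t ⊠ ((e ⊠ t) ∘ coev (kbase X))) =
          (t ⊠ (e ⊠ t)) ∘ (idm _ ⊠ coev (kbase X)).
  by rewrite -!tensm_comp mcompA -tensm_comp ee tt mcomp1r.
have s3 : ((ev (kbase X) ∘ (t ⊠ idm _)) ⊠ t) ∘ ((t ⊠ e) ⊠ t) =
    (idm tunit ⊠ t) ∘ (ev (kbase X) ⊠ idm _) ∘ ((t ⊠ idm _) ⊠ idm _).
  rewrite -!tensm_comp tt !mcomp1l !mcomp1r -mcompA -tensm_comp mcomp1l tt.
  by rewrite [t ⊠ e]tensm_rl mcompA -tE -mcompA -tensm_comp tt mcomp1l.
rewrite -!mcompA [(t ⊠ (e ⊠ t)) ∘ _]mcompA s1 -!mcompA.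
rewrite [assocV _ _ _ ∘ _]mcompA assocV_nat -!mcompA.
rewrite [((_ ∘ _) ⊠ t) ∘ _]mcompA s3 -!mcompA.
rewrite [((t ⊠ idm _) ⊠ idm _) ∘ _]mcompA -assocV_nat -!mcompA.
rewrite [(t ⊠ (idm _ ⊠ idm _)) ∘ _]mcompA tensm1 -tensm_lr.
rewrite [t ⊠ coev _]tensm_rl -!mcompA.
rewrite [(t ⊠ idm tunit) ∘ _]mcompA -runitV_nat -!mcompA tt.
rewrite [lunit _ ∘ _]mcompA lunit_nat -!mcompA.
have z := rigidr (kbase X).
have -> : lunit _ ∘ (ev _ ⊠ idm _) ∘ assocV _ _ _ ∘ (idm _ ⊠ coev (kbase X))
   ∘ runitV _ ∘ t = t by rewrite -[RHS]mcomp1l -[in RHS]z -!mcompA.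
by rewrite !tt.
Qed.

Definition karRigid : rigidCat K :=
  @RigidCat K (karSym A) kdual kev kcoev krigidl krigidr.

End KarRigid.

(* Deligne's category: the idempotent completion of the additive envelope of
   the category of partitions. *)
Definition repS (K : fieldType) (t : K) : rigidTensorCat K :=
  @RigidTensorCat K (karRigid (addRigid (partRigid t)))
    (karLin_additive (addLin_additive (partLin t)))
    (@karLin_pseudo_abelian _ (addLin (partLin t))).

(* Main.v *)
From HB Require Import structures.
Require Import Defs.
From mathcomp Require Import all_boot all_order all_algebra all_fingroup.
From mathcomp Require Import boolp reals.
From mathcomp Require Import complex.
From mathcomp Require Import ring zify.
Import Defs.

(** For t outside of the natural numbers, every morphism f of Rep(S_t) is
    regular (f g f = f for some g); with finite-dimensional Hom spaces and split
    idempotents this makes the category abelian semisimple.  Regularity is proved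
    on the objects [n], by induction on n: by the Gram matrix of partitions, the
    composition pairing between [n] and [n+1] is nondegenerate, so that retracts
    of [n] can be split off [n+1] until nothing maps to or from [n]; the
    partitions which are not permutations factor through [n], hence act by zero
    on what is left, and Maschke's theorem for the symmetric group applies.

    Let V be the image of p = 1 - J/t on [1], of Euler characteristic t - 1, and
    let X be the exterior square of V, of Euler characteristic (t-1)(t-2)/2.
    Both have scalar endomorphisms only.  If t^2 - 3t - 2 = 0, then X has Euler
    characteristic 2 while t is not an integer, and V is a direct summand of
    X ⊗ X because there is a nonzero morphism V -> X ⊗ X. *)

Set Implicit Arguments.
Unset Strict Implicit.
Unset Printing Implicit Defensive.

Import GRing.Theory Num.Theory.
Local Open Scope ring_scope.
Local Open Scope cat_scope.

(** * Regular categories *)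

Section RegularCategories.
Variables (K : fieldType) (A : linCat K).
Implicit Types W X Y Z : A.

(** Regularity is used instead of semisimplicity of endomorphism algebras because it concerns one
    morphism at a time: it passes to retracts and, by McCoy's lemma, to finite direct sums, hence to
    matrices and to images of idempotents. The category of partitions has too few images to split
    anything off, so the induction step is carried out in its idempotent completion and read back as
    a statement about an idempotent [v] of [n+1]. The exterior square enters because V is not of
    integral type for non-integral t, while the Euler characteristic of X is quadratic in t.
    Prescribing (t-1)(t-2)/2 = k gives a quadratic equation of discriminant 1 + 8k, and k = 2 is the
    first natural number for which this is not a square (1, 9, 17). Identities between diagrams,
    traces included, are checked on matrices indexed by two-colourings, where a loop counts 2; this
    single value suffices because it determines both the partition and the power of t. That the
    morphism V -> X ⊗ X is nonzero is seen on the coefficient of a single partition. *)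

Definition regular_hom X Y (f : hom X Y) : Prop := exists g : hom Y X, f ∘ g ∘ f = f.

Definition homs_regular X Y : Prop := forall f : hom X Y, regular_hom f.

Definition is_retract X Y : Prop :=
  exists (i : hom X Y) (p : hom Y X), p ∘ i = idm X.

Lemma mcompNl X Y Z (g : hom Y Z) (f : hom X Y) : (- g) ∘ f = - (g ∘ f).
Proof. by rewrite -scaleN1r mcompZl scaleN1r. Qed.
Lemma mcompNr X Y Z (g : hom Y Z) (f : hom X Y) : g ∘ (- f) = - (g ∘ f).
Proof. by rewrite -scaleN1r mcompZr scaleN1r. Qed.
Lemma mcompBl X Y Z (g g' : hom Y Z) (f : hom X Y) : (g - g') ∘ f = g ∘ f - g' ∘ f.
Proof. by rewrite mcompDl mcompNl. Qed.
Lemma mcompBr X Y Z (g : hom Y Z) (f f' : hom X Y) : g ∘ (f - f') = g ∘ f - g ∘ f'.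
Proof. by rewrite mcompDr mcompNr. Qed.

(** McCoy's lemma: if [y] is a quasi-inverse of f - fgf = (1 - fg) f = f (1 - gf), then g + (1 - gf)
    y (1 - fg) is one of [f]. Quasi-inverses can thus be built in stages. *)
Lemma regular_hom_sub X Y (f : hom X Y) (g : hom Y X) :
  regular_hom (f - f ∘ g ∘ f) -> regular_hom f.
Proof.
case=> y; rewrite !(mcompBl, mcompBr) => e.
exists (g + (idm X - g ∘ f) ∘ y ∘ (idm Y - f ∘ g)).
rewrite !(mcompBl, mcompBr, mcompDl, mcompDr, mcomp1l, mcomp1r) -?mcompA.
move: e; rewrite -?mcompA => e.
rewrite -[RHS](subrK (f ∘ g ∘ f)) -e addrC; congr (_ + _).
Qed.

Lemma regular_hom_inverse X Y (f : hom X Y) : regular_hom f ->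
  exists g : hom Y X, f ∘ g ∘ f = f /\ g ∘ f ∘ g = g.
Proof.
case=> g e; have e' W (u : hom W X) : f ∘ g ∘ f ∘ u = f ∘ u.
  by rewrite -[in RHS]e -!mcompA.
by exists (g ∘ f ∘ g); rewrite -!mcompA !e' e.
Qed.

Lemma homs_regular_retract X X' Y Y' :
  is_retract X X' -> is_retract Y Y' -> homs_regular X' Y' -> homs_regular X Y.
Proof.
move=> [i [p pi]] [j [q qj]] H f; have [g e] := H (j ∘ f ∘ p).
exists (p ∘ g ∘ j); rewrite -[LHS]mcomp1l -[LHS]mcomp1r -qj -pi.
transitivity (q ∘ ((j ∘ f ∘ p) ∘ g ∘ (j ∘ f ∘ p)) ∘ i); first by rewrite -!mcompA.
by rewrite e -!mcompA pi mcomp1r mcompA qj mcomp1l.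
Qed.

Lemma is_retract_refl X : is_retract X X.
Proof. by exists (idm X), (idm X); rewrite mcomp1l. Qed.

Lemma is_retract_trans X Y Z : is_retract X Y -> is_retract Y Z -> is_retract X Z.
Proof.
move=> [i [p pi]] [j [q qj]]; exists (j ∘ i), (p ∘ q).
by rewrite -mcompA [q ∘ _]mcompA qj mcomp1l.
Qed.

(** McCoy's lemma clears the components of the morphism one summand at a time: subtracting f (i k) y
    f kills the component [k] and keeps those that vanish already. The list [s] holds the summands
    still to be cleared. *)
Lemma homs_regular_sumr n (S : 'I_n -> A) X Y :
  is_direct_sum S X -> (forall k, homs_regular (S k) Y) -> homs_regular X Y.
Proof.
move=> [i [p [pi pi0 sum1]]] H f.
suff: forall s : seq 'I_n, uniq s -> forall f : hom X Y,
    (forall k, k \notin s -> f ∘ i k = 0) -> regular_hom f.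
  by move/(_ (enum 'I_n) (enum_uniq _)); apply=> k; rewrite mem_enum.
elim=> [_ g g0|k s IH /= /andP[ks us] g g0].
  exists 0; rewrite mcomp0l mcomp0r -[g]mcomp1r -sum1 mcomp_sumr big1 // => l _.
  by rewrite mcompA g0 ?mcomp0l.
have [y e] := H k (g ∘ i k).
apply: (@regular_hom_sub _ _ _ (i k ∘ y)); apply: (IH us) => l ls.
rewrite mcompBl -!mcompA; have [->|lk] := eqVneq l k.
  by move: e; rewrite -!mcompA => ->; rewrite subrr.
by rewrite g0 ?inE ?negb_or ?lk // !mcomp0r subrr.
Qed.

Lemma homs_regular_suml n (S : 'I_n -> A) X Y :
  is_direct_sum S Y -> (forall k, homs_regular X (S k)) -> homs_regular X Y.
Proof.
move=> [i [p [pi pi0 sum1]]] H f.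
suff: forall s : seq 'I_n, uniq s -> forall f : hom X Y,
    (forall k, k \notin s -> p k ∘ f = 0) -> regular_hom f.
  by move/(_ (enum 'I_n) (enum_uniq _)); apply=> k; rewrite mem_enum.
elim=> [_ g g0|k s IH /= /andP[ks us] g g0].
  exists 0; rewrite mcomp0l mcomp0r -[g]mcomp1l -sum1 mcomp_suml big1 // => l _.
  by rewrite -mcompA g0 ?mcomp0r.
have [y e] := H k (p k ∘ g).
apply: (@regular_hom_sub _ _ _ (y ∘ p k)); apply: (IH us) => l ls.
rewrite mcompBr; have [->|lk] := eqVneq l k.
  by move: e; rewrite -!mcompA => ->; rewrite subrr.
by rewrite mcompA g0 ?inE ?negb_or ?lk // mcomp0l subrr.
Qed.

Lemma is_biprod_direct_sum X Y Z (i : hom X Z) (j : hom Y Z) p q :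
  is_biprod i j p q ->
  is_direct_sum (fun k : 'I_2 => if k == ord0 then X else Y) Z.
Proof.
move=> [pi qj pj qi s].
exists (fun k : 'I_2 => if k == ord0 as b return hom (if b then X else Y) Z then i else j).
exists (fun k : 'I_2 => if k == ord0 as b return hom Z (if b then X else Y) then p else q).
split=> [k|k l|]; first by case: (k == ord0).
  by case: k l => [[|[|//]] ?] [[|[|//]] ?].
by rewrite big_ord_recl big_ord1.
Qed.

Lemma split_mono_biprod X Y (i : hom X Y) (p : hom Y X) :
  is_pseudo_abelian A -> p ∘ i = idm X ->
  exists Z (j : hom Z Y) (q : hom Y Z), is_biprod i j p q.
Proof.
move=> pab pi; have [|Z [j [q [qj jq]]]] := pab Y (idm Y - i ∘ p).
  rewrite mcompBl !mcompBr !mcomp1l mcomp1r -!mcompA [p ∘ _ ∘ _]mcompA pi mcomp1l.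
  by rewrite subrr subr0.
exists Z, j, q; split=> //.
- have ej : j = (idm Y - i ∘ p) ∘ j by rewrite -jq -mcompA qj mcomp1r.
  by rewrite ej mcompA mcompBr mcomp1r mcompA pi mcomp1l subrr mcomp0l.
- have eq : q = q ∘ (idm Y - i ∘ p) by rewrite -jq mcompA qj mcomp1l.
  by rewrite eq -mcompA mcompBl mcomp1l -mcompA pi mcomp1r subrr mcomp0r.
by rewrite jq addrC subrK.
Qed.

Lemma biprod_retract X Y Z (i : hom X Z) (j : hom Y Z) p q :
  is_biprod i j p q -> is_retract X Z /\ is_retract Y Z.
Proof. by case=> pi qj _ _ _; split; [exists i, p | exists j, q]. Qed.

(** A spanning family bounds the dimension without a choice of basis; [n] is the measure of the
    inductions that split off summands. *)
Definition dim_le X (n : nat) : Prop :=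
  exists b : 'I_n -> hom X X, forall f, exists c : 'I_n -> K, f = \sum_k c k *: b k.

Lemma dim_le0 X : dim_le X 0 -> is_zero_obj X.
Proof. by case=> b /(_ (idm X))[c]; rewrite big_ord0. Qed.

(* The compression [a |-> p ∘ a ∘ i] onto [hom X X] is onto and kills the
   nonzero projection [j ∘ q]. *)
Lemma dim_le_biprod X Y Z (i : hom X Z) (j : hom Y Z) p q n :
  is_biprod i j p q -> ~ is_zero_obj Y -> dim_le Z n.+1 -> dim_le X n.
Proof.
move=> [pi qj pj qi _] Y0 [b bP]; have [c jq] := bP (j ∘ q).
have [k ck0] : exists k, c k != 0.
  apply: contra_notP Y0 => /forallNP c0; rewrite /is_zero_obj.
  have z : j ∘ q = 0.
    rewrite jq big1 // => k _; move/negP: (c0 k); rewrite negbK => /eqP->.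
    by rewrite scale0r.
  have -> : idm Y = q ∘ (j ∘ q) ∘ j by rewrite -mcompA qj mcomp1r.
  by rewrite z mcomp0l mcomp0r.
pose F a := p ∘ a ∘ i.
have Fl n' (d : 'I_n' -> K) (v : 'I_n' -> hom Z Z) :
    F (\sum_l d l *: v l) = \sum_l d l *: F (v l).
  rewrite /F mcomp_suml mcomp_sumr; apply: eq_bigr => l _.
  by rewrite mcompZl mcompZr.
have Fjq : F (j ∘ q) = 0 by rewrite /F mcompA mcompA pj !mcomp0l.
move: (Fjq); rewrite jq Fl (bigD1_ord k) //= => /eqP; rewrite addr_eq0 => /eqP Fk.
exists (fun l => F (b (lift k l))) => a; have [d aE] := bP (i ∘ a ∘ p).
have -> : a = F (i ∘ a ∘ p) by rewrite /F -!mcompA pi mcomp1r mcompA pi mcomp1l.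
rewrite aE Fl (bigD1_ord k) //=.
have -> : d k *: F (b k) = \sum_l (- (d k / c k * c (lift k l))) *: F (b (lift k l)).
  have -> : F (b k) = (c k)^-1 *: (c k *: F (b k)) by rewrite scalerA mulVf ?scale1r.
  rewrite Fk !scalerN scalerA scaler_sumr -sumrN; apply: eq_bigr => l _.
  by rewrite scalerA -scaleNr.
by eexists => /=; rewrite -big_split /=; apply: eq_bigr => l _; rewrite -scalerDl.
Qed.

(** The pairing takes its values in hom Y Y and involves no trace, so it restricts at once to
    retracts of [X]. *)
Definition nondegenerate X Y : Prop :=
  (forall f : hom Y X, f <> 0 -> exists h : hom X Y, h ∘ f <> 0) /\
  (forall h : hom X Y, h <> 0 -> exists f : hom Y X, h ∘ f <> 0).

Lemma nondegenerate_retract X X' Y :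
  is_retract X' X -> nondegenerate X Y -> nondegenerate X' Y.
Proof.
move=> [i [p pi]] [nd1 nd2]; split=> [f f0|h h0].
  have [|h hf] := nd1 (i ∘ f).
    by move=> e; apply: f0; rewrite -[f]mcomp1l -pi -mcompA e mcomp0r.
  by exists (h ∘ i); rewrite -mcompA.
have [|f hf] := nd2 (h ∘ p).
  by move=> e; apply: h0; rewrite -[h]mcomp1r -pi mcompA e mcomp0l.
by exists (p ∘ f); rewrite mcompA.
Qed.

Lemma homs_regular0 X Y : (forall f : hom X Y, f = 0) -> homs_regular X Y.
Proof. by move=> H f; exists 0; rewrite mcomp0l mcomp0r (H f). Qed.

(* Splitting off [X] the retracts of [Y] one after the other, what is left has
   no nonzero morphism to or from [Y]. *)
Lemma homs_regular_split X Y n : is_pseudo_abelian A -> dim_le X n ->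
  homs_regular Y Y -> nondegenerate X Y ->
  (forall W, is_retract W X -> (forall f : hom Y W, f = 0) ->
     (forall h : hom W Y, h = 0) -> homs_regular W W) ->
  [/\ homs_regular X X, homs_regular X Y & homs_regular Y X].
Proof.
move=> pab; elim: n X => [|n IH] X dX YY nd HW.
  have X0 := dim_le0 dX.
  split; apply: homs_regular0 => f; first by rewrite -[f]mcomp1l X0 mcomp0l.
    by rewrite -[f]mcomp1r X0 mcomp0r.
  by rewrite -[f]mcomp1l X0 mcomp0l.
have [f0|] := EM (forall f : hom Y X, f = 0).
  (* Without morphisms from [Y], nondegeneracy leaves none to [Y] either, and the hypothesis on what
     is left applies to [X] itself. *)
  have h0 (h : hom X Y) : h = 0.
    by apply: contrapT => hn0; have [f] := nd.2 h hn0; rewrite (f0 f) mcomp0r.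
  split; [exact: (HW _ (is_retract_refl X))|exact: homs_regular0|exact: homs_regular0].
move=> /existsNP[f fn0]; have [h hf] := nd.1 f fn0.
have [c [bcb cbc]] := regular_hom_inverse (YY (h ∘ f)).
(* An idempotent, because c (h f) c = c. It factors through [Y], so its image is a retract of [Y],
   and it is nonzero because h e f = h f. *)
pose e := f ∘ c ∘ h.
have ee : e ∘ e = e.
  transitivity (f ∘ (c ∘ (h ∘ f) ∘ c) ∘ h); first by rewrite /e -!mcompA.
  by rewrite cbc.
have [X1 [i [p [pi ip]]]] := pab X e ee.
have [X2 [j [q bp]]] := split_mono_biprod pab pi.
have X1Y : is_retract X1 Y.
  exists (h ∘ i), (p ∘ f ∘ c).
  transitivity (p ∘ e ∘ i); first by rewrite /e -!mcompA.
  by rewrite -ip -!mcompA pi mcomp1r.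
have X1n0 : ~ is_zero_obj X1.
  move=> z; apply: hf; rewrite -bcb.
  transitivity (h ∘ e ∘ f); first by rewrite /e -!mcompA.
  by rewrite -ip -(mcomp1r i) z mcomp0r !(mcomp0l, mcomp0r).
have bp' : is_biprod j i q p by case: bp => *; split=> //; rewrite addrC.
have dX2 : dim_le X2 n by apply: dim_le_biprod bp' X1n0 dX.
have [rX1 rX2] := biprod_retract bp.
have [] := IH X2 dX2 YY (nondegenerate_retract rX2 nd).
  by move=> W rW; apply: HW; apply: is_retract_trans rX2.
move=> H22 H2Y HY2.
have rY := is_retract_refl Y; have rX := is_retract_refl X2.
have H12 := homs_regular_retract X1Y rX HY2.
have H21 := homs_regular_retract rX X1Y H2Y.
have H11 := homs_regular_retract X1Y X1Y YY.
have H1Y := homs_regular_retract X1Y rY YY.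
have HY1 := homs_regular_retract rY X1Y YY.
have ds := is_biprod_direct_sum bp.
split.
- by apply: (homs_regular_suml ds) => k; apply: (homs_regular_sumr ds) => l;
    case: eqP; case: eqP.
- by apply: (homs_regular_sumr ds) => l; case: eqP.
by apply: (homs_regular_suml ds) => l; case: eqP.
Qed.

End RegularCategories.

(** * Regularity and split idempotents give an abelian semisimple category *)

Section RegularAbelian.
Variables (K : fieldType) (A : linCat K).
Hypothesis reg : forall X Y : A, homs_regular X Y.
Hypothesis pab : is_pseudo_abelian A.
Implicit Types W X Y Z : A.

Lemma mono_split X Y (f : hom X Y) : is_mono f -> exists g : hom Y X, g ∘ f = idm X.
Proof.
by move=> mf; have [g e] := reg f; exists g; apply: mf; rewrite e mcomp1r.
Qed.

Lemma epi_split X Y (f : hom X Y) : is_epi f -> exists g : hom Y X, f ∘ g = idm Y.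
Proof.
by move=> ef; have [g e] := reg f; exists g; apply: ef; rewrite -mcompA e mcomp1l.
Qed.

(** If f g f = f, the kernel of [f] is the image of the idempotent 1 - gf. *)
Lemma regular_kernel X Y (f : hom X Y) : exists N (k : hom N X), is_kernel f k.
Proof.
have [g e] := reg f.
have [|N [k [q [qk kq]]]] := pab (e := idm X - g ∘ f).
  rewrite mcompBl !mcompBr !mcomp1l mcomp1r -!mcompA e.
  by rewrite subrr subr0.
exists N, k; split=> [|W u fu].
  have ek : k = (idm X - g ∘ f) ∘ k by rewrite -kq -mcompA qk mcomp1r.
  by rewrite ek mcompA mcompBr mcomp1r e subrr mcomp0l.
exists (q ∘ u); split=> [|v <-].
  by rewrite mcompA kq mcompBl mcomp1l -mcompA fu mcomp0r subr0.
by rewrite mcompA qk mcomp1l.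
Qed.

Lemma regular_cokernel X Y (f : hom X Y) : exists Q (c : hom Y Q), is_cokernel f c.
Proof.
have [g e] := reg f.
have [|Q [k [q [qk kq]]]] := pab (e := idm Y - f ∘ g).
  rewrite mcompBl !mcompBr !mcomp1l mcomp1r -!mcompA [g ∘ f ∘ g]mcompA mcompA.
  by rewrite [f ∘ g ∘ f]mcompA -[(f ∘ g) ∘ f]mcompA e subrr subr0.
exists Q, q; split=> [|W u uf].
  have eq : q = q ∘ (idm Y - f ∘ g) by rewrite -kq mcompA qk mcomp1l.
  by rewrite eq -mcompA mcompBl mcomp1l -mcompA e subrr mcomp0r.
exists (u ∘ k); split=> [|v <-].
  by rewrite -mcompA kq mcompBr mcomp1r mcompA uf mcomp0l subr0.
by rewrite -mcompA qk mcomp1r.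
Qed.

(** Monomorphisms and epimorphisms split, by cancelling [f] in f g f = f. A monomorphism [f] with
    retraction [g] is then a kernel of 1 - fg, and dually. *)
Lemma regular_abelian : is_additive A -> is_abelian A.
Proof.
move=> add; split=> //; [exact: regular_kernel|exact: regular_cokernel| |].
  move=> X Y f mf; have [g gf] := mono_split mf.
  exists Y, (idm Y - f ∘ g); split=> [|W u].
    by rewrite mcompBl mcomp1l -mcompA gf mcomp1r subrr.
  rewrite mcompBl mcomp1l => /eqP; rewrite subr_eq0 -mcompA => /eqP uE.
  by exists (g ∘ u); split=> [//|v vE]; apply: mf; rewrite -uE.
move=> X Y f ef; have [g fg] := epi_split ef.
exists X, (idm X - g ∘ f); split=> [|W u].
  by rewrite mcompBr mcomp1r mcompA fg mcomp1l subrr.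
rewrite mcompBr mcomp1r => /eqP; rewrite subr_eq0 mcompA => /eqP uE.
by exists (u ∘ g); split=> [//|v vE]; apply: ef; rewrite -uE.
Qed.

Lemma is_direct_sum_biprod X Y Z (i : hom X Z) (j : hom Y Z) p q
    n (S : 'I_n -> A) m (T : 'I_m -> A) :
  is_biprod i j p q -> is_direct_sum S X -> is_direct_sum T Y ->
  is_direct_sum (fun k => match split k with inl l => S l | inr l => T l end) Z.
Proof.
move=> [pi qj pj qi s] [a [b [ba ba0 sX]]] [c [d [dc dc0 sY]]].
pose fam (u : 'I_n + 'I_m) := match u with inl l => S l | inr l => T l end.
pose inj u : hom (fam u) Z :=
  match u with inl l => i ∘ a l | inr l => j ∘ c l end.
pose prj u : hom Z (fam u) :=
  match u with inl l => b l ∘ p | inr l => d l ∘ q end.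
exists (fun k => inj (split k)), (fun k => prj (split k)); split=> [k|k l kl|].
- case: (split k) => u /=; rewrite -mcompA.
    by rewrite [p ∘ _]mcompA pi mcomp1l ba.
  by rewrite [q ∘ _]mcompA qj mcomp1l dc.
- have {kl} : split k != split l.
    by apply: contra kl => /eqP/(congr1 (@unsplit n m)); rewrite !splitK => ->.
  case: (split k) (split l) => u [v|v] uv /=; rewrite -mcompA.
  + by rewrite [p ∘ _]mcompA pi mcomp1l ba0.
  + by rewrite [p ∘ _]mcompA pj mcomp0l mcomp0r.
  + by rewrite [q ∘ _]mcompA qi mcomp0l mcomp0r.
  by rewrite [q ∘ _]mcompA qj mcomp1l dc0.
pose F u : hom Z Z := inj u ∘ prj u.
rewrite big_split_ord /= -s; congr (_ + _).
  rewrite -[in RHS](mcomp1r i) -sX mcomp_sumr mcomp_suml; apply: eq_bigr => k _.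
  rewrite -/(F _) (unsplitK (inl k)) /F /=; by rewrite -!mcompA.
rewrite -[in RHS](mcomp1r j) -sY mcomp_sumr mcomp_suml; apply: eq_bigr => k _.
rewrite -/(F _) (unsplitK (inr k)) /F /=; by rewrite -!mcompA.
Qed.

(** A nonzero object that is not simple has a subobject which is neither zero nor everything. It
    splits, and the endomorphisms of both pieces are spanned by fewer elements. *)
Lemma regular_semisimple : (forall X, fin_dim_hom X X) -> is_semisimple A.
Proof.
move=> fd X; have [n dX] := fd X; elim: n X dX => [|n IH] X dX;
  (have [X0|Xn0] := EM (is_zero_obj X);
    first by exists 0%N, (fun=> X); split=> [[]//|]; exists (fun=> 0), (fun=> 0);
      split=> [[]//|[]//|]; rewrite big_ord0 X0).
  by case: Xn0; apply: dim_le0.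
have [sX|nsX] := EM (is_simple X).
  exists 1%N, (fun=> X); split=> // ; exists (fun=> idm X), (fun=> idm X).
  by split=> [_|k l|]; rewrite ?big_ord1 ?mcomp1l // !ord1.
have [Y [i [mi [Yn0 niso]]]] : exists Y (i : hom Y X),
    is_mono i /\ ~ is_zero_obj Y /\ ~ is_iso i.
  apply: contra_notP nsX => H; split=> // Y i mi.
  have [?|Yn0] := EM (is_zero_obj Y); first by left.
  by right; apply: contra_notP H => ni; exists Y, i.
have [p pi] := mono_split mi; have [Z [j [q bp]]] := split_mono_biprod pab pi.
have bp' : is_biprod j i q p by case: bp => *; split=> //; rewrite addrC.
have Zn0 : ~ is_zero_obj Z.
  move=> Z0; apply: niso; exists p; split=> //.
  by case: bp => _ _ _ _ <-; rewrite -(mcomp1r j) Z0 mcomp0r mcomp0l addr0.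
have [m1 [S1 [sS1 dS1]]] := IH _ (dim_le_biprod bp Zn0 dX).
have [m2 [S2 [sS2 dS2]]] := IH _ (dim_le_biprod bp' Yn0 dX).
eexists; eexists; split; last exact: is_direct_sum_biprod bp dS1 dS2.
by move=> k /=; case: (split k).
Qed.

End RegularAbelian.

(** * Objects with scalar endomorphisms *)

Section ScalarEndomorphisms.
Variables (K : fieldType) (A : linCat K).
Implicit Types X Y : A.

Definition scalar_End X : Prop :=
  idm X <> 0 /\ forall f : hom X X, exists a : K, f = a *: idm X.

Lemma scalar_End_ideal X (L : hom X X -> Prop) : scalar_End X -> is_left_ideal L ->
  (forall f, L f -> f = 0) \/ (forall f, L f).
Proof.
move=> [_ sX] [_ Li]; have [|] := EM (forall f, L f -> f = 0); first by left.
move=> /existsNP[f /not_implyP[Lf f0]]; right=> g.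
have [a fE] := sX f; have [b ->] := sX g.
have a0 : a != 0 by apply: contra_notN f0 => /eqP a0; rewrite fE a0 scale0r.
have -> : b *: idm X = ((b / a) *: idm X) ∘ f; last exact: Li.
by rewrite fE mcompZl mcompZr mcomp1l scalerA divfK.
Qed.

Lemma scalar_End_simple X : scalar_End X -> simple_End X.
Proof.
move=> sX; split; first by case: sX.
by move=> L [Li _]; apply: scalar_End_ideal.
Qed.

Lemma scalar_End_semisimple X : scalar_End X -> semisimple_End X.
Proof.
move=> sX L Li; have [L0|LT] := scalar_End_ideal sX Li.
  exists (fun=> True); split=> [|f /L0//|f]; first by split.
  exists 0, f; split=> //; last by rewrite add0r.
  by case: Li => -[].
exists (fun f => f = 0); split=> [|//|f].
  split; last by move=> g f ->; rewrite mcomp0r.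
  by split=> // a f g -> ->; rewrite scaler0 addr0.
by exists f, 0; rewrite addr0.
Qed.

Lemma scalar_End_fin_dim X : scalar_End X -> fin_dim_hom X X.
Proof.
move=> [_ sX]; exists 1%N, (fun=> idm X) => f; have [a ->] := sX f.
by exists (fun=> a); rewrite big_ord1.
Qed.

(** The idempotent i p is a scalar [a] with a (a - 1) = 0, and a = 0 would make the identity p (i p)
    i of [Y] vanish. *)
Lemma scalar_End_retract X Y (i : hom Y X) (p : hom X Y) :
  scalar_End X -> p ∘ i = idm Y -> idm Y <> 0 -> i ∘ p = idm X.
Proof.
move=> [X0 sX] pi Y0; have [a ip] := sX (i ∘ p).
have : (a * (a - 1)) *: idm X = 0.
  rewrite mulrBr mulr1 scalerBl -ip; apply/eqP; rewrite subr_eq0; apply/eqP.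
  rewrite -[in LHS]scalerA -ip.
  transitivity ((a *: idm X) ∘ (i ∘ p)); first by rewrite mcompZl mcomp1l.
  by rewrite -ip -mcompA [p ∘ _]mcompA pi mcomp1l.
move/eqP; rewrite scaler_eq0 mulf_eq0 subr_eq0 => /orP[/orP[/eqP a0|/eqP a1]|/eqP//].
  case: Y0; rewrite -pi -[RHS](mcomp0r _ p).
  by rewrite -[in LHS](mcomp1r i) -pi [i ∘ p ∘ i]mcompA ip a0 scale0r mcomp0l.
by rewrite ip a1 scale1r.
Qed.

(** A Schur argument: if f g f = f, the scalar g f is nonzero because f = f (g f), and dividing [g]
    by it gives a retraction of [f]. *)
Lemma scalar_End_summand X Y (f : hom X Y) :
  is_pseudo_abelian A -> regular_hom f -> scalar_End X -> f <> 0 ->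
  is_direct_summand X Y.
Proof.
move=> pab [g e] [X0 sX] f0; have [a gf] := sX (g ∘ f).
have a0 : a != 0.
  apply: contra_notN f0 => /eqP a0.
  by rewrite -e gf a0 scale0r mcomp0r.
have sf : (a^-1 *: g) ∘ f = idm X by rewrite mcompZl gf scalerA mulVf // scale1r.
by have [Z [j [q bp]]] := split_mono_biprod pab sf; exists Z, f, j, (a^-1 *: g), q.
Qed.

Lemma scalar_End_is_simple X : (forall X Y : A, homs_regular X Y) ->
  scalar_End X -> is_simple X.
Proof.
move=> reg sX; split; first by case: sX.
move=> Y i mi; have [Y0|Yn0] := EM (is_zero_obj Y); [by left | right].
have [p pi] := mono_split reg mi.
by exists p; split=> //; apply: scalar_End_retract pi Yn0.
Qed.

End ScalarEndomorphisms.

(** * Regularity of the additive envelope and of the idempotent completion *)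

Lemma big_unit (V : nmodType) (F : unit -> V) : \sum_i F i = F tt.
Proof. by rewrite (bigD1 tt) //= big1 ?addr0 // => -[]. Qed.

Section EnvelopesRegular.
Variables (K : fieldType) (A : linCat K).

Lemma karLin_regular : (forall X Y : A, homs_regular X Y) ->
  forall X Y : karLin A, homs_regular X Y.
Proof.
move=> reg X Y f; have [g e] := reg _ _ (kval f).
exists (kmk g); apply: val_inj => /=.
by rewrite -!mcompA khomPl !mcompA khomPr -!mcompA.
Qed.

Definition asingle (x : A) : addLin A := AddObj (fun _ : unit => x).

Definition ainj (X : addLin A) (k : aidx X) : hom (asingle (X k)) X :=
  @amono _ _ (asingle (X k)) X (fun=> k) (fun=> idm (X k)).
Definition aprj (X : addLin A) (k : aidx X) : hom X (asingle (X k)) :=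
  @amat _ _ X (asingle (X k)) (fun i _ => entry (aidm X) i k).

Lemma aprj_ainj (X : addLin A) (k l : aidx X) i j :
  entry (aprj k ∘ ainj l) i j = entry (aidm X) l k.
Proof. by rewrite entry_compr entryE mcomp1r. Qed.

Lemma addLin_direct_sum (X : addLin A) :
  is_direct_sum (fun k : 'I_#|aidx X| => asingle (X (enum_val k))) X.
Proof.
exists (fun k => ainj (enum_val k)), (fun k => aprj (enum_val k)); split.
- move=> k; apply: entryP => -[] []; rewrite aprj_ainj.
  rewrite (amono_diag (fun i => idm (X i))).
  by rewrite (amono_diag (X := asingle _) (Y := asingle _) (phi := id) (fun=> idm _)).
- move=> k l kl; apply: entryP => i j; rewrite aprj_ainj entry0 amono_off //.
  by apply: contra kl => /eqP/enum_val_inj ->.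
transitivity (\sum_(k in aidx X) ainj k ∘ aprj k).
  by rewrite [RHS]big_enum_val.
apply: entryP => a b.
have -> : entry (\sum_(k in aidx X) ainj k ∘ aprj k) a b =
          \sum_(k in aidx X) entry (ainj k ∘ aprj k) a b.
  apply: (big_morph (fun M : hom X X => entry M a b)) => [M N|]; first exact: entryD.
  exact: entry0.
rewrite (bigD1 b) //= big1 => [|k kb].
  rewrite addr0 entry_comp big_unit
    (amono_diag (X := asingle _) (Y := X) (phi := fun=> b) (fun=> idm _)).
  by rewrite mcomp1l entryE.
by rewrite entry_comp big_unit amono_off ?mcomp0l.
Qed.

(** Splitting source and target into single summands reduces matrices to one by one blocks, where
    regularity is that of the entry. *)
Lemma addLin_regular : (forall X Y : A, homs_regular X Y) ->
  forall X Y : addLin A, homs_regular X Y.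
Proof.
move=> reg X Y; apply: (homs_regular_sumr (addLin_direct_sum X)) => k.
apply: (homs_regular_suml (addLin_direct_sum Y)) => l f.
have [g e] := reg _ _ (entry f tt tt).
exists (@amat _ _ (asingle _) (asingle _) (fun _ _ => g)).
by apply: entryP => -[] []; rewrite !(entry_comp, big_unit) entryE.
Qed.

End EnvelopesRegular.

(** * Finite-dimensional Hom spaces *)

Section FiniteDimension.
Variables (K : fieldType).

(** Spans of lists are compatible with concatenation and with linear images, which is what direct
    sums and compression by projectors require. *)
Fixpoint in_span (V : lmodType K) (s : seq V) (f : V) : Prop :=
  if s is x :: s' then exists (a : K) g, in_span s' g /\ f = a *: x + g else f = 0.

Lemma in_span_cat (V : lmodType K) (s t : seq V) f g :
  in_span s f -> in_span t g -> in_span (s ++ t) (f + g).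
Proof.
elim: s f => [|x s IH] f /=; first by move=> ->; rewrite add0r.
move=> [a [h [sh ->]]] tg; exists a, (h + g); split; first exact: IH.
by rewrite addrA.
Qed.

Lemma in_span_map (V W : lmodType K) (F : V -> W) s f :
  linear F -> in_span s f -> in_span (map F s) (F f).
Proof.
move=> lF; elim: s f => [|x s IH] f /=.
  by move=> ->; rewrite -[0](scale0r 0) (linZ lF) scale0r.
by move=> [a [g [sg ->]]]; exists a, (F g); split; [apply: IH|apply: lF].
Qed.

Lemma in_spanP (V : lmodType K) (s : seq V) f :
  in_span s f <-> exists c : 'I_(size s) -> K, f = \sum_k c k *: s`_k.
Proof.
elim: s f => [|x s IH] f /=; first by split=> [->|[c]]; [exists (fun=> 0)|]; rewrite big_ord0.
split=> [[a [g [/IH[c ->] ->]]]|[c ->]].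
  exists (fun k => oapp c a (unlift ord0 k)); rewrite big_ord_recl unlift_none /=.
  by congr (_ + _); apply: eq_bigr => k _; rewrite liftK.
exists (c ord0), (\sum_k c (lift ord0 k) *: s`_k); rewrite big_ord_recl; split=> //.
by apply/IH; exists (fun k => c (lift ord0 k)).
Qed.

Variables (A : linCat K).
Implicit Types X Y Z : A.

Lemma fin_dim_homP X Y : fin_dim_hom X Y <-> exists s, forall f : hom X Y, in_span s f.
Proof.
split=> [[n [b bP]]|[s sP]].
  exists [seq b k | k <- enum 'I_n] => f; have [c ->] := bP f.
  rewrite -big_enum /=; elim: (enum 'I_n) => [|k r IH] /=.
    by rewrite big_nil.
  by rewrite big_cons; exists (c k); eexists; split; last reflexivity.
by exists (size s), (fun k => s`_k) => f; apply/in_spanP.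
Qed.

Lemma fin_dim_hom_image X Y (V : lmodType K) (s : seq V) (F : V -> hom X Y) :
  linear F -> (forall f, exists2 v, in_span s v & f = F v) -> fin_dim_hom X Y.
Proof.
move=> lF H; apply/fin_dim_homP; exists (map F s) => f.
by have [v sv ->] := H f; apply: in_span_map.
Qed.

Lemma fin_dim_hom_sumr n (S : 'I_n -> A) X Y : is_direct_sum S X ->
  (forall k, fin_dim_hom (S k) Y) -> fin_dim_hom X Y.
Proof.
move=> [i [p [_ _ s1]]] fd; apply/fin_dim_homP.
suff [s sP] : exists s, forall f : hom X Y, in_span s (\sum_(k <- enum 'I_n) f ∘ i k ∘ p k).
  by exists s => f; rewrite -[f]mcomp1r -s1 mcomp_sumr -big_enum.
elim: (enum 'I_n) => [|k r [s sP]]; first by exists [::] => f; rewrite big_nil.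
have [s' s'P] := (fin_dim_homP (S k) Y).1 (fd k).
exists ([seq g ∘ p k | g <- s'] ++ s) => f; rewrite big_cons; apply: in_span_cat => //.
rewrite mcompA; apply: (in_span_map (F := fun g => g ∘ p k)) => //.
by move=> a u v; apply: mcompPl.
Qed.

Lemma fin_dim_hom_suml n (S : 'I_n -> A) X Y : is_direct_sum S Y ->
  (forall k, fin_dim_hom X (S k)) -> fin_dim_hom X Y.
Proof.
move=> [i [p [_ _ s1]]] fd; apply/fin_dim_homP.
suff [s sP] : exists s, forall f : hom X Y, in_span s (\sum_(k <- enum 'I_n) i k ∘ p k ∘ f).
  exists s => f; rewrite -[f]mcomp1l -s1 mcomp_suml -big_enum.
  by under eq_bigr do rewrite -mcompA.
elim: (enum 'I_n) => [|k r [s sP]]; first by exists [::] => f; rewrite big_nil.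
have [s' s'P] := (fin_dim_homP X (S k)).1 (fd k).
exists ([seq i k ∘ g | g <- s'] ++ s) => f; rewrite big_cons; apply: in_span_cat => //.
apply: (in_span_map (F := fun g => i k ∘ g)) => //.
by move=> a u v; apply: mcompPr.
Qed.

End FiniteDimension.

Lemma addLin_fin_dim (K : fieldType) (A : linCat K) :
  (forall X Y : A, fin_dim_hom X Y) -> forall X Y : addLin A, fin_dim_hom X Y.
Proof.
move=> fd X Y; apply: (fin_dim_hom_sumr (addLin_direct_sum X)) => k.
apply: (fin_dim_hom_suml (addLin_direct_sum Y)) => l.
move: (X (enum_val k)) (Y (enum_val l)) => x y; have [s sP] := (fin_dim_homP x y).1 (fd x y).
pose F (g : hom x y) : hom (asingle x) (asingle y) :=
  @amat _ _ (asingle x) (asingle y) (fun _ _ => g).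
apply: (fin_dim_hom_image (s := s) (F := F)).
  by move=> a u v; apply: entryP => i j; rewrite entry_lin !entryE.
move=> f; exists (entry f tt tt) => //.
by apply: entryP => -[] []; rewrite entryE.
Qed.

Lemma karLin_fin_dim (K : fieldType) (A : linCat K) :
  (forall X Y : A, fin_dim_hom X Y) -> forall X Y : karLin A, fin_dim_hom X Y.
Proof.
move=> fd X Y; have [s sP] := (fin_dim_homP _ _).1 (fd (kbase X) (kbase Y)).
pose F (g : hom (kbase X) (kbase Y)) : hom X Y := @kmk _ _ X Y g.
apply: (fin_dim_hom_image (s := s) (F := F)).
  move=> a u v; apply: val_inj.
  rewrite [RHS](kval_lin a (F u : khom X Y) (F v)) /=.
  by rewrite mcompPl mcompPr.
by move=> f; exists (kval f); [apply: sP | rewrite /F kvalK].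
Qed.

(** * Descent from the idempotent completion *)

Section SplitIdempotents.
Variables (K : fieldType) (A : linCat K).

Definition kar_of (U : A) : karLin A := KarObj (mcomp1l (idm U)).

Definition kmk_of (U V : A) (f : hom U V) : hom (kar_of U) (kar_of V) :=
  @kmk _ _ (kar_of U) (kar_of V) f.

Lemma kval_kmk_of (U V : A) (f : hom U V) : kval (kmk_of f) = f.
Proof. by rewrite /= mcomp1l mcomp1r. Qed.

Lemma kmk_ofK (U V : A) (f : hom (kar_of U) (kar_of V)) : kmk_of (kval f) = f.
Proof. exact: kvalK. Qed.

Lemma kmk_of_comp (U V W : A) (g : hom V W) (f : hom U V) :
  kmk_of (g ∘ f) = kmk_of g ∘ kmk_of f.
Proof. by apply: val_inj; rewrite [LHS]kval_kmk_of /= !mcomp1l !mcomp1r. Qed.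

Lemma kmk_of0 (U V : A) : kmk_of (0 : hom U V) = 0.
Proof. by apply: val_inj; rewrite [LHS]kval_kmk_of [RHS]karval0. Qed.

Lemma kmk_of_inj (U V : A) : injective (@kmk_of U V).
Proof. by move=> f g e; rewrite -(kval_kmk_of f) e kval_kmk_of. Qed.

Lemma homs_regular_kar_of (X Y : A) :
  homs_regular (kar_of X) (kar_of Y) <-> homs_regular X Y.
Proof.
split=> H f.
  have [g e] := H (kmk_of f); exists (kval g); apply: kmk_of_inj.
  by rewrite !kmk_of_comp kmk_ofK.
have [g e] := H (kval f); exists (kmk_of g).
by rewrite -(kmk_ofK f) -!kmk_of_comp e.
Qed.

Lemma nondegenerate_kar_of (X Y : A) :
  nondegenerate X Y -> nondegenerate (kar_of X) (kar_of Y).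
Proof.
move=> [nd1 nd2]; split=> f f0.
  have [|h hf] := nd1 (kval f); first by move=> e; apply: f0; rewrite -(kmk_ofK f) e kmk_of0.
  by exists (kmk_of h); rewrite -(kmk_ofK f) -kmk_of_comp -kmk_of0 => /kmk_of_inj.
have [|h hf] := nd2 (kval f); first by move=> e; apply: f0; rewrite -(kmk_ofK f) e kmk_of0.
by exists (kmk_of h); rewrite -(kmk_ofK f) -kmk_of_comp -kmk_of0 => /kmk_of_inj.
Qed.

(** The version of [homs_regular_split] for a category whose idempotents need not split. What is
    left of [X] in the completion is the image [W] of an idempotent [v] = i p of [X]; an
    endomorphism [f] of [W] becomes x = i f p, and the absence of morphisms between [W] and [Y] says
    that [v] kills all morphisms from and to [Y]. *)
Lemma homs_regular_split_idem (X Y : A) :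
  (forall U V : A, fin_dim_hom U V) -> homs_regular Y Y -> nondegenerate X Y ->
  (forall v x : hom X X, v ∘ x = x -> x ∘ v = x ->
     (forall F : hom Y X, v ∘ F = 0) -> (forall H : hom X Y, H ∘ v = 0) ->
     regular_hom x) ->
  homs_regular X X.
Proof.
move=> fd YY nd reg.
have [d dX] := karLin_fin_dim fd (kar_of X) (kar_of X).
apply/homs_regular_kar_of.
have [||W [i [p pi]] YW0 WY0 f|//] := homs_regular_split
    (@karLin_pseudo_abelian _ A) dX (Y := kar_of Y).
- exact/homs_regular_kar_of.
- exact: nondegenerate_kar_of.
pose x := i ∘ f ∘ p.
have [||F|H|y e] := reg (kval (i ∘ p)) (kval x).
- apply: kmk_of_inj; rewrite kmk_of_comp !kmk_ofK /x -!mcompA.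
  by rewrite [p ∘ _]mcompA pi mcomp1l.
- apply: kmk_of_inj; rewrite kmk_of_comp !kmk_ofK /x -!mcompA.
  by rewrite [p ∘ i ∘ _]mcompA pi mcomp1l.
- apply: kmk_of_inj; rewrite kmk_of_comp kmk_ofK kmk_of0 -mcompA.
  by rewrite (YW0 (p ∘ _)) mcomp0r.
- apply: kmk_of_inj; rewrite kmk_of_comp kmk_ofK kmk_of0 mcompA.
  by rewrite (WY0 (_ ∘ i)) mcomp0l.
have {}e : x ∘ kmk_of y ∘ x = x by rewrite -(kmk_ofK x) -!kmk_of_comp e.
exists (p ∘ kmk_of y ∘ i).
have fE : f = p ∘ x ∘ i by rewrite /x -!mcompA pi mcomp1r mcompA pi mcomp1l.
rewrite [RHS]fE -e /x -!mcompA pi mcomp1r [p ∘ i ∘ _]mcompA pi mcomp1l //.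
Qed.

End SplitIdempotents.

(** * Traces *)

Lemma trace_lin (K : fieldType) (A : rigidCat K) (X : A) a (f g : hom X X) :
  trace (a *: f + g) = a *: trace f + trace g.
Proof. by rewrite /trace tensmPl !(mcompPl, mcompPr). Qed.

Lemma trace0 (K : fieldType) (A : rigidCat K) (X : A) : trace (0 : hom X X) = 0.
Proof. by rewrite /trace tensm0l mcomp0l !mcomp0r. Qed.

Lemma trace_sum (K : fieldType) (A : rigidCat K) (X : A) (I : Type) (r : seq I)
    (F : I -> hom X X) : trace (\sum_(i <- r) F i) = \sum_(i <- r) trace (F i).
Proof.
apply: big_morph => [u v|]; last exact: trace0.
by rewrite -[u]scale1r trace_lin !scale1r.
Qed.

Lemma traceZ (K : fieldType) (A : rigidCat K) (X : A) a (f : hom X X) :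
  trace (a *: f) = a *: trace f.
Proof. exact: (linZ (fun a f g => trace_lin a f g)). Qed.

Lemma traceB (K : fieldType) (A : rigidCat K) (X : A) (f g : hom X X) :
  trace (f - g) = trace f - trace g.
Proof. by rewrite addrC -scaleN1r trace_lin scaleN1r addrC. Qed.

Section EnvelopeTraces.
Variables (K : fieldType) (A : rigidCat K).

(** The projector of the dual is the transpose of that of [X], so it slides along the evaluation
    onto [f], which absorbs it. *)
Lemma karRigid_trace (X : karRigid A) (f : hom X X) :
  kval (trace f) = trace (kval f).
Proof.
change (kval (trace f)) with (kval (kev X) ∘ kval (ksym X (kdual X))
  ∘ (kval f ⊠ kproj (kdual X)) ∘ kval (kcoev X)).
rewrite (kval_mkr (ksym_equiv X (kdual X))) kval_kcoev kval_kev' /=.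
set e := kproj X; set t := transp e.
have tt : t ∘ t = t := kdual_proof X.
have fe : (e ⊠ t) ∘ (kval f ⊠ t) ∘ (e ⊠ t) = kval f ⊠ t.
  by rewrite -!tensm_comp !tt khomP.
rewrite -!mcompA [(e ⊠ t) ∘ _ ∘ _ ∘ _]mcompA [((e ⊠ t) ∘ _) ∘ _]mcompA.
rewrite -[((e ⊠ t) ∘ _) ∘ _]mcompA fe.
rewrite [sym _ _ ∘ _]mcompA sym_nat -!mcompA [(t ⊠ idm _) ∘ _]mcompA -tensm_comp.
rewrite tt mcomp1l tensm_lr -!mcompA [ev _ ∘ _]mcompA transpE -!mcompA.
rewrite [(idm _ ⊠ e) ∘ _]mcompA -tensm_compr khomPl [(idm _ ⊠ _) ∘ _]mcompA.
by rewrite -sym_nat /trace -!mcompA.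
Qed.

(** Evaluation and coevaluation vanish on pairs of distinct indices, so only diagonal entries
    contribute. *)
Lemma addRigid_trace (X : addRigid A) (f : hom X X) :
  entry (trace f) tt tt = \sum_(i : aidx X) trace (entry f i i).
Proof.
change (trace f) with (amcomp (aev X) (amcomp (asym X (adual X))
  (amcomp (atensm f (aidm (adual X))) (acoev X)))).
rewrite amcompA entry_comp.
transitivity (\sum_(i : aidx X) \sum_(j : aidx X)
  (entry (aev X) (j, i) tt ∘ sym (X i) (dual (X j))) ∘
  \sum_q entry (atensm f (aidm (adual X))) q (i, j) ∘ entry (acoev X) tt q).
  by rewrite pair_bigA; apply: eq_bigr => -[i j] _; rewrite entry_compr entry_comp.
apply: eq_bigr => i _; rewrite (bigD1 i) //= [X in _ + X]big1 ?addr0 => [|j ji]; last first.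
  by rewrite aev_off // !mcomp0l.
rewrite aev_diag (bigD1 (i, i)) //= [X in _ + X]big1 ?addr0 => [|[k l] kl]; last first.
  have [e|n] := eqVneq k l; last by rewrite acoev_off ?mcomp0r.
  rewrite entry_tens /= (@aidm_off _ _ (adual X)) ?tensm0r ?mcomp0l //.
  by apply: contra kl => /eqP <-; rewrite e.
by rewrite entry_tens acoev_diag /= (@aidm_diag _ _ (adual X)) /trace -!mcompA.
Qed.

End EnvelopeTraces.

Section PartitionTraces.
Variables (K : fieldType) (t : K).
Notation colour n := {ffun 'I_n -> bool}.

Lemma sum_colour_split n m (F : colour n -> colour m -> nat) :
  (\sum_(b : colour (n + m)) F (resl b) (resr b) = \sum_x \sum_y F x y)%N.
Proof.
rewrite pair_bigA /=.
pose h (p : colour n * colour m) : colour (n + m) :=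
  [ffun i => match split i with inl j => p.1 j | inr j => p.2 j end].
have hl p : resl (h p) = p.1 by apply/ffunP => i; rewrite !ffunE (unsplitK (inl i)).
have hr p : resr (h p) = p.2 by apply/ffunP => i; rewrite !ffunE (unsplitK (inr i)).
rewrite (reindex h) => [|]; first by apply: eq_bigr => p _; rewrite hl hr.
exists (fun b => (resl b, resr b)) => [p _|b _]; first by rewrite hl hr -surjective_pairing.
by apply/ffunP => i; rewrite !ffunE; case: split_ordP => j ->; rewrite ffunE.
Qed.

Lemma sum_eq_op (T : finType) (F : T -> nat) (x : T) :
  (\sum_y F y * (y == x) = F x)%N.
Proof.
rewrite (bigD1 x) //= eqxx muln1 big1 ?addn0 // => y /negbTE ->.
by rewrite muln0.
Qed.

(** On two-colourings the evaluation, the coevaluation and the swap are the usual ones of matrix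
    algebra, and the categorical trace becomes the ordinary trace of [M]. *)
Lemma mrep_trace n (f : phom K n n) M :
  mrep t f M -> mrep t (trace (A := partRigid t) f) (fun _ _ => \sum_a M a a)%N.
Proof.
move=> fM; have := mrep_comp (mrep_comp (mrep_comp (mrep_coev t n)
  (mrep_tens fM (mrep_map t id))) (mrep_map t (@swap_ord n n))) (mrep_ev t n).
move=> [k [P [e h]]]; exists k, P; split; first exact: e.
move=> a c; rewrite -h.
under [RHS]eq_bigr => b _ do rewrite sum_mapr.
have El (b : colour (n + n)) : resl (pullc (@swap_ord n n) b) = resr b.
  by apply/ffunP => i; rewrite !ffunE swap_ordl.
have Er (b : colour (n + n)) : resr (pullc (@swap_ord n n) b) = resl b.
  by apply/ffunP => i; rewrite !ffunE swap_ordr.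
under [RHS]eq_bigr => b _ do rewrite El Er.
rewrite (sum_colour_split (fun x y =>
  (\sum_b (resl b == resr b) * (M (resl b) y * (resr b == pullc id x))) * (x == y)))%N.
rewrite exchange_big; apply: eq_bigr => y _; rewrite sum_eq_op.
rewrite (sum_colour_split (fun u v => (u == v) * (M u y * (v == pullc id y))))%N.
rewrite exchange_big /= pullc_id (bigD1 y) //= [X in (_ + X)%N]big1 ?addn0 => [|v vy]; last first.
  by rewrite big1 // => u _; rewrite (negbTE vy) !muln0.
rewrite eqxx -[LHS](sum_eq_op (fun u => M u y)).
by apply: eq_bigr => u _; rewrite muln1 mulnC.
Qed.

End PartitionTraces.

(** * The Gram matrix of partitions *)

Section PartitionCounting.
Variables (T : finType).
Implicit Types (P Q R : spart T).

Definition refines P Q : bool := [forall x, forall y, prel P x y ==> prel Q x y].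

Lemma refinesP P Q : reflect (forall x y, prel P x y -> prel Q x y) (refines P Q).
Proof.
apply: (iffP forallP) => [h x y|h x]; first by have /forallP/(_ y)/implyP := h x.
by apply/forallP => y; apply/implyP/h.
Qed.

Lemma refines_refl P : refines P P.
Proof. by apply/refinesP. Qed.

(** The number of related pairs is the rank used in the triangular inductions over the lattice of
    partitions. *)
Lemma refines_card P Q : refines P Q -> P != Q ->
  (#|[set x | prel P x.1 x.2]| < #|[set x | prel Q x.1 x.2]|)%N.
Proof.
move=> /refinesP PQ nPQ; apply: proper_card; rewrite properE; apply/andP; split.
  by apply/subsetP => -[x y]; rewrite !inE; apply: PQ.
apply: contra nPQ => /subsetP QP; apply/eqP/prel_inj => x y; apply/idP/idP; first exact: PQ.
by have := QP (x, y); rewrite !inE.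
Qed.

Definition join_rel P Q : rel T := fun x y => prel P x y || prel Q x y.

Lemma join_equiv P Q : equivalence_rel (connect (join_rel P Q)).
Proof.
have js : connect_sym (join_rel P Q).
  by apply: sym_connect_sym => x y; rewrite /join_rel ![prel _ y x]prel_sym.
by apply/equivalence_relP; split=> [x|x y /(same_connect js)] //; apply: connect0.
Qed.

Definition spart_join P Q : spart T := spart_of (join_equiv P Q).

Lemma refines_join P Q R : refines (spart_join P Q) R = refines P R && refines Q R.
Proof.
apply/refinesP/andP => [h|[/refinesP PR /refinesP QR] x y].
  by split; apply/refinesP => x y r; apply: h; rewrite prel_spart_of connect1 //;
    rewrite /join_rel r ?orbT.
rewrite prel_spart_of => /connectP[p]; elim: p x => [|z p IH] x /=.
  by move=> _ ->; apply: prel_refl.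
move=> /andP[xz pz] yE; have [_ ->] := prel_equiv R x z y; first exact: IH pz yE.
by case/orP: xz; [apply: PR|apply: QR].
Qed.

Section Blocks.
Variable P : spart T.

Definition block_type := {B : {set T} | B \in val P}.

Lemma pblock_in x : pblock (val P) x \in val P.
Proof. by apply: pblock_mem; rewrite (cover_partition (valP P)) inE. Qed.

Definition block_of x : block_type := exist _ (pblock (val P) x) (pblock_in x).

Lemma block_of_eq x y : (block_of x == block_of y) = prel P x y.
Proof.
rewrite -val_eqE /= eq_pblock ?(partition_trivIset (valP P)) //.
by rewrite (cover_partition (valP P)) inE.
Qed.

Lemma block_of_rep : exists r : block_type -> T, cancel r block_of.
Proof.
have H (B : block_type) : exists x, block_of x == B.
  have /set0Pn[x xB] := partition_neq0 (valP P) (valP B).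
  by exists x; rewrite -val_eqE /= (def_pblock (partition_trivIset (valP P)) (valP B) xB).
by exists (fun B => xchoose (H B)) => B; apply/eqP/(xchooseP (H B)).
Qed.

Variable U : finType.

(** Maps constant on the blocks of [P] are functions on the set of blocks. *)
Lemma card_refines_kerpart :
  #|[set c : {ffun T -> U} | refines P (kerpart c)]| = (#|U| ^ #|val P|)%N.
Proof.
have [r rK] := block_of_rep.
pose G (g : {ffun block_type -> U}) : {ffun T -> U} := [ffun x => g (block_of x)].
have Ginj : injective G.
  by move=> g h /ffunP e; apply/ffunP => B; have := e (r B); rewrite !ffunE rK.
rewrite -(card_sig (mem (val P))) -card_ffun -(card_imset predT Ginj).
apply: eq_card => c; rewrite inE; apply/refinesP/imsetP => [h|[g _ ->] x y].
  exists [ffun B => c (r B)] => //; apply/ffunP => x; rewrite !ffunE.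
  by apply/eqP; rewrite -prel_kerpart; apply: h; rewrite -block_of_eq rK.
by rewrite prel_kerpart !ffunE -block_of_eq => /eqP->.
Qed.

(** Among the functions on the blocks of [P], the injective ones are those that merge no blocks. *)
Lemma card_kerpart_eq :
  #|[set c : {ffun T -> U} | kerpart c == P]| = (#|U| ^_ #|val P|)%N.
Proof.
have [r rK] := block_of_rep.
pose G (g : {ffun block_type -> U}) : {ffun T -> U} := [ffun x => g (block_of x)].
have Ginj : injective G.
  by move=> g h /ffunP e; apply/ffunP => B; have := e (r B); rewrite !ffunE rK.
rewrite -(card_sig (mem (val P))) -card_inj_ffuns -(card_imset _ Ginj).
apply: eq_card => c; rewrite inE; apply/eqP/imsetP => [h|[g]].
  have hc x y : (c x == c y) = (block_of x == block_of y).
    by rewrite block_of_eq -h prel_kerpart.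
  exists [ffun B => c (r B)].
    rewrite inE; apply/injectiveP => B C; rewrite !ffunE => /eqP.
    by rewrite hc !rK => /eqP.
  by apply/ffunP => x; rewrite !ffunE; apply/eqP; rewrite hc rK.
rewrite inE => /injectiveP gi ->; apply: prel_inj => x y.
by rewrite prel_kerpart !ffunE (inj_eq gi) block_of_eq.
Qed.

End Blocks.

(** The maps to a set with [N] elements that are constant on the blocks of [P] are sorted by their
    kernel partition [R], which is coarser than [P]. *)
Lemma expn_sum_ffact P (N : nat) :
  (N ^ #|val P| = \sum_(R : spart T | refines P R) N ^_ #|val R|)%N.
Proof.
rewrite -[N in LHS]card_ord -card_refines_kerpart -sum1_card.
rewrite (partition_big (fun c : {ffun T -> 'I_N} => kerpart c) (refines P)) /=.
  apply: eq_bigr => R PR; rewrite -[N in RHS]card_ord -card_kerpart_eq -sum1_card.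
  apply: eq_bigl => c; rewrite !inE.
  by case: eqP => [->|_]; rewrite ?PR ?andbF.
by move=> c; rewrite inE.
Qed.

Variables (K : fieldType) (t : K).
Hypothesis charK : [pchar K] =i pred0.

Lemma polyP_nat (p q : {poly K}) :
  (forall N : nat, p.[N%:R] = q.[N%:R]) -> p = q.
Proof.
move=> pq; apply/eqP; rewrite -subr_eq0; apply/negPn/negP => d0.
have natI : injective (fun n : nat => n%:R : K).
  have H m n : (m <= n)%N -> m%:R = n%:R :> K -> m = n.
    move=> mn /eqP; rewrite eq_sym -subr_eq0 -natrB // (pcharf0P _).1 // subn_eq0.
    by move=> nm; apply/eqP; rewrite eqn_leq mn.
  move=> m n e; have /orP[mn|nm] := leq_total m n; first exact: H.
  exact/esym/H.
have := max_poly_roots d0 (rs := [seq i%:R | i <- iota 0 (size (p - q))]).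
rewrite size_map size_iota ltnn (map_inj_uniq natI) iota_uniq => H.
have /H/(_ isT) // : all (root (p - q)) [seq i%:R | i <- iota 0 (size (p - q))].
by apply/allP => _ /mapP[i _ ->]; rewrite rootE hornerD hornerN pq subrr.
Qed.

Lemma horner_prod_sub_nat (x : K) b :
  (\prod_(i < b) ('X - (i%:R)%:P)).[x] = \prod_(i < b) (x - i%:R) :> K.
Proof.
by rewrite horner_prod; apply: eq_bigr => i _; rewrite hornerXsubC.
Qed.

Lemma prod_sub_nat (N b : nat) : \prod_(i < b) (N%:R - i%:R) = (N ^_ b)%:R :> K.
Proof.
elim: b => [|b IH]; first by rewrite big_ord0 ffactn0.
rewrite big_ord_recr /= IH ffactnSr natrM; have [bN|Nb] := leqP b N; first by rewrite natrB.
by rewrite ffact_small // !mul0r.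
Qed.

(** Both sides are polynomials in [t] that agree at all natural numbers by the preceding count,
    hence everywhere in characteristic zero. *)
Lemma expr_sum_ffact P :
  t ^+ #|val P| = \sum_(R : spart T | refines P R) \prod_(i < #|val R|) (t - i%:R).
Proof.
have : 'X^#|val P| = \sum_(R : spart T | refines P R)
    \prod_(i < #|val R|) ('X - (i%:R)%:P) :> {poly K}.
  apply: polyP_nat => N; rewrite hornerXn horner_sum -natrX expn_sum_ffact natr_sum.
  by apply: eq_bigr => R _; rewrite horner_prod_sub_nat prod_sub_nat.
move/(congr1 (horner^~ t)); rewrite hornerXn horner_sum => ->.
by apply: eq_bigr => R _; rewrite horner_prod_sub_nat.
Qed.

(** A unitriangular system: besides [x], only indices of smaller rank [m] enter the equation of
    [x]. *)
Lemma triangular_sum_eq0 (I : finType) (r : rel I) (m : I -> nat) (F : I -> K) :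
  reflexive r -> (forall x y, r x y -> x != y -> (m y < m x)%N) ->
  (forall x, \sum_(y | r x y) F y = 0) -> forall x, F x = 0.
Proof.
move=> rr rm F0 x; have [n] := ubnP (m x); elim: n x => // n IH x xn.
have := F0 x; rewrite (bigD1 x) //= big1 ?addr0 // => y /andP[xy yx].
apply: IH; rewrite -ltnS; apply: leq_trans xn; rewrite ltnS; apply: rm => //.
by rewrite eq_sym.
Qed.

Hypothesis tN : forall n : nat, t != n%:R.

(* In the basis obtained by Moebius inversion, the form is diagonal with the
   falling factorials of [t] on the diagonal. *)
Lemma gram_nondegenerate (f : spart T -> K) :
  (forall Q, \sum_P f P * t ^+ #|val (spart_join P Q)| = 0) -> forall P, f P = 0.
Proof.
pose c (R : spart T) := \prod_(i < #|val R|) (t - i%:R).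
have c0 R : c R != 0 by apply/prodf_neq0 => i _; rewrite subr_eq0.
pose m (R : spart T) := #|[set x | prel R x.1 x.2]|.
have mT (R : spart T) : (m R <= #|{: T * T}|)%N by apply: max_card.
(* By inversion over finer partitions, it is enough that for each [R] the sum of f P over the [P]
   finer than [R] vanishes. *)
move=> H; apply: (@triangular_sum_eq0 _ (fun P Q => refines Q P) m) => [P|P Q QP PQ|R].
- exact: refines_refl.
- by apply: refines_card; rewrite // eq_sym.
(* The falling factorial c R is nonzero because [t] is not a natural number. After multiplication by
   it a second inversion applies, now over coarser partitions, which is why the rank is
   complemented. *)
apply/eqP; rewrite -(mulrI_eq0 _ (mulfI (c0 R))); apply/eqP; move: R.
apply: (@triangular_sum_eq0 _ refines (fun R => #|{: T * T}| - m R)%N) => [P|P Q PQ nPQ|Q].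
- exact: refines_refl.
- have := refines_card PQ nPQ; rewrite -!/(m _) => mPQ.
  by apply: ltn_sub2l => //; apply: leq_trans mPQ (mT _).
rewrite -[RHS](H Q).
(* A partition [R] is coarser than the join of [P] and [Q] exactly when it is coarser than both, so
   the sum over [P] separates from the condition on [Q]. *)
under [RHS]eq_bigr => P _ do rewrite expr_sum_ffact big_distrr /=.
rewrite (exchange_big_dep (fun R => refines Q R)) /=; last first.
  by move=> P R _; rewrite refines_join => /andP[].
apply: eq_bigr => R QR; rewrite big_distrr /=; apply: eq_big => [P|P PR].
  by rewrite refines_join QR andbT.
by rewrite mulrC.
Qed.

End PartitionCounting.

(** * Regularity of the category of partitions *)

Lemma linear_pseudo_inverse (K : fieldType) (V : vectType K) (T : V -> V) :
  linear T -> exists S : V -> V, linear S /\ forall v, T (S (T v)) = T v.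
Proof.
move=> lT; pose Tm := GRing.isLinear.Build K V V *:%R T lT.
pose T' : {linear V -> V} := HB.pack T Tm.
exists (linfun T')^-1%VF; split=> [a u v|v]; first exact: linearP.
have TE u : T u = linfun T' u by rewrite lfunE.
by rewrite !TE limg_lfunVK // memv_img // memvf.
Qed.

(* Averaging a pseudo-inverse [S] of right multiplication by [x] over the group,
   as in Maschke's theorem. *)
Lemma maschke_regular (K : fieldType) (A : linCat K) (X : A) (gT : finGroupType)
    (I : finType) (G : gT -> hom X X) (S : hom X X -> hom X X)
    (c : I -> K) (s : I -> gT) (v x : hom X X) :
  linear S -> (forall a, S (a ∘ x) ∘ x = a ∘ x) -> #|gT|%:R != 0 :> K ->
  (forall r s, G (s * r)%g = G r ∘ G s) -> G 1%g = idm X -> v ∘ x = x ->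
  x = \sum_i c i *: (G (s i) ∘ v) -> x = \sum_i c i *: (v ∘ G (s i)) ->
  regular_hom x.
Proof.
move=> lS TST N0 GM G1 vx xGv xvG.
(* Averaging makes the map commute with left multiplication by every [G r]. It is still a
   pseudo-inverse of right multiplication by [x], which commutes with left multiplications from the
   start. *)
pose S' a := #|gT|%:R^-1 *: \sum_s G s ∘ S (G (s^-1)%g ∘ a).
have S'G r a : S' (G r ∘ a) = G r ∘ S' a.
  rewrite /S' mcompZr mcomp_sumr; congr (_ *: _); rewrite (reindex_inj (mulIg r)).
  apply: eq_bigr => u _; rewrite GM -mcompA [G _ ∘ G r ∘ a]mcompA -GM.
  by rewrite invMg mulgA mulgV mul1g.
have S'D u w : S' (u + w) = S' u + S' w.
  rewrite /S' -scalerDr -big_split; congr (_ *: _); apply: eq_bigr => r _.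
  rewrite mcompDr; have := lS 1 (G (r^-1)%g ∘ u) (G (r^-1)%g ∘ w).
  by rewrite !scale1r => ->; rewrite mcompDr.
have S'Z a u : S' (a *: u) = a *: S' u.
  rewrite /S' scalerA [a * _]mulrC -scalerA; congr (_ *: _).
  rewrite scaler_sumr; apply: eq_bigr => r _.
  by rewrite mcompZr (linZ lS) mcompZr.
have S'0 : S' 0 = 0 by rewrite -[0](scale0r 0) S'Z !scale0r.
have TS'T a : S' (a ∘ x) ∘ x = a ∘ x.
  rewrite /S' mcompZl mcomp_suml (eq_bigr (fun=> a ∘ x)) => [|r _].
    by rewrite sumr_const -scaler_nat scalerA mulVf // scale1r.
  by rewrite -mcompA [G _ ∘ a ∘ x]mcompA TST !mcompA -GM mulVg G1 mcomp1l.
have S'x : S' x = \sum_i c i *: (G (s i) ∘ S' v).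
  rewrite {1}xGv (big_morph S' S'D S'0); apply: eq_bigr => i _.
  by rewrite S'Z S'G.
(* The two expansions of [x] give x S'(v) x = v S'(x) x, and S'(x) x = x because v x = x. *)
exists (S' v); have e : S' x ∘ x = x by have := TS'T v; rewrite vx.
transitivity ((\sum_i c i *: (v ∘ G (s i))) ∘ S' v ∘ x); first by rewrite -xvG.
transitivity (v ∘ S' x ∘ x); last by rewrite e.
rewrite S'x !mcomp_suml mcomp_sumr; apply: eq_bigr => i _.
by rewrite !(mcompZl, mcompZr) -!mcompA.
Qed.

Section PartitionCategoryRegular.
Variables (K : fieldType) (t : K).
Notation colour n := {ffun 'I_n -> bool}.
Notation C := (partRigid t).

Definition swap_sum (S T : Type) (x : S + T) : T + S :=
  match x with inl i => inr i | inr j => inl j end.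

Lemma pswap_equiv (S T : finType) (P : spart (S + T)%type) :
  equivalence_rel (fun x y : T + S => prel P (swap_sum x) (swap_sum y)).
Proof. by move=> x y z; apply: prel_equiv. Qed.

Definition pswap (S T : finType) (P : spart (S + T)%type) : spart (T + S)%type :=
  spart_of (pswap_equiv P).

Lemma pmx_pswap (S T : finType) (P : spart (S + T)%type) a b :
  pmx (pswap P) b a = pmx P a b.
Proof.
apply/pcolP/pcolP => h x y.
  by move=> r; have := h (swap_sum x) (swap_sum y); rewrite prel_spart_of;
    case: x y r => [x|x] [y|y] r /(_ r).
by rewrite prel_spart_of => /h; case: x y => [x|x] [y|y].
Qed.

Lemma mrep_scale n m k (P : spart ('I_n + 'I_m)%type) :
  mrep t (t ^+ k *: pbas P) (fun a b => 2 ^ k * pmx P a b)%N.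
Proof. by exists k, P. Qed.

(** The empty set has only one partition, so a trace is determined by its power of [t], and the
    exponent is read off from the value at two colours. *)
Lemma trace_mrep n (f : phom K n n) M k : mrep t f M ->
  (\sum_a M a a = 2 ^ k)%N -> trace (A := C) f = t ^+ k *: pidm K 0.
Proof.
move=> /mrep_trace fM Mk; apply: (mrep_inj fM (mrep_scale _ _)) => a b.
by rewrite Mk (_ : pmx _ _ _ = true) ?muln1 //; apply/pcolP => -[[]|[]].
Qed.

Lemma refines_kerpart_pcol (T : finType) (P : spart T) (c : {ffun T -> bool}) :
  refines P (kerpart c) = pcol P c.
Proof.
by apply/refinesP/pcolP => h x y /h; rewrite prel_kerpart => /eqP.
Qed.

(** Both sides count the two-colourings constant on the blocks of [P] and on those of [Q], hence on
    those of their join. *)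
Lemma sum_pmx_join n m (P Q : spart ('I_n + 'I_m)%type) :
  (\sum_(a : colour n) \sum_(b : colour m) pmx P a b * pmx Q a b
     = 2 ^ #|val (spart_join P Q)|)%N.
Proof.
rewrite -card_bool -card_refines_kerpart -sum1_card [RHS]big_mkcond /=.
rewrite pair_bigA /=.
pose h (c : {ffun 'I_n + 'I_m -> bool}) : colour n * colour m :=
  ([ffun i => c (inl i)], [ffun j => c (inr j)]).
rewrite (reindex h) /=; last first.
  exists (fun p : colour n * colour m => [ffun x => scol p.1 p.2 x]) => [c _|[a b] _] /=.
    by apply/ffunP => -[i|j]; rewrite !ffunE /= ffunE.
  by congr pair; apply/ffunP => i; rewrite !ffunE.
apply: eq_bigr => c _; rewrite inE refines_join !refines_kerpart_pcol mulnb.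
have E R : pmx R [ffun i => c (inl i)] [ffun j => c (inr j)] = pcol R c.
  by apply: eq_pcol => -[i|j] /=; rewrite ffunE.
by rewrite !E; case: (_ && _).
Qed.

(** Pairing partitions with flipped partitions by the trace yields the Gram matrix treated in
    [gram_nondegenerate]. *)
Lemma trace_pbas_swapl n m (P Q : spart ('I_n + 'I_m)%type) :
  trace (A := C) (pmcomp t (pbas (pswap Q)) (pbas P)) =
    t ^+ #|val (spart_join P Q)| *: pidm K 0.
Proof.
apply: (trace_mrep (mrep_comp (mrep_bas _ _) (mrep_bas _ _))).
rewrite -sum_pmx_join; apply: eq_bigr => a _; apply: eq_bigr => b _.
by rewrite pmx_pswap.
Qed.

Lemma trace_pbas_swapr n m (P Q : spart ('I_n + 'I_m)%type) :
  trace (A := C) (pmcomp t (pbas P) (pbas (pswap Q))) =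
    t ^+ #|val (spart_join P Q)| *: pidm K 0.
Proof.
apply: (trace_mrep (mrep_comp (mrep_bas _ _) (mrep_bas _ _))).
rewrite -sum_pmx_join exchange_big; apply: eq_bigr => a _; apply: eq_bigr => b _.
by rewrite pmx_pswap mulnC.
Qed.

Lemma pidm0_neq0 : pidm K 0 <> 0.
Proof.
by move/ffunP/(_ (pgraph id)); rewrite !ffunE eqxx => /eqP; rewrite oner_eq0.
Qed.

Hypothesis charK : [pchar K] =i pred0.
Hypothesis tN : forall n : nat, t != n%:R.

Lemma linear_functional_neq0 n m (L : spart ('I_n + 'I_m)%type -> phom K n m -> phom K 0 0)
    (f : phom K n m) :
  (forall Q, linear (L Q)) ->
  (forall P Q, L Q (pbas P) =
     t ^+ #|val (spart_join P Q)| *: pidm K 0) ->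
  f <> 0 -> exists Q, L Q f <> 0.
Proof.
move=> lL LE f0; apply/existsNP => H; apply: f0; apply/ffunP => P0; rewrite [RHS]ffunE.
move: P0; apply: (gram_nondegenerate charK tN) => Q.
have [//|] := eqVneq (\sum_P f P * t ^+ #|val (spart_join P Q)|) 0.
move=> /eqP n0; case: pidm0_neq0; have := H Q.
have L0 : L Q 0 = 0 by rewrite -[0](scale0r 0) (linZ (lL Q)) scale0r.
have LD u v : L Q (u + v) = L Q u + L Q v by have := lL Q 1 u v; rewrite !scale1r.
rewrite {1}(pbas_dec f) (big_morph _ LD L0).
under eq_bigr => P _ do rewrite (linZ (lL Q)) LE scalerA.
rewrite -scaler_suml => /eqP; rewrite scaler_eq0 => /orP[/eqP//|/eqP//].
Qed.

(** A composite with nonzero trace is nonzero, so it suffices that the trace pairing is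
    nondegenerate. *)
Lemma part_nondegenerate (n m : C) : nondegenerate n m.
Proof.
split=> f f0.
  have [||Q] := linear_functional_neq0
    (L := fun Q f => trace (A := C) (pmcomp t (pbas (pswap Q)) f)) _ _ f0.
  - by move=> Q a u v; rewrite pmcompPr trace_lin.
  - by move=> P Q; apply: trace_pbas_swapl.
  move=> Hn; exists (pbas (pswap Q)) => e; apply: Hn.
  by have := congr1 (@trace _ C m) e; rewrite trace0.
have [||Q] := linear_functional_neq0
  (L := fun Q f => trace (A := C) (pmcomp t f (pbas (pswap Q)))) _ _ f0.
- by move=> Q a u v; rewrite pmcompPl trace_lin.
- by move=> P Q; apply: trace_pbas_swapr.
move=> Hn; exists (pbas (pswap Q)) => e; apply: Hn.
by have := congr1 (@trace _ C m) e; rewrite trace0.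
Qed.

Definition ptmap n m (phi : 'I_n -> 'I_m) : phom K m n := pbas (pswap (pgraph phi)).

Lemma mrep_ptmap n m (phi : 'I_n -> 'I_m) :
  mrep t (ptmap phi) (fun b a => a == pullc phi b).
Proof.
have [k [P [e h]]] := mrep_map t phi.
exists k, (pswap P); split=> [|b a]; last by rewrite pmx_pswap -h.
(* [mrep] hides the exponent and the partition behind an existential; the injectivity of the matrix
   representation recovers both. *)
suff [-> <-] : k = 0%N /\ pgraph phi = P by rewrite expr0 scale1r.
have [k0 [P0 [e0 h0]]] := mrep_bas t (pgraph phi).
apply/and_comm; have [|k0k PP] := @pmx_inj _ _ (pgraph phi) P 0 k.
  move=> x y; rewrite expn0 mul1n -h; congr nat_of_bool.
  apply/pcolP/eqP => [h'|-> u v]; last first.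
    by rewrite prel_kerpart => /eqP; case: u v => u [] v /=; rewrite ?ffunE => ->.
  apply/ffunP => i; rewrite ffunE; apply: (h' (inl i) (inr (phi i))).
  by rewrite prel_kerpart.
by split.
Qed.

(** An output in the block of another one can be discarded and then copied back from it. *)
Lemma pbas_merge n m (P : spart ('I_n + 'I_m.+1)%type) j j' :
  j != j' -> prel P (inr j) (inr j') ->
  exists (F : phom K m m.+1) (H : phom K n m), pbas P = pmcomp t F H.
Proof.
move=> jj' r; have [k jk _] := unlift_some jj'.
(* [unlift] fails only at [j], where the default [k] is the place of [j'] once [j] is removed. *)
pose phi x := odflt k (unlift j x).
exists (ptmap phi), (pmcomp t (ptmap (lift j)) (pbas P)).
apply: (mrep_inj (mrep_bas t P)
  (mrep_comp (mrep_comp (mrep_bas _ _) (mrep_ptmap _)) (mrep_ptmap _))) => a c.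
under eq_bigr => b _ do rewrite big_distrl /=.
rewrite exchange_big /=; rewrite -[LHS](sum_eq_op (fun y : colour m.+1 => nat_of_bool (pmx P a y))).
apply: eq_bigr => b _; under [RHS]eq_bigr => d _ do rewrite -mulnA [(_ * (c == _))%N]mulnC mulnA.
rewrite (sum_eq_op (fun d : colour m => pmx P a b * (c == pullc phi d))%N).
case: (boolP (pmx P a b)) => [/pcolP/(_ _ _ r) /= e|_]; last by rewrite !mul0n.
rewrite !mul1n eq_sym; congr (nat_of_bool (_ == _)); apply/ffunP => x.
rewrite !ffunE /phi; case: unliftP => [y ->|->] //=; by rewrite -jk e.
Qed.

Definition ext_colour n (j : 'I_n.+1) (v : bool) (d : colour n) : colour n.+1 :=
  [ffun x => if unlift j x is Some y then d y else v].

Lemma pullc_ext_colour n (j : 'I_n.+1) v d : pullc (lift j) (ext_colour j v d) = d.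
Proof. by apply/ffunP => y; rewrite !ffunE liftK. Qed.

Lemma sum_ext_colour n (j : 'I_n.+1) (F : colour n.+1 -> nat) :
  (\sum_b F b = \sum_v \sum_d F (ext_colour j v d))%N.
Proof.
rewrite pair_bigA (reindex (fun p => ext_colour j p.1 p.2)) //.
exists (fun b : colour n.+1 => (b j, pullc (lift j) b)) => [[v d] _|b _] /=.
  by rewrite pullc_ext_colour ffunE unlift_none.
by apply/ffunP => x; rewrite ffunE; case: unliftP => [y|] ->; rewrite ?ffunE.
Qed.

(** Discarding the singleton output and creating it anew closes one loop, so it multiplies the
    diagram by [t], which can be divided out. *)
Lemma pbas_isolated n m (P : spart ('I_n + 'I_m.+1)%type) j :
  (forall x, prel P (inr j) x -> x = inr j) ->
  exists H : phom K n m, pbas P = pmcomp t (pmap K (lift j)) H.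
Proof.
move=> iso; pose H := pmcomp t (ptmap (lift j)) (pbas P).
suff E : pmcomp t (pmap K (lift j)) H = t *: pbas P.
  have t0 : t != 0 by have := tN 0.
  by exists (t^-1 *: H); rewrite pmcompZr E scalerA mulVf // scale1r.
rewrite -[t in RHS]expr1; apply: (mrep_inj (mrep_comp (mrep_comp (mrep_bas _ _)
  (mrep_ptmap _)) (mrep_map _ _)) (mrep_scale _ _)) => a c.
rewrite sum_mapr expn1 (sum_ext_colour j) /=.
have indep b b' : pullc (lift j) b = pullc (lift j) b' -> pmx P a b -> pmx P a b'.
  move=> /ffunP e /pcolP h; apply/pcolP => x y r; have := h x y r.
  have [xj|nxj] := eqVneq x (inr j); first by have := iso y; rewrite -xj => /(_ r) ->.
  have [yj|nyj] := eqVneq y (inr j).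
    by move: r; rewrite prel_sym yj => /iso xj; rewrite xj eqxx in nxj.
  have E z : z != inr j -> scol a b z = scol a b' z.
    case: z => //= z nz; have := e; case: (unliftP j z) nz => [u ->|->] nz eu.
      by have := eu u; rewrite !ffunE.
    by rewrite eqxx in nz.
  by rewrite !E.
have indepE v d : pmx P a (ext_colour j v (pullc (lift j) d)) = pmx P a d.
  by apply/idP/idP; apply: indep; rewrite pullc_ext_colour.
have sE v : (\sum_(d : colour m) pmx P a (ext_colour j v d) *
    (pullc (lift j) c == pullc (lift j) (ext_colour j v d)) = pmx P a c)%N.
  rewrite -(indepE v c) -[RHS](sum_eq_op (fun d => nat_of_bool (pmx P a (ext_colour j v d)))).
  by apply: eq_bigr => d _; rewrite pullc_ext_colour eq_sym.
by under eq_bigr => v _ do rewrite sE; rewrite big_bool /= addnn mul2n.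
Qed.

(** If no two outputs are joined and none is isolated, each output is joined to an input. No input
    serves two outputs, and the two sides have equally many points, so the diagram is a
    permutation. *)
Lemma pbas_factor n (P : spart ('I_n.+1 + 'I_n.+1)%type) :
  (exists s : {perm 'I_n.+1}, pbas P = pmap K s) \/
  exists (F : phom K n n.+1) (H : phom K n.+1 n), pbas P = pmcomp t F H.
Proof.
have [[j [j' [jj' r]]]|nmerge] := EM (exists j j', j != j' /\ prel P (inr j) (inr j')).
  by right; apply: pbas_merge jj' r.
have [[j iso]|niso] := EM (exists j, forall x, prel P (inr j) x -> x = inr j).
  by right; exists (pmap K (lift j)); apply: pbas_isolated iso.
left.
have inr_inj j j' : prel P (inr j) (inr j') -> j = j'.
  by move=> r; apply/eqP/negPn/negP => jj'; apply: nmerge; exists j, j'.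
have /fin_all_exists[g gP] j : exists i, prel P (inr j) (inl i).
  apply: contra_notP niso => H; exists j => -[i|j'] r; last by rewrite (inr_inj _ _ r).
  by case: H; exists i.
have ptrans y x z : prel P x y -> prel P y z -> prel P x z.
  by move=> xy yz; have [_ ->] := prel_equiv P x y z.
have ginj : injective g.
  move=> j j' e; apply: inr_inj; apply: (ptrans _ _ _ (gP j)).
  by rewrite e prel_sym.
(* [g] leads from outputs to inputs, a permutation diagram from inputs to outputs, hence the
   inverse. *)
pose s := perm ginj; exists (s^-1)%g; congr pbas; apply: prel_inj => x y.
pose q (x : 'I_n.+1 + 'I_n.+1) : 'I_n.+1 := match x with inl i => (s^-1)%g i | inr j => j end.
have qP z : prel P (inr (q z)) z.
  case: z => [i|j] /=; last exact: prel_refl.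
  by have := gP ((s^-1)%g i); rewrite -[g _](permE ginj) permKV.
rewrite prel_kerpart -/(q x) -/(q y); apply/idP/eqP => [r|e].
  apply: inr_inj; apply: (ptrans _ _ _ (qP x)); apply: (ptrans _ _ _ r).
  by rewrite prel_sym.
by apply: (ptrans _ _ _ _ (qP y)); rewrite -e prel_sym.
Qed.

Lemma ptmap_lift n (j : 'I_n.+1) :
  pmcomp t (ptmap (lift j)) (pmap K (lift j)) = t *: pidm K n.
Proof.
rewrite -[t in RHS]expr1; apply: (mrep_inj (mrep_comp (mrep_map _ _) (mrep_ptmap _))
  (mrep_scale _ _)) => a c.
have [k [P [e h]]] := mrep_map t (id : 'I_n -> 'I_n).
rewrite (sum_ext_colour j) expn1 (_ : pmx _ a c = (a == c)); last first.
  apply/pcolP/eqP => [h'|-> u w]; last first.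
    by rewrite prel_kerpart => /eqP; case: u w => u [] w /= ->.
  by apply/ffunP => i; apply: (h' (inl i) (inr i)); rewrite prel_kerpart.
have sE v : (\sum_(d : colour n) (a == pullc (lift j) (ext_colour j v d)) *
    (c == pullc (lift j) (ext_colour j v d)) = (a == c))%N.
  rewrite -[RHS](sum_eq_op (fun d : colour n => nat_of_bool (a == d)) c).
  by apply: eq_bigr => d _; rewrite pullc_ext_colour [c == d]eq_sym.
by under eq_bigr => v _ do rewrite sE; rewrite big_bool /= addnn mul2n.
Qed.

(** An isolated point is added and removed again; the loop this closes contributes [t], which is
    normalised away. *)
Lemma part_retract (n m : C) : (n <= m)%N -> is_retract n m.
Proof.
elim: m => [|m IH] nm.
  by move: nm; rewrite leqn0 => /eqP->; apply: is_retract_refl.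
have [<-|nsm] := eqVneq n m.+1; first exact: is_retract_refl.
apply: (is_retract_trans (IH _)); first by rewrite -ltnS ltn_neqAle nsm.
exists (pmap K (lift ord0)), (t^-1 *: ptmap (lift ord0)).
have t0 : t != 0 by have := tN 0.
rewrite mcompZl [X in _ *: X](ptmap_lift (ord0 : 'I_m.+1)).
by rewrite scalerA mulVf // scale1r.
Qed.

Lemma part_fin_dim (n m : C) : fin_dim_hom n m.
Proof.
exists #|{: spart ('I_n + 'I_m)%type}|, (fun k => pbas (enum_val k)) => f.
exists (fun k => f (enum_val k)).
by rewrite {1}(pbas_dec f) big_enum_val.
Qed.

Lemma part_scalar_unit : scalar_End (0%N : C).
Proof.
split; first exact: pidm0_neq0.
move=> f; exists (f (pgraph id)); rewrite [LHS]pbas_dec.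
rewrite (bigD1 (pgraph id)) //= big1 ?addr0 // => P.
have -> : P = pgraph id by apply: prel_inj => -[[]|[]].
by rewrite eqxx.
Qed.

(** Partitions other than permutations factor through [n] and are killed by [v] on either side.
    Expanding the middle factor in x = x v and in x = v x therefore leaves only permutations, as
    Maschke's argument requires. *)
Lemma part_maschke n (v x : hom (n.+1 : C) (n.+1 : C)) :
  v ∘ x = x -> x ∘ v = x ->
  (forall F : hom (n : C) (n.+1 : C), v ∘ F = 0) ->
  (forall H : hom (n.+1 : C) (n : C), H ∘ v = 0) ->
  regular_hom x.
Proof.
move=> vx xv vF Hv; pose E : lmodType K := hom (n.+1 : C) (n.+1 : C).
have [S [lS TST]] : exists S : E -> E, linear S /\ forall a, S (a ∘ x) ∘ x = a ∘ x.
  apply: (@linear_pseudo_inverse K {ffun spart ('I_n.+1 + 'I_n.+1)%type -> K^o}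
    (fun a : E => a ∘ x)).
  by move=> a u w; exact: (pmcompPl t a u w x).
pose G (s : {perm 'I_n.+1}) : E := pmap K s.
have GM r s : G (s * r)%g = G r ∘ G s.
  by rewrite /G [RHS]pmap_comp; apply: (eq_pmap t) => i; rewrite permM.
have G1 : G 1%g = idm (n.+1 : C) by apply: (eq_pmap t) => i; rewrite perm1.
have N0 : #|{: {perm 'I_n.+1}}|%:R != 0 :> K.
  have c0 : (0 < #|{: {perm 'I_n.+1}}|)%N by apply/card_gt0P; exists 1%g.
  by rewrite (pcharf0P K).1 -?lt0n; [exact: c0 | exact: charK].
pose b P : hom (n.+1 : C) (n.+1 : C) := pbas P.
have /fin_all_exists[cs csP] P : exists cs : K * {perm 'I_n.+1},
    x P *: (v ∘ b P) = cs.1 *: (v ∘ G cs.2) /\ x P *: (b P ∘ v) = cs.1 *: (G cs.2 ∘ v).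
  have [[s e]|[F [H e]]] := pbas_factor P.
    have bE : b P = G s by exact: e.
    by exists (x P, s); rewrite bE; split; reflexivity.
  have -> : b P = (F : hom (n : C) (n.+1 : C)) ∘ (H : hom (n.+1 : C) (n : C)) by exact: e.
  (* A partition that factors contributes nothing; it is recorded with coefficient 0 and an
     arbitrary permutation. *)
  exists (0, 1%g); rewrite mcompA vF -mcompA Hv mcomp0l mcomp0r; cbn [fst snd].
  by split; rewrite scaler0 [RHS]scale0r; reflexivity.
have xE : x = \sum_P x P *: b P by apply: pbas_dec.
apply: (maschke_regular lS TST N0 GM G1 vx (c := fun P => (cs P).1) (s := fun P => (cs P).2)).
  by rewrite -[LHS]xv {1}xE mcomp_suml; apply: eq_bigr => P _; rewrite mcompZl (csP P).2.
by rewrite -[LHS]vx {1}xE mcomp_sumr; apply: eq_bigr => P _; rewrite mcompZr (csP P).1.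
Qed.

Lemma part_End_regular n : homs_regular (n : C) (n : C).
Proof.
elim: n => [|n IH].
  move=> f; have [c ->] := part_scalar_unit.2 f.
  exists (c^-1 *: idm _); rewrite !(mcompZl, mcompZr, mcomp1l) !scalerA mulrC.
  by have [->|c0] := eqVneq c 0; rewrite ?mul0r // mulrA mulfK.
exact: (homs_regular_split_idem part_fin_dim IH (part_nondegenerate n.+1 n) (@part_maschke n)).
Qed.

(** Both objects are retracts of the larger one, so regularity of endomorphisms suffices. *)
Theorem part_regular (n m : C) : homs_regular n m.
Proof.
apply: (homs_regular_retract _ _ (@part_End_regular (maxn n m))).
  by apply: part_retract; apply: leq_maxl.
by apply: part_retract; apply: leq_maxr.
Qed.

End PartitionCategoryRegular.

(** * Cyclic traces and images of a single idempotent *)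

Definition trace_cyclic (K : fieldType) (A : rigidCat K) : Prop :=
  forall (X Y : A) (f : hom X Y) (g : hom Y X), trace (g ∘ f) = trace (f ∘ g).

Lemma addRigid_trace_cyclic (K : fieldType) (A : rigidCat K) :
  trace_cyclic A -> trace_cyclic (addRigid A).
Proof.
move=> cyc X Y f g; apply: entryP => -[] []; rewrite !addRigid_trace.
have E (U V : addRigid A) (h : hom U V) (k : hom V U) :
    \sum_(i : aidx U) trace (entry (k ∘ h) i i) =
    \sum_i \sum_j trace (entry k j i ∘ entry h i j).
  by apply: eq_bigr => i _; rewrite -trace_sum; congr trace; exact: entry_comp.
rewrite !E exchange_big; apply: eq_bigr => j _; apply: eq_bigr => i _.
exact: cyc.
Qed.

Lemma karRigid_trace_cyclic (K : fieldType) (A : rigidCat K) :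
  trace_cyclic A -> trace_cyclic (karRigid A).
Proof.
by move=> cyc X Y f g; apply: val_inj; rewrite [LHS]karRigid_trace [RHS]karRigid_trace; apply: cyc.
Qed.

(** A summand with simple endomorphism algebra is nonzero, hence is all of [X] up to isomorphism,
    and cyclicity of the trace gives it the Euler characteristic of [X]. *)
Lemma scalar_End_integral_type (K : fieldType) (A : rigidCat K) (X : A) :
  trace_cyclic A -> scalar_End X -> is_integral_scalar (euler_char X) ->
  is_integral_type X.
Proof.
move=> cyc sX zX; split; [exact: scalar_End_fin_dim|exact: scalar_End_semisimple|].
move=> Y [Z [i [j [p [q [pi _ _ _ _]]]]]] [Y0 _].
by rewrite /euler_char -pi cyc (scalar_End_retract sX pi Y0).
Qed.

Lemma entryZ (K : fieldType) (A : linCat K) (X Y : addObj A) a (M : ahom X Y) i j :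
  entry (a *: M) i j = a *: entry M i j.
Proof. by rewrite /entry ffunE. Qed.

Section SingleObjects.
Variables (K : fieldType) (A : rigidCat K) (x : A).
Variable M : hom (asingle x) (asingle x : addRigid A).
Hypothesis MM : M ∘ M = M.
Let e := entry M tt tt.
Let X : karRigid (addRigid A) := KarObj MM.

Lemma single_scalar_End :
  e <> 0 -> (forall g : hom x x, exists c, e ∘ g ∘ e = c *: e) -> scalar_End X.
Proof.
move=> e0 H; split=> [/(congr1 (@kval _ _ _ _))|f].
  rewrite karval0 => /(congr1 (fun N : ahom (asingle x) (asingle x) => entry N tt tt)).
  by rewrite entry0.
have [c cE] := H (entry (kval f) tt tt); exists c; apply: val_inj.
rewrite [RHS](linZ (@kval_lin _ _ X X)); apply: entryP => -[] [].
rewrite entryZ -/e.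
rewrite -cE; have /(congr1 (fun N : ahom (asingle x) (asingle x) => entry N tt tt)) := khomP f.
move=> /esym; rewrite entry_comp big_unit entry_comp big_unit.
by [].
Qed.

Lemma single_integral_scalar :
  is_integral_scalar (euler_char X) <->
  exists z : int, trace e = z%:~R *: (idm tunit : hom (tunit : A) tunit).
Proof.
have E : entry (kval (euler_char X)) tt tt = trace e.
  by rewrite /euler_char [kval _]karRigid_trace addRigid_trace big_unit.
have E1 : entry (kval (idm (tunit : karRigid (addRigid A)))) tt tt = idm tunit.
  exact: (@aidm_diag _ A (aone A) tt).
split=> [[z zE]|[z zE]]; exists z.
  rewrite -E zE [kval _](linZ (@kval_lin _ _ (kone _) (kone _))) -E1.
  by rewrite entryZ.
apply: val_inj; apply: entryP => -[] []; rewrite [LHS]E zE -E1.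
by rewrite [val _](linZ (@kval_lin _ _ (kone _) (kone _))) entryZ.
Qed.

End SingleObjects.

Section PartitionTraceFormulas.
Variables (K : fieldType) (t : K).
Notation C := (partRigid t).
Notation colour n := {ffun 'I_n -> bool}.

Lemma part_trace_cyclic : trace_cyclic C.
Proof.
move=> n m f g; move: f; apply: lin_ext => [a u v|a u v|P].
- by rewrite -trace_lin -mcompPr.
- by rewrite -trace_lin -mcompPl.
move: g; apply: lin_ext => [a u v|a u v|Q].
- by rewrite -trace_lin -mcompPl.
- by rewrite -trace_lin -mcompPr.
apply: (mrep_inj (mrep_trace (mrep_comp (mrep_bas t P) (mrep_bas t Q)))
  (mrep_trace (mrep_comp (mrep_bas t Q) (mrep_bas t P)))) => _ _.
rewrite exchange_big; apply: eq_bigr => a _; apply: eq_bigr => b _.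
by rewrite mulnC.
Qed.

Lemma part_trace_idm n : trace (idm (n : C)) = t ^+ n *: idm (tunit : C).
Proof.
apply: (trace_mrep (mrep_map t id)).
rewrite (eq_bigr (fun=> 1%N)) => [|a _]; last first.
  by rewrite (_ : pullc id a = a) ?eqxx //; apply/ffunP => i; rewrite ffunE.
by rewrite sum1_card card_ffun card_bool card_ord.
Qed.

Lemma part_trace_tens (n m : C) (f : hom n n) (g : hom m m) :
  trace (f ⊠ g) = trace f ∘ trace g.
Proof.
move: f; apply: lin_ext => [a u v|a u v|P].
- by rewrite -trace_lin -tensmPl.
- by rewrite trace_lin mcompPl.
move: g; apply: lin_ext => [a u v|a u v|Q].
- by rewrite -trace_lin -tensmPr.
- by rewrite trace_lin mcompPr.
apply: (mrep_inj (mrep_trace (mrep_tens (mrep_bas t P) (mrep_bas t Q)))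
  (mrep_comp (mrep_trace (mrep_bas t Q)) (mrep_trace (mrep_bas t P)))) => _ _.
rewrite (sum_colour_split (fun x y => pmx P x x * pmx Q y y))%N.
rewrite sum_nat_const card_ffun card_bool card_ord mul1n mulnC big_distrl /=.
by apply: eq_bigr => x _; rewrite -big_distrr.
Qed.

(** Closing up the swap threads both morphisms onto one loop. *)
Lemma part_trace_sym_tens (n : C) (f g : hom n n) :
  trace (sym n n ∘ (f ⊠ g)) = trace (g ∘ f).
Proof.
move: f; apply: lin_ext => [a u v|a u v|P].
- by rewrite -trace_lin -mcompPr -tensmPl.
- by rewrite -trace_lin -mcompPr.
move: g; apply: lin_ext => [a u v|a u v|Q].
- by rewrite -trace_lin -mcompPr -tensmPr.
- by rewrite -trace_lin -mcompPl.
apply: (mrep_inj (mrep_trace (mrep_comp (mrep_tens (mrep_bas t P) (mrep_bas t Q))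
  (mrep_map t (@swap_ord n n)))) (mrep_trace (mrep_comp (mrep_bas t P) (mrep_bas t Q)))) => _ _.
rewrite -(sum_colour_split (fun x y => pmx P x y * pmx Q y x)%N).
apply: eq_bigr => a _; rewrite sum_mapr; congr (nat_of_bool _ * nat_of_bool _)%N;
  by apply: eq_pmx => i //; rewrite !ffunE ?swap_ordl ?swap_ordr.
Qed.

(** Here [f] is a power of [t] times one partition. If that partition were [P], then [M] would be a
    multiple of the matrix of [P] and would separate the two pairs of colourings as well. *)
Lemma coef_mrep_eq0 n m (f : phom K n m) M (P : spart ('I_n + 'I_m)%type) a b a' b' :
  mrep t f M -> M a b = M a' b' -> pmx P a b != pmx P a' b' -> f P = 0.
Proof.
move=> [k [Q [-> MQ]]] e ne; rewrite !ffunE; case: eqP => [PQ|_]; last exact: mulr0.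
case/eqP: ne; move/eqP: e; rewrite !MQ -PQ eqn_pmul2l ?expn_gt0 //.
by case: (pmx _ _ _); case: (pmx _ _ _).
Qed.

End PartitionTraceFormulas.

(** * The standard object and its exterior square *)

Section AlternatingSquare.
Variables (K : fieldType) (A : symCat K) (X : A) (p : hom X X).
Hypothesis two0 : 2%:R != 0 :> K.
Hypothesis pp : p ∘ p = p.

Definition alt_idem : hom (X ⊗ X) (X ⊗ X) :=
  2%:R^-1 *: ((idm (X ⊗ X) - sym X X) ∘ (p ⊠ p)).

Lemma alt_idemE : alt_idem = 2%:R^-1 *: ((p ⊠ p) ∘ (idm (X ⊗ X) - sym X X)).
Proof. by rewrite /alt_idem mcompBl mcompBr mcomp1l mcomp1r sym_nat. Qed.

Lemma alt_idem_sym : alt_idem ∘ sym X X = - alt_idem.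
Proof.
rewrite alt_idemE mcompZl -mcompA mcompBl mcomp1l symK.
by rewrite -(opprB (idm _)) mcompNr scalerN.
Qed.

Lemma alt_idem_idem : alt_idem ∘ alt_idem = alt_idem.
Proof.
rewrite {2}/alt_idem mcompZr mcompA mcompBr mcomp1r alt_idem_sym opprK.
rewrite -mulr2n -scaler_nat mcompZl scalerA mulVf // scale1r.
by rewrite /alt_idem mcompZl -mcompA -tensm_comp pp.
Qed.

Lemma alt_idem_kill U V (f : hom U X) (g : hom V X) : p ∘ f = 0 \/ p ∘ g = 0 ->
  alt_idem ∘ (f ⊠ g) = 0.
Proof.
move=> fg; rewrite /alt_idem mcompZl -mcompA -tensm_comp.
by case: fg => ->; rewrite ?tensm0l ?tensm0r mcomp0r scaler0.
Qed.

End AlternatingSquare.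

Lemma trace_alt_idem (K : fieldType) (A : rigidCat K) (X : A) (p : hom X X) :
  trace (alt_idem p) = 2%:R^-1 *: (trace (p ⊠ p) - trace (sym X X ∘ (p ⊠ p))).
Proof. by rewrite /alt_idem traceZ mcompBl mcomp1l traceB. Qed.

Lemma mcomp_strip (K : fieldType) (A : linCat K) (W X Y Z : A) (S : hom X Y) a
    (F : hom Z X) (B : hom X Z) (h : hom W X) :
  S ∘ (idm X - a *: (F ∘ B)) ∘ h = S ∘ h - a *: ((S ∘ F) ∘ B ∘ h).
Proof. by rewrite mcompBl mcomp1l mcompBr mcompZl mcompZr -!mcompA. Qed.

Lemma mcomp_strip_source (K : fieldType) (A : linCat K) (X Y Z W : A) (S : hom Y W) (i : hom X Y)
    a (F : hom Z X) (B : hom X Z) :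
  S ∘ i ∘ (idm X - a *: (F ∘ B)) = S ∘ i - a *: ((S ∘ i ∘ F) ∘ B).
Proof. by rewrite !mcompBr mcomp1r !mcompZr -!mcompA. Qed.

Lemma tens_sub_idml (K : fieldType) (A : symCat K) (X Y Z : A) a (F : hom Z X) (B : hom X Z) :
  (idm X - a *: (F ∘ B)) ⊠ idm Y = idm (X ⊗ Y) - a *: ((F ⊠ idm Y) ∘ (B ⊠ idm Y)).
Proof. by rewrite tensmDl tensm1 -scaleN1r !tensmZl scaleN1r -tensm_comp mcomp1l. Qed.

Lemma tens_sub_idmr (K : fieldType) (A : symCat K) (X Y Z : A) a (F : hom Z X) (B : hom X Z) :
  idm Y ⊠ (idm X - a *: (F ∘ B)) = idm (Y ⊗ X) - a *: ((idm Y ⊠ F) ∘ (idm Y ⊠ B)).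
Proof. by rewrite tensmDr tensm1 -scaleN1r !tensmZr scaleN1r -tensm_comp mcomp1l. Qed.

Lemma tens_sub_idm_ll (K : fieldType) (A : symCat K) (X Y Z W : A) a
    (F : hom W X) (B : hom X W) :
  ((idm X - a *: (F ∘ B)) ⊠ idm Y) ⊠ idm Z =
    idm _ - a *: (((F ⊠ idm Y) ⊠ idm Z) ∘ ((B ⊠ idm Y) ⊠ idm Z)).
Proof. by rewrite tens_sub_idml tens_sub_idml. Qed.

Lemma tens_sub_idm_lr (K : fieldType) (A : symCat K) (X Y Z W : A) a
    (F : hom W X) (B : hom X W) :
  (idm Y ⊠ (idm X - a *: (F ∘ B))) ⊠ idm Z =
    idm _ - a *: (((idm Y ⊠ F) ⊠ idm Z) ∘ ((idm Y ⊠ B) ⊠ idm Z)).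
Proof. by rewrite tens_sub_idmr tens_sub_idml. Qed.

Lemma tens_sub_idm_rl (K : fieldType) (A : symCat K) (X Y Z W : A) a
    (F : hom W X) (B : hom X W) :
  idm Z ⊠ ((idm X - a *: (F ∘ B)) ⊠ idm Y) =
    idm _ - a *: ((idm Z ⊠ (F ⊠ idm Y)) ∘ (idm Z ⊠ (B ⊠ idm Y))).
Proof. by rewrite tens_sub_idml tens_sub_idmr. Qed.

Lemma tens_sub_idm_rr (K : fieldType) (A : symCat K) (X Y Z W : A) a
    (F : hom W X) (B : hom X W) :
  idm Z ⊠ (idm Y ⊠ (idm X - a *: (F ∘ B))) =
    idm _ - a *: ((idm Z ⊠ (idm Y ⊠ F)) ∘ (idm Z ⊠ (idm Y ⊠ B))).
Proof. by rewrite tens_sub_idmr tens_sub_idmr. Qed.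

(** The fourth tensor power of [p] is a product of four factors, each acting in one slot, so the
    corrections to the identity can be removed one at a time. *)
Lemma tens4_strip (K : fieldType) (A : symCat K) (W X Y Z : A) a
    (F : hom W X) (B : hom X W) (p := idm X - a *: (F ∘ B)) (u := idm X) (U := idm (X ⊗ X))
    (S : hom ((X ⊗ X) ⊗ (X ⊗ X)) Z) (h : hom Y ((X ⊗ X) ⊗ (X ⊗ X))) :
  S ∘ ((p ⊠ p) ⊠ (p ⊠ p)) ∘ h =
  S ∘ (idm _ - a *: (((F ⊠ u) ⊠ U) ∘ ((B ⊠ u) ⊠ U)))
    ∘ (idm _ - a *: (((u ⊠ F) ⊠ U) ∘ ((u ⊠ B) ⊠ U)))
    ∘ (idm _ - a *: ((U ⊠ (F ⊠ u)) ∘ (U ⊠ (B ⊠ u))))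
    ∘ (idm _ - a *: ((U ⊠ (u ⊠ F)) ∘ (U ⊠ (u ⊠ B)))) ∘ h.
Proof.
have -> : (p ⊠ p) ⊠ (p ⊠ p) =
    ((p ⊠ u) ⊠ U) ∘ ((u ⊠ p) ⊠ U) ∘ (U ⊠ (p ⊠ u)) ∘ (U ⊠ (u ⊠ p)).
  rewrite /u /U; move: (p) => q.
  by rewrite -!tensm_comp !(mcomp1l, mcomp1r) -?tensm_comp ?(mcomp1l, mcomp1r).
rewrite -!mcompA /p /u /U.
by rewrite tens_sub_idm_ll tens_sub_idm_lr tens_sub_idm_rl tens_sub_idm_rr.
Qed.

Lemma alt_tens_alt (K : fieldType) (A : symCat K) (X : A) (p : hom X X) (W : A)
    (h : hom W ((X ⊗ X) ⊗ (X ⊗ X))) (P := (p ⊠ p) ⊠ (p ⊠ p)) (s := sym X X) (u := idm (X ⊗ X)) :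
  (alt_idem p ⊠ alt_idem p) ∘ h = (2%:R^-1 * 2%:R^-1) *:
    ((u ⊠ u) ∘ P ∘ h - (s ⊠ u) ∘ P ∘ h - ((u ⊠ s) ∘ P ∘ h - (s ⊠ s) ∘ P ∘ h)).
Proof.
have tBl (f f' g : hom (X ⊗ X) (X ⊗ X)) : (f - f') ⊠ g = f ⊠ g - f' ⊠ g.
  by rewrite tensmDl -!scaleN1r tensmZl.
have tBr (f g g' : hom (X ⊗ X) (X ⊗ X)) : f ⊠ (g - g') = f ⊠ g - f ⊠ g'.
  by rewrite tensmDr -!scaleN1r tensmZr.
rewrite /alt_idem tensmZl tensmZr tensm_comp scalerA mcompZl -mcompA; congr (_ *: _).
by rewrite tBr !tBl !mcompBl.
Qed.

Section IrrationalSummand.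
Variables (K : fieldType) (t : K).
Hypothesis charK : [pchar K] =i pred0.
Hypothesis tN : forall n : nat, t != n%:R.
Notation C := (partRigid t).
Notation colour n := {ffun 'I_n -> bool}.

Let t0 : t != 0. Proof. exact: (tN 0). Qed.
Let two0 : 2%:R != 0 :> K. Proof. by rewrite (pcharf0P K).1. Qed.

(** For [t] a natural number, [eta] is the all-ones vector of the permutation representation, [eps]
    the sum of the coordinates, and [std_idem] below the projection onto the vectors of sum zero. *)
Definition eta : hom (0%N : C) (1%N : C) := pmap K (lift ord0).
Definition eps : hom (1%N : C) (0%N : C) := ptmap K (lift ord0).

Lemma eps_eta : eps ∘ eta = t *: idm (0%N : C).
Proof. exact: ptmap_lift. Qed.

Definition std_idem : hom (1%N : C) (1%N : C) := idm (1%N : C) - t^-1 *: (eta ∘ eps).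
Notation p := std_idem.

Lemma std_eta : p ∘ eta = 0.
Proof.
rewrite /p mcompBl mcomp1l mcompZl -mcompA eps_eta mcompZr mcomp1r scalerA mulVf //.
by rewrite scale1r subrr.
Qed.

Lemma std_std : p ∘ p = p.
Proof. by rewrite {2}/p mcompBr mcomp1r mcompZr mcompA std_eta mcomp0l scaler0 subr0. Qed.

Lemma trace_std : trace p = (t - 1) *: idm (tunit : C).
Proof.
have scal (V : lmodType K) (u : V) :
    t ^+ 1 *: u - t^-1 *: (t *: (t ^+ 0 *: u)) = (t - 1) *: u.
  by rewrite expr1 expr0 scale1r scalerA mulVf // scale1r scalerBl scale1r.
rewrite /p traceB traceZ part_trace_cyclic eps_eta traceZ !part_trace_idm.
exact: scal.
Qed.

(** Partitions that factor through [n] are killed by [e], and the remaining ones are permutations,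
    which [e] turns into scalars. *)
Lemma scalar_compress n (e : hom (n.+1 : C) (n.+1 : C)) : e ∘ e = e ->
  (forall F : hom (n : C) (n.+1 : C), e ∘ F = 0) ->
  (forall s : {perm 'I_n.+1}, exists c, e ∘ (pmap K s : hom (n.+1 : C) (n.+1 : C)) = c *: e) ->
  forall g, exists c, e ∘ g ∘ e = c *: e.
Proof.
move=> ee eF es g.
pose b P : hom (n.+1 : C) (n.+1 : C) := pbas P.
have /fin_all_exists[c cP] P : exists c, e ∘ b P ∘ e = c *: e.
  have [[s bE]|[F [H bE]]] := pbas_factor tN P.
    have [c cE] := es s; exists c; have -> : b P = pmap K s by exact: bE.
    by rewrite mcompA cE mcompZl ee.
  have -> : b P = (F : hom (n : C) (n.+1 : C)) ∘ (H : hom (n.+1 : C) (n : C)) by exact: bE.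
  by exists 0; rewrite -mcompA mcompA eF mcomp0l [RHS]scale0r.
exists (\sum_P g P * c P); have gE : g = \sum_P g P *: b P by apply: pbas_dec.
rewrite {1}gE mcomp_suml mcomp_sumr scaler_suml; apply: eq_bigr => P _.
by rewrite mcompZl mcompZr cP scalerA; reflexivity.
Qed.

Lemma std_scalar g : exists c, p ∘ g ∘ p = c *: p.
Proof.
apply: (scalar_compress std_std) => [F|s].
  have -> : F = F (pgraph (lift ord0)) *: eta.
    rewrite [LHS]pbas_dec (bigD1 (pgraph (lift ord0))) //= big1 ?addr0 // => P.
    have -> : P = pgraph (lift ord0) :> spart ('I_0 + 'I_1)%type.
      by apply: prel_inj => -[[]//|x] [[]//|y]; rewrite !ord1 !prel_refl.
    by rewrite eqxx.
  by rewrite mcompZr std_eta scaler0.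
exists 1; have -> : pmap K s = idm (1%N : C).
  by apply: (eq_pmap t) => i; rewrite !ord1.
by rewrite mcomp1r scale1r.
Qed.

Notation c1 := (1%N : C).
Definition alt_std : hom (c1 ⊗ c1) (c1 ⊗ c1) := alt_idem p.
Notation e := alt_std.

Lemma alt_std_idem : e ∘ e = e.
Proof. exact: (alt_idem_idem two0 std_std). Qed.

Lemma trace_alt_std : trace e = (2%:R^-1 * ((t - 1) * (t - 1) - (t - 1))) *: idm (tunit : C).
Proof.
have scal (V : lmodType K) (u : V) : 2%:R^-1 *: ((t - 1) *: ((t - 1) *: u) - (t - 1) *: u) =
    (2%:R^-1 * ((t - 1) * (t - 1) - (t - 1))) *: u.
  by rewrite scalerA -scalerBl scalerA.
have pp1 : trace (p ⊠ p) = trace p ∘ trace p := part_trace_tens p p.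
have pp2 : trace (sym c1 c1 ∘ (p ⊠ p)) = trace p.
  by rewrite -[in RHS]std_std; exact: part_trace_sym_tens.
rewrite [LHS]trace_alt_idem pp1 pp2 trace_std mcompZl mcomp1l; exact: scal.
Qed.

Lemma swap_ord11 (i : 'I_2) : @swap_ord 1 1 i = rev_ord i.
Proof.
by case: (@split_ordP 1 1 i) => j ->; rewrite ?swap_ordl ?swap_ordr; apply: val_inj; rewrite !ord1.
Qed.

Lemma ord2_cases (i : 'I_2) : i = ord0 \/ i = ord_max.
Proof. by case: i => [[|[|//]] ?]; [left|right]; apply: val_inj. Qed.

Lemma perm2_cases (s : {perm 'I_2}) : s =1 id \/ s =1 @swap_ord 1 1.
Proof.
have rE (i j : 'I_2) : i != j -> j = rev_ord i.
  by case: i j => [[|[|//]] ?] [[|[|//]] ?] // _; apply: val_inj.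
have [s0|s0] := eqVneq (s ord0) ord0; [left|right] => i; rewrite ?swap_ord11.
  have [->//|i0] := eqVneq i ord0.
  rewrite (rE ord0 i) 1?eq_sym //; apply: (rE ord0); rewrite -{1}s0 (inj_eq perm_inj).
  by [].
apply: (rE i); have [->|i0] := eqVneq i ord0; first by rewrite eq_sym.
have e1 : i = rev_ord ord0 by apply: (rE ord0); rewrite eq_sym.
have e2 : s ord0 = rev_ord ord0 by apply: (rE ord0); rewrite eq_sym.
apply: contra i0 => /eqP si; apply/eqP/(@perm_inj _ s).
by rewrite -si e2.
Qed.

Lemma alt_std_perm (s : {perm 'I_2}) :
  exists c, e ∘ (pmap K s : hom (c1 ⊗ c1) (c1 ⊗ c1)) = c *: e.
Proof.
have [sE|sE] := perm2_cases s.
  exists 1; have -> : pmap K s = idm (c1 ⊗ c1) by apply: (eq_pmap t) => i; rewrite sE.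
  by rewrite mcomp1r [RHS]scale1r.
exists (-1); have -> : pmap K s = sym c1 c1 by apply: (eq_pmap t) => i; rewrite sE.
by rewrite alt_idem_sym [RHS]scaleN1r.
Qed.

Lemma pmap_lift0 : (pmap K (lift (ord0 : 'I_2)) : hom c1 (c1 ⊗ c1)) = (eta ⊠ idm c1) ∘ lunitV c1.
Proof.
rewrite [RHS](_ : _ = pmcomp t (ptensm (pmap K (lift ord0)) (pmap K id))
  (pmap K (cast_ord (esym (add0n 1))))) //.
rewrite pmap_tens // pmap_comp; apply: (eq_pmap t) => i; rewrite [RHS]/=.
have -> : cast_ord (esym (add0n 1)) i = rshift 0 i by apply: val_inj.
by rewrite sum_ordr; apply: val_inj; rewrite ord1.
Qed.

Lemma pmap_lift1 : (pmap K (lift (ord_max : 'I_2)) : hom c1 (c1 ⊗ c1)) = (idm c1 ⊠ eta) ∘ runitV c1.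
Proof.
rewrite [RHS](_ : _ = pmcomp t (ptensm (pmap K id) (pmap K (lift ord0)))
  (pmap K (cast_ord (esym (addn0 1))))) //.
rewrite pmap_tens // pmap_comp; apply: (eq_pmap t) => i; rewrite [RHS]/=.
have -> : cast_ord (esym (addn0 1)) i = lshift 0 i by apply: val_inj.
by rewrite sum_ordl; apply: val_inj; rewrite ord1.
Qed.

(** A partition with an isolated output contains [eta], which [p] kills. Otherwise both outputs lie
    in one block, the diagram is symmetric under the swap, and the antisymmetriser kills it. *)
Lemma alt_std_lower (F : hom c1 (c1 ⊗ c1)) : e ∘ F = 0.
Proof.
pose b P : hom c1 (c1 ⊗ c1) := pbas P.
have FE : F = \sum_P F P *: b P by apply: pbas_dec.
rewrite FE mcomp_sumr big1 // => P _; rewrite mcompZr.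
suff -> : e ∘ b P = 0 by rewrite scaler0.
have lift_eq0 (j : 'I_2) : (forall x, prel P (inr j) x -> x = inr j) ->
    e ∘ (pmap K (lift j) : hom c1 (c1 ⊗ c1)) = 0 -> e ∘ b P = 0.
  move=> iso ej; have [H bE] := pbas_isolated tN iso.
  have -> : b P = (pmap K (lift j) : hom c1 (c1 ⊗ c1)) ∘ (H : hom c1 c1) by exact: bE.
  by rewrite mcompA ej mcomp0l.
have [i0|n0] := EM (forall x, prel P (inr ord0) x -> x = inr ord0).
  apply: (lift_eq0 _ i0); rewrite pmap_lift0 mcompA alt_idem_kill ?mcomp0l //.
  by left; exact: std_eta.
have [i1|n1] := EM (forall x, prel P (inr ord_max) x -> x = inr ord_max).
  apply: (lift_eq0 _ i1); rewrite pmap_lift1 mcompA alt_idem_kill ?mcomp0l //.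
  by right; exact: std_eta.
have toj (j : 'I_2) : ~ (forall x, prel P (inr j) x -> x = inr j) ->
    prel P (inr ord0) (inr ord_max) \/ prel P (inr j) (inl ord0).
  move=> nj; apply: contrapT => /not_orP[n01 nji]; apply: nj => -[i|k] r.
    by case: nji; rewrite (ord1 i) in r.
  have [->//|kj] := eqVneq k j; case: n01.
  have [j0|j1] := ord2_cases j; have [k0|k1] := ord2_cases k; move: kj r.
  - by rewrite j0 k0 eqxx.
  - by rewrite j0 k1.
  - by rewrite j1 k0 prel_sym.
  - by rewrite j1 k1 eqxx.
(* There is only one input, so two outputs that are both joined to it are joined to each other. *)
have r01 : prel P (inr ord0) (inr ord_max).
  case: (toj _ n0) => // r0; case: (toj _ n1) => // r1.
  by have [_ ->] := prel_equiv P (inr ord0) (inl ord0) (inr ord_max); rewrite // prel_sym.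
have sb : sym c1 c1 ∘ b P = b P.
  apply: (mrep_inj (mrep_comp (mrep_bas t P) (mrep_map t (@swap_ord 1 1))) (mrep_bas t P)) => a c.
  rewrite sum_mapr; congr nat_of_bool; set d := pullc _ c.
  have dE (i : 'I_2) : d i = c (rev_ord i) by rewrite ffunE swap_ord11.
  have cd : c ord0 = c ord_max -> d = c.
    move=> c01; apply/ffunP => i; rewrite dE.
    have [->|->] := ord2_cases i.
      by rewrite (_ : rev_ord ord0 = ord_max) //; apply: val_inj.
    by rewrite (_ : rev_ord ord_max = ord0) //; apply: val_inj.
  apply/idP/idP => h; last by rewrite cd //; apply: (pcolP _ _ h _ _ r01).
  rewrite -cd //; have := pcolP _ _ h _ _ r01; rewrite /scol !dE.
  rewrite (_ : rev_ord ord0 = ord_max); last exact: val_inj.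
  by rewrite (_ : rev_ord ord_max = ord0); last exact: val_inj.
have eb : e ∘ b P = - (e ∘ b P).
  by rewrite -{1}sb mcompA alt_idem_sym mcompNl.
have : 2%:R *: (e ∘ b P) = 0.
  by rewrite scaler_nat mulr2n {1}eb addNr.
by move/eqP; rewrite scaler_eq0 (negbTE two0) => /eqP.
Qed.

Lemma alt_std_scalar g : exists c, e ∘ g ∘ e = c *: e.
Proof. exact: (scalar_compress (n := 1) alt_std_idem alt_std_lower alt_std_perm). Qed.

(** * A nonzero morphism from the standard object to the square of its exterior square *)

Notation c4 := ((c1 ⊗ c1) ⊗ (c1 ⊗ c1)).

(* The blocks are the input with the outputs 0 and 2, and the outputs 1 and 3. *)
Definition zigzag : spart ('I_1 + 'I_(1 + 1 + (1 + 1)))%type :=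
  kerpart (fun x : 'I_1 + 'I_(1 + 1 + (1 + 1)) => if x is inr k then odd k else false).

(** A linear form that detects the morphism: [zigzag] has no isolated point and is not preserved by
    the swaps inside the pairs of outputs, so all correction terms have coefficient zero on it. *)
Definition coef (f : hom c1 c4) : K := (f : phom K 1 (1 + 1 + (1 + 1))) zigzag.

Lemma coef_sum (I : Type) (r : seq I) (F : I -> hom c1 c4) :
  coef (\sum_(i <- r) F i) = \sum_(i <- r) coef (F i).
Proof. by apply: (big_morph coef) => [u v|]; rewrite /coef ffunE. Qed.

Lemma coefZ a f : coef (a *: f) = a * coef f.
Proof. by rewrite /coef ffunE. Qed.

Lemma coefB f g : coef (f - g) = coef f - coef g.
Proof. by rewrite /coef !ffunE. Qed.

Lemma zigzag_not_isolated j : exists x, x != inr j /\ prel zigzag (inr j) x.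
Proof.
case: (boolP (odd j)) => oj; last first.
  by exists (inl ord0); split; rewrite // prel_kerpart (negbTE oj).
pose k : 'I_(1 + 1 + (1 + 1)) :=
  (* The other odd output. *)
  if j == 1%N :> nat then Ordinal (isT : 3 < 4)%N else Ordinal (isT : 1 < 4)%N.
exists (inr k); rewrite prel_kerpart oj /k; split; last by case: ifP.
case: ifP => j1; apply/negP => /eqP[] /(congr1 val) /= e'; first by rewrite -e' in j1.
by rewrite -e' in j1.
Qed.

Definition true_colour n : colour n := [ffun=> true].

Lemma pmx_true n m (P : spart ('I_n + 'I_m)%type) :
  pmx P (true_colour n) (true_colour m).
Proof. by apply/pcolP => -[x|x] [y|y] _ /=; rewrite !ffunE. Qed.

(** An output outside the image of [phi] is isolated in every partition that occurs in the
    composite, but not in [zigzag]. Changing the colour of [j] alone exhibits this. *)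
Lemma coef_missing_output (n : nat) (phi : 'I_n -> 'I_(1 + 1 + (1 + 1))) j
    (Y : hom c1 (n : C)) :
  (forall i, phi i != j) -> coef ((pmap K phi : hom (n : C) c4) ∘ Y) = 0.
Proof.
move=> phij; pose b P : hom c1 (n : C) := pbas P.
have YE : Y = \sum_P Y P *: b P by apply: pbas_dec.
rewrite YE mcomp_sumr coef_sum big1 // => P _; rewrite mcompZr coefZ.
suff -> : coef ((pmap K phi : hom (n : C) c4) ∘ b P) = 0 by rewrite mulr0.
pose c : colour (1 + 1 + (1 + 1)) := [ffun k => k != j].
have E : pullc phi (true_colour _) = pullc phi c.
  by apply/ffunP => i; rewrite !ffunE phij.
apply: (coef_mrep_eq0 (mrep_comp (mrep_bas t P) (mrep_map t phi))
  (a := true_colour 1) (b := true_colour _) (a' := true_colour 1) (b' := c)).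
  rewrite !sum_mapr; congr (nat_of_bool (pmx _ _ _)).
  by rewrite E.
rewrite pmx_true; apply/eqP => /esym/pcolP h.
have [x [xj r]] := zigzag_not_isolated j; have := h _ _ r.
rewrite /= ffunE eqxx; case: x xj {r} => [x|k] kj /=; rewrite ffunE //.
by move=> /esym/negbT; rewrite negbK => /eqP kE; rewrite kE eqxx in kj.
Qed.

(** Every partition occurring after [eps] has an isolated input, whereas [zigzag] joins the input to
    outputs. *)
Lemma coef_eps (Z : hom (0%N : C) c4) : coef (Z ∘ eps) = 0.
Proof.
pose b P : hom (0%N : C) c4 := pbas P.
have ZE : Z = \sum_P Z P *: b P by apply: pbas_dec.
rewrite ZE mcomp_suml coef_sum big1 // => P _; rewrite mcompZl coefZ.
suff -> : coef (b P ∘ eps) = 0 by rewrite mulr0.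
apply: (coef_mrep_eq0 (mrep_comp (mrep_ptmap t (lift ord0)) (mrep_bas t P))
  (a := true_colour 1) (b := true_colour _) (a' := [ffun=> false]) (b' := true_colour _)).
  by apply: eq_bigr => x _; congr (nat_of_bool (_ == _) * _)%N; apply/ffunP => -[].
rewrite pmx_true; apply/eqP => /esym/pcolP h.
have := h (inl ord0) (inr (lshift _ (lshift _ ord0))); rewrite prel_kerpart /= !ffunE.
by move=> /(_ isT).
Qed.

(** The correction term factors through sg ∘ phi, which misses the output [sg j]. *)
Lemma coef_strip (n : nat) (sg : 'I_(1 + 1 + (1 + 1)) -> 'I_(1 + 1 + (1 + 1)))
    (phi : 'I_n -> 'I_(1 + 1 + (1 + 1))) j a (F : hom (n : C) c4) (B : hom c4 (n : C))
    (h : hom c1 c4) :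
  injective sg -> (forall i, phi i != j) -> F = pmap K phi ->
  coef ((pmap K sg : hom c4 c4) ∘ (idm c4 - a *: (F ∘ B)) ∘ h) =
  coef ((pmap K sg : hom c4 c4) ∘ h).
Proof.
move=> sgI phij FE; have -> := mcomp_strip (pmap K sg : hom c4 c4) a F B h.
have -> : (pmap K sg : hom c4 c4) ∘ F = pmap K (sg \o phi).
  by rewrite FE; exact: pmap_comp.
rewrite coefB coefZ (@coef_missing_output _ (sg \o phi) (sg j)) ?mulr0 ?subr0 // => i /=.
by rewrite inj_eq.
Qed.

Lemma coef_strip4 (sg : 'I_(1 + 1 + (1 + 1)) -> 'I_(1 + 1 + (1 + 1))) (h : hom c1 c4) :
  injective sg ->
  coef ((pmap K sg : hom c4 c4) ∘ ((p ⊠ p) ⊠ (p ⊠ p)) ∘ h) =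
  coef ((pmap K sg : hom c4 c4) ∘ h).
Proof.
move=> sgI; pose f0 : 'I_0 -> 'I_1 := lift ord0.
(* Creating an isolated point in one of the four slots is the inclusion of three outputs that misses
   the output 0, 1, 2 or 3 respectively. *)
pose phi1 := sum_ord (sum_ord f0 (@id 'I_1)) (@id 'I_(1 + 1)).
pose phi2 := sum_ord (sum_ord (@id 'I_1) f0) (@id 'I_(1 + 1)).
pose phi3 := sum_ord (@id 'I_(1 + 1)) (sum_ord f0 (@id 'I_1)).
pose phi4 := sum_ord (@id 'I_(1 + 1)) (sum_ord (@id 'I_1) f0).
have E1 : ptensm (ptensm (pmap K f0) (pidm K 1)) (pidm K (1 + 1)) = pmap K phi1.
  exact: (etrans (congr1 (fun f => ptensm f _) (pmap_tens t f0 id)) (pmap_tens t _ id)).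
have E2 : ptensm (ptensm (pidm K 1) (pmap K f0)) (pidm K (1 + 1)) = pmap K phi2.
  exact: (etrans (congr1 (fun f => ptensm f _) (pmap_tens t id f0)) (pmap_tens t _ id)).
have E3 : ptensm (pidm K (1 + 1)) (ptensm (pmap K f0) (pidm K 1)) = pmap K phi3.
  exact: (etrans (congr1 (ptensm _) (pmap_tens t f0 id)) (pmap_tens t id _)).
have E4 : ptensm (pidm K (1 + 1)) (ptensm (pidm K 1) (pmap K f0)) = pmap K phi4.
  exact: (etrans (congr1 (ptensm _) (pmap_tens t id f0)) (pmap_tens t id _)).
have ne (x y : 'I_(1 + 1 + (1 + 1))) : nat_of_ord x != y -> x != y by [].
have m1 i : phi1 i != lshift 2 (lshift 1 (ord0 : 'I_1)).
  apply: ne; rewrite /phi1; case: (split_ordP i) => k ->; rewrite ?sum_ordl ?sum_ordr //.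
  by case: (split_ordP k) => k' -> ; [case: k' | rewrite sum_ordr].
have m2 i : phi2 i != lshift 2 (rshift 1 (ord0 : 'I_1)).
  apply: ne; rewrite /phi2; case: (split_ordP i) => k ->; rewrite ?sum_ordl ?sum_ordr //.
  by case: (split_ordP k) => k' -> ; [rewrite sum_ordl ord1 | case: k'].
have m3 i : phi3 i != rshift 2 (lshift 1 (ord0 : 'I_1)).
  apply: ne; rewrite /phi3; case: (split_ordP i) => k ->; rewrite ?sum_ordl ?sum_ordr //.
    by case: k => [[|[|//]]].
  by case: (split_ordP k) => k' -> ; [case: k' | rewrite sum_ordr ord1].
have m4 i : phi4 i != rshift 2 (rshift 1 (ord0 : 'I_1)).
  apply: ne; rewrite /phi4; case: (split_ordP i) => k ->; rewrite ?sum_ordl ?sum_ordr //.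
    by case: k => [[|[|//]]].
  by case: (split_ordP k) => k' -> ; [rewrite sum_ordl ord1 | case: k'].
have -> := tens4_strip t^-1 eta eps (pmap K sg : hom c4 c4) h.
apply: etrans (coef_strip _ _ _ sgI m1 E1) _.
apply: etrans (coef_strip _ _ _ sgI m2 E2) _.
apply: etrans (coef_strip _ _ _ sgI m3 E3) _.
exact: coef_strip _ _ _ sgI m4 E4.
Qed.

Definition zigzag_hom : hom c1 c4 := pbas zigzag.

Lemma coef_strip_zigzag (sg : 'I_(1 + 1 + (1 + 1)) -> 'I_(1 + 1 + (1 + 1))) :
  injective sg ->
  coef ((pmap K sg : hom c4 c4) ∘ ((p ⊠ p) ⊠ (p ⊠ p)) ∘ zigzag_hom ∘ p) =
  coef ((pmap K sg : hom c4 c4) ∘ zigzag_hom).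
Proof.
move=> sgI; apply: etrans (coef_strip4 _ sgI) _.
have -> := mcomp_strip_source (pmap K sg : hom c4 c4) zigzag_hom t^-1 eta eps.
by rewrite coefB coefZ coef_eps mulr0 subr0.
Qed.

(** In the composite the input is joined to the odd output [sg k], in [zigzag] only to even ones. *)
Lemma coef_swap_zigzag (sg : 'I_(1 + 1 + (1 + 1)) -> 'I_(1 + 1 + (1 + 1)))
    (k : 'I_(1 + 1 + (1 + 1))) :
  ~~ odd k -> odd (sg k) -> coef ((pmap K sg : hom c4 c4) ∘ zigzag_hom) = 0.
Proof.
move=> ek osk; pose c : colour (1 + 1 + (1 + 1)) := [ffun k : 'I_(1 + 1 + (1 + 1)) => ~~ odd k].
pose c0 : colour (1 + 1 + (1 + 1)) := [ffun=> false].
have inl_k b : pmx zigzag (true_colour 1) b -> b k.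
  move/pcolP/(_ (inl ord0) (inr k)); rewrite prel_kerpart (negbTE ek) => /(_ isT).
  by rewrite /= ffunE.
(* With the input coloured true, [zigzag] admits [c] but not [c0], while the composite rejects both
   because they colour [sg k] false. *)
apply: (coef_mrep_eq0 (mrep_comp (mrep_bas t zigzag) (mrep_map t sg))
  (a := true_colour 1) (b := c) (a' := true_colour 1) (b' := c0)).
  rewrite !sum_mapr; congr nat_of_bool; transitivity false; [|apply: esym];
    by apply/negP => /inl_k; rewrite !ffunE ?osk.
have -> : pmx zigzag (true_colour 1) c0 = false by apply/negP => /inl_k; rewrite ffunE.
rewrite (_ : pmx _ _ _ = true) //; apply/pcolP => x y.
have E z : scol (true_colour 1) c z = ~~ (if z is inr k then odd k else false).
  by case: z => z /=; rewrite ffunE.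
by rewrite prel_kerpart !E => /eqP ->.
Qed.

Lemma coef_zigzag : coef zigzag_hom = 1.
Proof. by rewrite /coef /zigzag_hom ffunE eqxx. Qed.

Lemma sum_ord_inj n m (phi : 'I_n -> 'I_n) (psi : 'I_m -> 'I_m) :
  involutive phi -> involutive psi -> injective (sum_ord phi psi).
Proof.
move=> phiK psiK; apply: (can_inj (g := sum_ord phi psi)) => i.
by case: (split_ordP i) => j ->; rewrite ?(sum_ordl, sum_ordr) ?(sum_ordl, sum_ordr) ?phiK ?psiK.
Qed.

(** Of the four terms of the two antisymmetrisers only the identity contributes, since a swap inside
    a pair moves an even output to an odd place. The value is the product of the two
    normalisations. *)
Lemma coef_alt_zigzag : coef ((e ⊠ e) ∘ (zigzag_hom ∘ p)) = 2%:R^-1 * 2%:R^-1.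
Proof.
have -> := alt_tens_alt p (zigzag_hom ∘ p).
pose i2 := @id 'I_(1 + 1); pose sw := @swap_ord 1 1.
have swK : involutive sw := @swap_ordK 1 1.
have i2K : involutive i2 by [].
have E0 : ptensm (pidm K (1 + 1)) (pidm K (1 + 1)) = pmap K (sum_ord i2 i2) := pmap_tens t i2 i2.
have E1 : ptensm (psym K 1 1) (pidm K (1 + 1)) = pmap K (sum_ord sw i2) := pmap_tens t sw i2.
have E2 : ptensm (pidm K (1 + 1)) (psym K 1 1) = pmap K (sum_ord i2 sw) := pmap_tens t i2 sw.
have E3 : ptensm (psym K 1 1) (psym K 1 1) = pmap K (sum_ord sw sw) := pmap_tens t sw sw.
have c0 : coef ((pmap K (sum_ord i2 i2) : hom c4 c4) ∘ zigzag_hom) = 1.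
  have -> : pmap K (sum_ord i2 i2) = idm c4.
    apply: (eq_pmap t) => i.
    by case: (split_ordP i) => j ->; rewrite ?sum_ordl ?sum_ordr.
  by rewrite mcomp1l coef_zigzag.
have k0 : sw (lshift 1 (ord0 : 'I_1)) = rshift 1 (ord0 : 'I_1) := @swap_ordl 1 1 ord0.
have c1' psi : coef ((pmap K (sum_ord sw psi) : hom c4 c4) ∘ zigzag_hom) = 0.
  by apply: (@coef_swap_zigzag _ (lshift 2 (lshift 1 (ord0 : 'I_1)))); rewrite // sum_ordl k0.
have c2' : coef ((pmap K (sum_ord i2 sw) : hom c4 c4) ∘ zigzag_hom) = 0.
  by apply: (@coef_swap_zigzag _ (rshift 2 (lshift 1 (ord0 : 'I_1)))); rewrite // sum_ordr k0.
have strip sg (S : hom c4 c4) : S = pmap K sg -> injective sg ->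
    coef (S ∘ ((p ⊠ p) ⊠ (p ⊠ p)) ∘ zigzag_hom ∘ p) =
    coef ((pmap K sg : hom c4 c4) ∘ zigzag_hom).
  by move=> ->; apply: coef_strip_zigzag.
have arith (q x0 x1 x2 x3 : K) : x0 = 1 -> x1 = 0 -> x2 = 0 -> x3 = 0 ->
    q * (x0 - x1 - (x2 - x3)) = q.
  by move=> -> -> -> ->; rewrite !subr0 mulr1.
have coef4 q x0 x1 x2 x3 : coef (q *: (x0 - x1 - (x2 - x3))) =
    q * (coef x0 - coef x1 - (coef x2 - coef x3)) by rewrite coefZ !coefB.
apply: etrans (coef4 _ _ _ _ _) _; apply: arith.
- exact: (etrans (strip _ _ E0 (sum_ord_inj i2K i2K)) c0).
- exact: (etrans (strip _ _ E1 (sum_ord_inj swK i2K)) (c1' _)).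
- exact: (etrans (strip _ _ E2 (sum_ord_inj i2K swK)) c2').
- exact: (etrans (strip _ _ E3 (sum_ord_inj swK swK)) (c1' _)).
Qed.

End IrrationalSummand.

(** * Deligne's category *)

Section SingleMatrices.
Variables (K : fieldType) (A : linCat K).

Definition single_mat (x : A) (e : hom x x) : hom (asingle x) (asingle x) :=
  @amat _ _ (asingle x) (asingle x) (fun _ _ => e).

Lemma single_mat_idem (x : A) (e : hom x x) :
  e ∘ e = e -> single_mat e ∘ single_mat e = single_mat e.
Proof. by move=> ee; apply: entryP => -[] []; rewrite entry_comp big_unit !entryE. Qed.

End SingleMatrices.

Section DeligneCategory.
Variables (K : fieldType) (t : K).
Hypothesis charK : [pchar K] =i pred0.
Hypothesis tN : forall n : nat, t != n%:R.
Notation C := (partRigid t).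
Notation c1 := (1%N : C).

Lemma repS_regular (X Y : repS t) : homs_regular X Y.
Proof. exact: (karLin_regular (addLin_regular (part_regular charK tN))). Qed.

Lemma repS_fin_dim (X Y : repS t) : fin_dim_hom X Y.
Proof. exact: (karLin_fin_dim (addLin_fin_dim (@part_fin_dim K t))). Qed.

Lemma repS_abelian : is_abelian (repS t).
Proof.
exact: (regular_abelian repS_regular (@rtc_pseudo_abelian _ (repS t)) (@rtc_additive _ (repS t))).
Qed.

Lemma repS_semisimple : is_semisimple (repS t).
Proof.
apply: (regular_semisimple repS_regular (@rtc_pseudo_abelian _ (repS t))) => X.
exact: repS_fin_dim.
Qed.

Lemma repS_trace_cyclic : trace_cyclic (repS t).
Proof. exact: (karRigid_trace_cyclic (addRigid_trace_cyclic (@part_trace_cyclic K t))). Qed.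

Lemma repS_scalar_unit : scalar_unit (repS t).
Proof.
have E1 : entry (idm (asingle (0%N : C))) tt tt = idm (0%N : C).
  exact: (@aidm_diag _ C (aone C) tt).
have [u0 uS] := @part_scalar_unit K t.
apply: (single_scalar_End (mcomp1l (idm (asingle (0%N : C))))); first by rewrite E1.
by move=> g; have [c cE] := uS g; exists c; rewrite E1 mcomp1r mcomp1l.
Qed.

Definition std_obj : repS t := KarObj (single_mat_idem (std_std tN)).
Definition alt_obj : repS t := KarObj (single_mat_idem (alt_std_idem charK tN)).

(** The trace t - 1 shows that the object is nonzero. *)
Lemma std_obj_scalar_End : t != 1 -> scalar_End std_obj.
Proof.
move=> t1; apply: single_scalar_End; rewrite [entry _ _ _]entryE.
  move=> p0; have := trace_std tN; rewrite p0 trace0 => /esym/eqP.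
  rewrite scaler_eq0 subr_eq0 (negbTE t1) => /eqP.
  exact: (@part_scalar_unit K t).1.
exact: std_scalar.
Qed.

Lemma std_obj_euler : is_integral_scalar (euler_char std_obj) -> exists z : int, t = z%:~R.
Proof.
move=> /single_integral_scalar[z]; rewrite [entry _ _ _]entryE trace_std // => /eqP.
rewrite -subr_eq0 -scalerBl scaler_eq0 => /orP[|/eqP u0]; last first.
  by case: (@part_scalar_unit K t).1.
rewrite subr_eq0 subr_eq => /eqP tz; exists (z + 1).
by rewrite intrD.
Qed.

Hypothesis t2 : t * t = 3%:R * t + 2%:R.

Lemma alt_trace : trace (alt_std t) = 2%:R *: idm (tunit : C).
Proof.
apply: etrans (trace_alt_std tN) _; congr (_ *: _).
have -> : (t - 1) * (t - 1) - (t - 1) = t * t - 3%:R * t + 2%:R by ring.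
rewrite t2 (_ : _ + _ = 2%:R + 2%:R); last by ring.
have two0 : 2%:R != 0 :> K by rewrite (pcharf0P K).1.
by rewrite mulrDr mulVf.
Qed.

Lemma alt_obj_scalar_End : scalar_End alt_obj.
Proof.
apply: single_scalar_End; rewrite [entry _ _ _]entryE.
  move=> p0; have := alt_trace; rewrite p0 trace0 => /esym/eqP.
  rewrite scaler_eq0 (negbTE (_ : 2%:R != 0 :> K)); last by rewrite (pcharf0P K).1.
  by move=> /eqP; exact: (@part_scalar_unit K t).1.
exact: alt_std_scalar.
Qed.

Lemma alt_obj_integral_type : is_integral_type alt_obj.
Proof.
apply: (scalar_End_integral_type repS_trace_cyclic alt_obj_scalar_End).
apply/single_integral_scalar; exists 2; rewrite [entry _ _ _]entryE.
exact: alt_trace.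
Qed.

(** [kmk] composes the diagram with the projectors of source and target, so its only entry is the
    morphism of [coef_alt_zigzag]. *)
Definition std_to_alt2 : hom std_obj (alt_obj ⊗ alt_obj) :=
  @kmk _ _ std_obj (ktens (alt_obj : karObj (addRigid C)) alt_obj)
    (@amat _ _ (asingle c1) (atens (asingle (c1 ⊗ c1)) (asingle (c1 ⊗ c1)))
      (fun _ _ => zigzag_hom t)).

Lemma big_unit2 (V : nmodType) (F : unit * unit -> V) : \sum_i F i = F (tt, tt).
Proof. by rewrite (bigD1 (tt, tt)) //= big1 ?addr0 // => -[[] []]. Qed.

Lemma std_to_alt2_neq0 : std_to_alt2 <> 0.
Proof.
move=> /(congr1 (@kval _ _ _ _)); rewrite karval0.
move=> /(congr1 (fun M : ahom (asingle c1) (atens (asingle (c1 ⊗ c1)) (asingle (c1 ⊗ c1)))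
   => entry M tt (tt, tt))).
rewrite entry0 [kval _]/= entry_comp big_unit2.
rewrite entry_tens entry_comp big_unit !entryE => e0.
have := coef_alt_zigzag t; rewrite [X in coef X = _]e0.
rewrite /coef ffunE => /esym/eqP; rewrite mulf_eq0 invr_eq0 orbb.
by rewrite (pcharf0P K).1.
Qed.

Hypothesis t_not_int : ~ exists z : int, t = z%:~R.

Lemma alt_obj_tens_not_integral : ~ is_integral_type (alt_obj ⊗ alt_obj).
Proof.
move=> [_ _ H]; apply: t_not_int; apply: std_obj_euler.
have sV := std_obj_scalar_End (tN 1).
apply: H (scalar_End_simple sV).
apply: (scalar_End_summand (@rtc_pseudo_abelian _ (repS t)) _ sV std_to_alt2_neq0).
exact: repS_regular.
Qed.

End DeligneCategory.

Theorem mainTheorem3 (R : realType) :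
  (exists t : R[i],
     (~ exists z : int, t = z%:~R) /\
     exists X : repS t,
       [/\ is_simple X, is_integral_type X & ~ is_integral_type (X ⊗ X)]) /\
  ~ (forall A : rigidTensorCat R[i],
       scalar_unit A -> is_abelian A -> is_semisimple A ->
       forall X Y : A,
         is_integral_type X -> is_integral_type Y -> is_integral_type (X ⊗ Y)).
Proof.
have [t [t2 t_not_int]] : exists t : R[i],
    t * t = 3%:R * t + 2%:R /\ ~ exists z : int, t = z%:~R.
  pose t : R[i] := (3%:R + sqrtC 17%:R) / 2%:R; exists t.
  have t2 : t * t = 3%:R * t + 2%:R.
    have s2 : sqrtC 17%:R * sqrtC 17%:R = 17%:R :> R[i] by rewrite -expr2 sqrtCK.
    have -> : t * t = (9%:R + 6%:R * sqrtC 17%:R + sqrtC 17%:R * sqrtC 17%:R) / 4%:R.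
      by rewrite /t; field.
    by rewrite s2 /t; field.
  split=> // -[z tz]; move/eqP: t2; rewrite tz.
  rewrite -[3%:R]/(3%:~R) -[2%:R]/(2%:~R) -!intrM -intrD eqr_int => /eqP.
  (* The equation reads z (z - 3) = 2; the left side is at least 4 outside of 0, ..., 3 and at most
     0 on these four values. *)
  have [z4|z4] := lerP 4 z; first by nia.
  have [z0|z0] := lerP z (-1); first by nia.
  have : z = 0 \/ z = 1 \/ z = 2 \/ z = 3 by lia.
  by case=> [|[|[|]]] ->.
have charC : [pchar R[i]] =i pred0 by exact: pchar_num.
have tN n : t != n%:R.
  by apply/eqP => tn; apply: t_not_int; exists n%:Z; rewrite tn.
have iX := alt_obj_integral_type charC tN t2.
have niXX := alt_obj_tens_not_integral (charK := charC) (tN := tN) t_not_int.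
split; last first.
  move=> /(_ (repS t) (repS_scalar_unit t) (repS_abelian charC tN) (repS_semisimple charC tN)).
  by move=> /(_ _ _ iX iX).
exists t; split=> //; exists (alt_obj charC tN); split=> //.
apply: scalar_End_is_simple; first by move=> X Y; exact: repS_regular.
exact: alt_obj_scalar_End.
Qed.
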